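(* Let $n\ge1$, let $Q,B\in M_n(\mathbb{R})$ with $Q$ symmetric positive semi-definite, and let $P=\frac12\mathrm{Tr}(Q\nabla_x^2)+\langle Bx,\nabla_x\rangle$, $x\in\mathbb{R}^n$, be a hypoelliptic Ornstein-Uhlenbeck operator which is degenerate, i.e. $\det(Q)=0$, and which admits an invariant measure $d\mu(x)=\rho(x)\,dx$. Then for all $z\in\mathbb{C}$ with $\mathrm{Re}\,z>0$ and all $N\in\mathbb{N}$, $$\lim_{t\to+\infty}\frac{\big\|\big(P+\frac12\mathrm{Tr}(B)+tz\big)^{-1}\big\|_{\mathcal{L}(L^2_\mu)}}{t^N}=+\infty .$$
   Context: Notation: $\mathrm{Tr}(Q\nabla_x^2)=\sum_{i,j}q_{i,j}\partial^2_{x_i,x_j}$ and $\langle Bx,\nabla_x\rangle=\sum_{i,j}b_{i,j}x_j\partial_{x_i}$. Hypoellipticity of $P$ is known to be equivalent to the Kalman rank condition $\mathrm{Rank}[Q^{1/2},BQ^{1/2},\dots,B^{n-1}Q^{1/2}]=n$ (the $n\times n^2$ matrix obtained by juxtaposing these blocks), and also to $\det Q_t>0$ for some (equivalently all) $t>0$, where $Q_t=\int_0^te^{sB}Qe^{sB^T}ds$. Invariant measure: when hypoelliptic, $P$ generates the Markov semigroup $(T(t)f)(x)=\frac{1}{(2\pi)^{n/2}\sqrt{\det Q_t}}\int_{\mathbb{R}^n}e^{-\frac12\langle Q_t^{-1}y,y\rangle}f(e^{tB}x-y)\,dy$, $t>0$; an invariant measure is a probability measure $\mu$ with $\int T(t)f\,d\mu=\int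 f\,d\mu$ for all $t\ge0$ and all bounded continuous $f$. It is known that existence of an invariant measure is equivalent to $\sigma(B)\subset\{z\in\mathbb{C}:\mathrm{Re}\,z<0\}$, and then it is unique and given by $d\mu=\rho\,dx$ with $\rho(x)=\frac{1}{(2\pi)^{n/2}\sqrt{\det Q_\infty}}e^{-\frac12\langle Q_\infty^{-1}x,x\rangle}$, $Q_\infty=\int_0^{+\infty}e^{sB}Qe^{sB^T}ds$. $L^2_\mu=L^2(\mathbb{R}^n,d\mu)$ (complex valued functions). $P$ is regarded as the unbounded operator on $L^2_\mu$ with maximal domain $D(P)=\{u\in L^2_\mu: Pu\in L^2_\mu\}$. $\|\cdot\|_{\mathcal{L}(L^2_\mu)}$ is the operator norm of bounded operators on $L^2_\mu$, with the convention $\|(P-z)^{-1}\|=+\infty$ if $z\in\sigma(P)$. $\mathbb{N}$ is the set of non-negative integers. *)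

(* Defs.v *)
From HB Require Import structures.
From mathcomp Require Import all_boot all_order all_algebra.
From mathcomp Require Import all_classical all_reals all_analysis.
From mathcomp Require Import complex.

Set Implicit Arguments.
Unset Strict Implicit.
Unset Printing Implicit Defensive.

Import Order.TTheory GRing.Theory Num.Theory.
Import numFieldNormedType.Exports.

Local Open Scope classical_set_scope.
Local Open Scope ring_scope.
Local Open Scope complex_scope.

(* R^n is 'cV[R]_n. As for tuples and pairs in the library, it carries the
   product sigma-algebra, i.e. the one generated by the coordinate functions;
   on R^n this is the Borel sigma-algebra. *)
Section measurable_cV.
Context {R : realType}.
Variable n : nat.

Let coors : 'I_n -> 'cV[R]_n -> measurableTypeR R := fun i x => x i 0.

Let cV_set0 : g_sigma_preimage coors set0.
Proof. exact: sigma_algebra0. Qed.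

Let cV_setC A : g_sigma_preimage coors A -> g_sigma_preimage coors (~` A).
Proof. exact: sigma_algebraC. Qed.

Let cV_bigcup (F : _^nat) : (forall i, g_sigma_preimage coors (F i)) ->
  g_sigma_preimage coors (\bigcup_i (F i)).
Proof. exact: sigma_algebra_bigcup. Qed.

HB.instance Definition _ := @isMeasurable.Build default_measure_display
  'cV[R]_n (g_sigma_preimage coors) cV_set0 cV_setC cV_bigcup.

Lemma measurable_coord (i : 'I_n) :
  measurable_fun [set: 'cV[R]_n]
    (fun x : 'cV[R]_n => x i 0 : measurableTypeR R).
Proof.
move=> _ Y mY; rewrite setTI; apply: sub_sigma_algebra => /=.
rewrite -bigcup_seq/=; exists i => /=; first by rewrite mem_index_enum.
by exists Y => //; rewrite setTI.
Qed.

Lemma measurable_fun_coordP d (T : measurableType d) (f : T -> 'cV[R]_n) :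
  (forall i, measurable_fun [set: T] (fun x => f x i 0 : measurableTypeR R)) ->
  measurable_fun [set: T] f.
Proof.
move=> mf.
have H : g_sigma_preimage (fun i x => coors i (f x)) `<=` measurable.
  apply: smallest_sub; first exact: sigma_algebra_measurable.
  move=> A; rewrite -bigcup_seq/= => -[i _ [B mB <-]].
  by apply: mf.
move=> _ A mA; rewrite setTI; apply: H.
have := @g_sigma_preimage_comp _ (measurableTypeR R) n 'cV[R]_n coors T f.
rewrite /comp => ->; exists A => //; by rewrite setTI.
Qed.

End measurable_cV.

Section lebesgue_cV.
Context {R : realType}.

Definition consv n (p : measurableTypeR R * 'cV[R]_n) : 'cV[R]_n.+1 :=
  col_mx (const_mx p.1 : 'cV[R]_1) p.2.

Definition unconsv n (x : 'cV[R]_n.+1) : measurableTypeR R * 'cV[R]_n :=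
  (x ord0 0, \col_i x (lift ord0 i) 0).

Lemma consv0 n p : @consv n p ord0 0 = p.1.
Proof.
have -> : ord0 = lshift n (ord0 : 'I_1) by apply/val_inj.
by rewrite [LHS]col_mxEu mxE.
Qed.

Lemma consvS n p i : @consv n p (lift ord0 i) 0 = p.2 i 0.
Proof.
have -> : lift ord0 i = rshift 1 i by apply/val_inj.
by rewrite [LHS]col_mxEd.
Qed.

Lemma consvK n : cancel (@consv n) (@unconsv n).
Proof.
case=> a x; rewrite /unconsv consv0; congr pair.
by apply/colP => i; rewrite mxE consvS.
Qed.

Lemma measurable_consv n : measurable_fun setT (@consv n).
Proof.
apply: measurable_fun_coordP => i; have [j ->|->] := unliftP ord0 i.
  rewrite (_ : (fun x => _) = (fun x : 'cV[R]_n => x j 0) \o snd); last first.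
    by apply/funext => p /=; rewrite consvS.
  apply: measurableT_comp; first exact: measurable_coord.
  exact: measurable_snd.
rewrite (_ : (fun x => _) = fst); first exact: measurable_fst.
by apply/funext => p; rewrite consv0.
Qed.

Lemma measurable_unconsv n : measurable_fun setT (@unconsv n).
Proof.
apply/measurable_fun_pairP; split; first exact: measurable_coord.
apply: measurable_fun_coordP => i.
rewrite (_ : (fun x => _) = fun x : 'cV[R]_n.+1 => x (lift ord0 i) 0).
  exact: measurable_coord.
by apply/funext => x /=; rewrite mxE.
Qed.

Section step.
Variables (n : nat) (m : {sigma_finite_measure set 'cV[R]_n -> \bar R}).

Definition lebesgue_step : set 'cV[R]_n.+1 -> \bar R :=
  pushforward (lebesgue_measure \x m)%E (@consv n).

Let mconsv := @measurable_consv n.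

Let step0 : lebesgue_step set0 = 0%E.
Proof. by rewrite /lebesgue_step /pushforward preimage_set0 measure0. Qed.

Let step_ge0 A : (0 <= lebesgue_step A)%E.
Proof. exact: measure_ge0. Qed.

Let step_sigma_additive : semi_sigma_additive lebesgue_step.
Proof. exact: measure_semi_sigma_additive. Qed.

HB.instance Definition _ := isMeasure.Build _ _ _ lebesgue_step
  step0 step_ge0 step_sigma_additive.

Let step_sigma_finite : sigma_finite setT lebesgue_step.
Proof.
have /sigma_finiteP[F [FT ndF Foo]] := sigma_finiteT (@lebesgue_measure R).
have /sigma_finiteP[G [GT ndG Goo]] := sigma_finiteT m.
exists (fun k => @unconsv n @^-1` (F k `*` G k)).
  rewrite -preimage_bigcup -[LHS](preimage_setT (@unconsv n)); congr (_ @^-1` _).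
  rewrite -setXTT FT GT; apply/seteqP; split => -[a x] /=.
    move=> [[k _ Fka] [l _ Glx]]; exists (maxn k l) => //; split => /=.
    - by move: a Fka; exact/subsetPset/ndF/leq_maxl.
    - by move: x Glx; exact/subsetPset/ndG/leq_maxr.
  by move=> [k _ []/= ? ?]; split; exists k.
move=> k; have [mF Fk] := Foo k; have [mG Gk] := Goo k; split.
  rewrite -[X in measurable X]setTI.
  by apply: measurable_unconsv => //; exact: measurableX.
rewrite /lebesgue_step /pushforward -comp_preimage.
rewrite (_ : _ \o _ = id); last by apply/funext => p; exact: consvK.
by rewrite preimage_id product_measure1E// lte_mul_pinfty// ge0_fin_numE.
Qed.

HB.instance Definition _ := Measure_isSigmaFinite.Build _ _ _ lebesgue_step
  step_sigma_finite.

End step.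

(* n-fold product of the one-dimensional Lebesgue measure *)
Fixpoint lebesgue_cV n : {sigma_finite_measure set 'cV[R]_n -> \bar R} :=
  match n with
  | 0 => \d_(0 : 'cV[R]_0)
  | k.+1 => lebesgue_step (lebesgue_cV k)
  end.

Lemma lebesgue_cV_box n (a b : 'I_n -> R) : (forall i, a i <= b i) ->
  lebesgue_cV n [set x | forall i, a i <= x i 0 <= b i] =
  (\prod_(i < n) (b i - a i))%:E.
Proof.
elim: n a b => [|n IH] a b ab.
  by rewrite big_ord0 /= diracE mem_set// => -[].
rewrite big_ord_recl EFinM -(IH (a \o lift ord0) (b \o lift ord0)); last first.
  by move=> i; exact: ab.
rewrite [LHS]/= /lebesgue_step /pushforward.
pose B := [set x : 'cV[R]_n | forall i, (a \o lift ord0) i <= x i 0 <=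
  (b \o lift ord0) i].
rewrite -/B.
have -> : @consv n @^-1` [set x | forall i, a i <= x i 0 <= b i] =
    [set` `[a ord0, b ord0]%R] `*` B.
  apply/seteqP; split => [[u x] /= H|[u x] /= [H0 H] i].
    split; first by have := H ord0; rewrite consv0 in_itv.
    by move=> i; have := H (lift ord0 i); rewrite consvS.
  have [j ->|->] := unliftP ord0 i; first by rewrite consvS; exact: H.
  by rewrite consv0; move: H0; rewrite in_itv.
rewrite product_measure1E//=; last first.
  have -> : B = \bigcap_(i in [set: 'I_n])
      [set x : 'cV[R]_n | [set` `[a (lift ord0 i), b (lift ord0 i)]%R] (x i 0)].
    by apply/seteqP; split => x /= H i; have := H i; rewrite /= in_itv//=; apply.
  apply: fin_bigcap_measurable => // i _.
  rewrite -[X in measurable X]setTI.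
  by apply: (@measurable_coord R n i) => //; exact: measurable_itv.
congr (_ * _)%E; rewrite lebesgue_measure_itv/= lte_fin.
have := ab ord0; rewrite le_eqVlt => /orP[/eqP ->|->//].
by rewrite ltxx subrr.
Qed.

End lebesgue_cV.
Arguments lebesgue_cV : clear implicits.

Section differential_calculus.
Context {R : realType} {n : nat}.
Local Notation E := 'cV[R]_n.

Definition partial (i : 'I_n) (f : E -> R) : E -> R :=
  fun x => 'D_(delta_mx i 0) f x.

Definition partials (s : seq 'I_n) (f : E -> R) : E -> R :=
  foldr partial f s.

Definition smooth (U : set E) (f : E -> R) : Prop :=
  forall (s : seq 'I_n) (x : E), U x ->
    {for x, continuous (partials s f)} /\
    (forall i, derivable (partials s f) x (delta_mx i 0)).

Definition csmooth (U : set E) (f : E -> R[i]) : Prop :=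
  smooth U (fun x => complex.Re (f x)) /\ smooth U (fun x => complex.Im (f x)).

End differential_calculus.

(* Complex valued distributions on an open set U of R^n.  They are given by
   their values on real valued test functions, to which they are R-linear;
   this determines their C-linear extension to complex valued ones. *)
Section distributions.
Context {R : realType} {n : nat}.
Local Notation E := 'cV[R]_n.

Definition test_on (K : set E) (phi : E -> R) : Prop :=
  smooth setT phi /\ (forall x, ~ K x -> phi x = 0).

Definition test_function (U : set E) (phi : E -> R) : Prop :=
  exists K : set E, [/\ compact K, K `<=` U & test_on K phi].

(* The second clause is continuity: on each compact K, T is bounded by a C^k
   norm, any upper bound M of which is allowed. *)
Definition distribution_on (U : set E) (T : (E -> R) -> R[i]) : Prop :=
  (forall (a : R) (phi psi : E -> R),
     test_function U phi -> test_function U psi ->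
     T (fun x => a * phi x + psi x) = a%:C * T phi + T psi) /\
  (forall K : set E, compact K -> K `<=` U ->
     exists (C : R) (k : nat), forall (phi : E -> R) (M : R),
       test_on K phi ->
       (forall (s : seq 'I_n) x, (size s <= k)%N -> `|partials s phi x| <= M) ->
       ComplexField.Normc.normc (T phi) <= C * M).

(* For f given on an open set U only, phi vanishes outside U, so that the values
   of f there are irrelevant. *)
Definition distr_of (f : E -> R[i]) : (E -> R) -> R[i] := fun phi =>
  (\int[lebesgue_cV R n]_x (complex.Re (f x) * phi x))
  +i* (\int[lebesgue_cV R n]_x (complex.Im (f x) * phi x)).

Definition distr_partial (i : 'I_n) (T : (E -> R) -> R[i]) :
  (E -> R) -> R[i] := fun phi => - T (partial i phi).

Definition distr_mul (a : E -> R) (T : (E -> R) -> R[i]) :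
  (E -> R) -> R[i] := fun phi => T (fun x => a x * phi x).

Definition distr_eq_on (U : set E) (S T : (E -> R) -> R[i]) : Prop :=
  forall phi, test_function U phi -> S phi = T phi.

End distributions.

Section ornstein_uhlenbeck.
Context {R : realType} {n : nat}.
Local Notation E := 'cV[R]_n.
Variables Q B : 'M[R]_n.

(* P = 1/2 Tr(Q nabla^2) + <Bx, nabla>, acting on distributions; only the values
   of T at test functions are relevant. *)
Definition OU (T : (E -> R) -> R[i]) : (E -> R) -> R[i] := fun phi =>
  (2^-1)%:C *
    (\sum_i \sum_j (Q i j)%:C * distr_partial i (distr_partial j T) phi) +
  \sum_i \sum_j
    (B i j)%:C * distr_mul (fun x => x j 0) (distr_partial i T) phi.

Definition OU_hypoelliptic : Prop :=
  forall (U : set E) (T : (E -> R) -> R[i]) (v : E -> R[i]),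
    open U -> distribution_on U T -> csmooth U v ->
    distr_eq_on U (OU T) (distr_of v) ->
    exists2 w : E -> R[i], csmooth U w & distr_eq_on U T (distr_of w).

End ornstein_uhlenbeck.

Section invariant_measure.
Context {R : realType} {n : nat}.
Local Notation E := 'cV[R]_n.

Definition expmx (A : 'M[R]_n) : 'M[R]_n :=
  limn (fun N => \sum_(0 <= k < N) (k`!%:R^-1 : R) *: A ^+ k).

Definition dotv (x y : E) : R := \sum_i x i 0 * y i 0.

Variables Q B : 'M[R]_n.

Definition Qt (t : R) : 'M[R]_n := \matrix_(i, j)
  \int[lebesgue_measure]_(s in `[0, t])
    ((expmx (s *: B) *m Q *m expmx (s *: B^T)) i j).

Definition OU_semigroup (t : R) (f : E -> R) : E -> R := fun x =>
  ((2 * pi) `^ (n%:R / 2) * Num.sqrt (\det (Qt t)))^-1 *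
  \int[lebesgue_cV R n]_y
    (expR (- (2^-1 * dotv (invmx (Qt t) *m y) y)) *
     f (expmx (t *: B) *m x - y)).

(* t = 0 is omitted since T(0) is the identity (OU_semigroup is meaningful for
   t > 0 only); complex valued f reduce to real valued ones by linearity. *)
Definition OU_invariant (mu : probability E R) : Prop :=
  forall (t : R) (f : E -> R), 0 < t -> continuous f -> bounded_fun f ->
    \int[mu]_x OU_semigroup t f x = \int[mu]_x f x.

End invariant_measure.

(* Unbounded operators on L^2(mu) = L^2(mu; C), as graphs on representatives:
   A u v means that the class of u is in the domain and is mapped to that of v *)
Section resolvent.
Context {R : realType} {d : measure_display} {T : measurableType d}.
Variable mu : {measure set T -> \bar R}.

Definition normL2 (f : T -> R[i]) : \bar R :=
  Lnorm mu 2%:E (fun x => (ComplexField.Normc.normc (f x))%:E).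

Definition in_L2 (f : T -> R[i]) : Prop :=
  [/\ measurable_fun setT (fun x => complex.Re (f x) : measurableTypeR R),
      measurable_fun setT (fun x => complex.Im (f x) : measurableTypeR R) &
      (normL2 f < +oo)%E].

Variable A : (T -> R[i]) -> (T -> R[i]) -> Prop.

Definition in_resolvent_set (z : R[i]) : Prop :=
  [/\ (forall f, in_L2 f ->
         exists u v, A u v /\ {ae mu, forall x, v x - z * u x = f x}),
      (forall u v, A u v -> {ae mu, forall x, v x - z * u x = 0} ->
         {ae mu, forall x, u x = 0}) &
      (exists C : R, forall u v, A u v ->
         (normL2 u <= C%:E * normL2 (fun x => v x - z * u x)%R)%E)].

(* operator norm of (A - z)^-1, +oo on the spectrum *)
Definition resolvent_norm (z : R[i]) : \bar R :=
  if `[< in_resolvent_set z >] then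
    ereal_sup [set y | exists u v,
      [/\ A u v, (normL2 (fun x => v x - z * u x)%R <= 1)%E & y = normL2 u]]
  else +oo%E.

End resolvent.

(* maximal realization of P on L^2(mu), Pu being taken in distributions *)
Definition OU_L2 (R : realType) (n : nat) (Q B : 'M[R]_n)
    (mu : {measure set 'cV[R]_n -> \bar R}) (u v : 'cV[R]_n -> R[i]) : Prop :=
  [/\ in_L2 mu u, in_L2 mu v &
      distr_eq_on setT (OU Q B (distr_of u)) (distr_of v)].

(* Main.v *)
(* The invariant measure is a centred Gaussian whose covariance C solves the
   Lyapunov equation <C x, B^T x> = - <Q x, x> / 2.  If zeta' = B^T zeta, this
   equation makes
     g(s, x) = exp ((tau + t z) s + <zeta(s), x> - <C zeta(s), zeta(s)> / 2),
   tau = Tr B / 2, a solution of P g = dg/ds - (tau + t z) g, so that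
   u = int_(-d)^d g(s) ds satisfies (P + tau + t z) u = g(d) - g(-d).
   As det Q = 0 and the measure is nondegenerate, some eta has Q eta = 0 and
   Q B^T eta <> 0.  Taking zeta(0) = sqrt t (a eta + b B^T eta + i c eta) with
   suitable a, b, c, the inner products <g(s), g(0)> behave like exp (- k t s^2),
   whence |u| >= c / t, while |g(d)| and |g(-d)| are exponentially small in t. *)
Require Import Defs.
From mathcomp Require Import all_boot all_order all_algebra.
From mathcomp Require Import all_classical all_reals all_analysis.
From mathcomp Require Import complex.
From mathcomp Require Import measurable_realfun.
From mathcomp Require Import ring lra.

Import Order.TTheory GRing.Theory Num.Theory.
Import numFieldNormedType.Exports.

Local Open Scope classical_set_scope.
Local Open Scope ring_scope.
Local Open Scope complex_scope.

Set Implicit Arguments.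
Unset Strict Implicit.
Unset Printing Implicit Defensive.

(** * Integrals and derivatives of real functions *)

(** The measure is known only through an identity for bounded continuous functions, so its Gaussian
    law is read off that identity. Tested with 1 it normalizes the kernel; tested with cosines it
    bounds the forms of S_t = [Qt Q B t] as t grows. Their limit C satisfies C = S_t + exp(tB) C
    exp(tB^T), which yields the decay of the flow and the Lyapunov equation without any spectral
    argument on B. The curve is dictated by d/ds ln |g(s)|^2 = 2 Re(tau + t z) - <Q zeta, conj
    zeta>, where |g(s)| is the norm in L^2. Small ends g(d) and g(-d) require this to go from
    positive to negative at s = 0: there <Q zeta, conj zeta> must balance 2 t Re z and be
    increasing. The vector eta makes this possible for every z with Re z > 0: a multiple of eta in
    zeta(0) does not change <Q zeta, conj zeta> at s = 0, but contributes to its derivative through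
    Q B^T eta, as strongly as desired. Frequencies of size sqrt t make all quadratic quantities
    proportional to t. Complex exponentials are carried as real functions with a phase th: th = 0
    and th = - pi / 2 give the real and imaginary parts. *)

Section real_integral.
Context d (T : measurableType d) (R : realType).
Variable mu : {measure set T -> \bar R}.

Lemma integrable_indic_lty (A : set T) : measurable A -> (mu A < +oo)%E ->
  mu.-integrable [set: T] (fun x => (\1_A x)%:E).
Proof.
move=> mA Aoo; apply/integrableP; split; first exact/measurable_EFinP.
rewrite (eq_integral (fun x => (\1_A x)%:E)); last first.
  by move=> x _; rewrite gee0_abs.
by rewrite integral_indic// setIT.
Qed.

Lemma le_integrableR (f g : T -> R) : measurable_fun [set: T] f ->
  (forall x, `|f x| <= g x) -> mu.-integrable [set: T] (EFin \o g) ->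
  mu.-integrable [set: T] (EFin \o f).
Proof.
move=> mf fg; apply: le_integrable => //; first exact/measurable_EFinP.
by move=> x _ /=; rewrite lee_fin (le_trans (fg x))// ler_norm.
Qed.

Lemma dominated_Rintegral (f_ : nat -> T -> R) (f g : T -> R) :
  (forall k, measurable_fun [set: T] (f_ k)) ->
  (forall x, f_ k x @[k --> \oo] --> f x) ->
  mu.-integrable [set: T] (EFin \o g) ->
  (forall k x, `|f_ k x| <= g x) ->
  mu.-integrable [set: T] (EFin \o f) /\
  \int[mu]_x f_ k x @[k --> \oo] --> \int[mu]_x f x.
Proof.
move=> mf_ ff ig fg.
have mf : measurable_fun [set: T] f by apply: (measurable_fun_cvg mf_) => x _; exact: ff.
have [|||||intf _ H] := @dominated_convergence _ _ _ mu _ measurableT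
  (fun k x => (f_ k x)%:E) (EFin \o f) (EFin \o g).
- by move=> k; exact/measurable_EFinP.
- exact/measurable_EFinP.
- by apply: aeW => x _; apply: cvg_EFin; [exact: nearW|exact: ff].
- exact: ig.
- by apply: aeW => x k _; rewrite /= lee_fin.
split => //; apply: fine_cvg; rewrite /= in H.
by rewrite fineK; [exact: H|exact: integrable_fin_num].
Qed.

Lemma eq_integrableR (f g : T -> R) : (forall x, f x = g x) ->
  mu.-integrable [set: T] (EFin \o f) -> mu.-integrable [set: T] (EFin \o g).
Proof. by move=> fg; rewrite (_ : f = g)//; apply/funext. Qed.

Lemma integrableRZ (c : R) (f : T -> R) : mu.-integrable [set: T] (EFin \o f) ->
  mu.-integrable [set: T] (EFin \o (fun x => c * f x)).
Proof.
by move=> H; rewrite /comp; under eq_fun do rewrite EFinM; exact: integrableZl.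
Qed.

Lemma integrableRD (f g : T -> R) : mu.-integrable [set: T] (EFin \o f) ->
  mu.-integrable [set: T] (EFin \o g) ->
  mu.-integrable [set: T] (EFin \o (fun x => f x + g x)).
Proof.
by move=> H K; rewrite /comp; under eq_fun do rewrite EFinD; exact: integrableD.
Qed.

Lemma integrableRB (f g : T -> R) : mu.-integrable [set: T] (EFin \o f) ->
  mu.-integrable [set: T] (EFin \o g) ->
  mu.-integrable [set: T] (EFin \o (fun x => f x - g x)).
Proof.
by move=> H K; rewrite /comp; under eq_fun do rewrite EFinB; exact: integrableB.
Qed.

Lemma integrableR_measurable (f : T -> R) : mu.-integrable [set: T] (EFin \o f) ->
  measurable_fun [set: T] f.
Proof. by move=> /integrableP[/measurable_EFinP]. Qed.

Lemma integrableR_norm (f : T -> R) : mu.-integrable [set: T] (EFin \o f) ->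
  mu.-integrable [set: T] (EFin \o (fun x => `|f x|)).
Proof. exact: integrable_norm. Qed.

End real_integral.

Section probability_cst.
Context d (T : measurableType d) (R : realType).
Variable mu : probability T R.

Lemma Rintegral_probability_cst (c : R) : \int[mu]_x cst c x = c.
Proof.
rewrite (_ : (fun x => cst c x) = (fun=> c))// Rintegral_cst//.
by rewrite [X in fine X](@probability_setT _ _ _ mu) mulr1.
Qed.

Lemma integrable_probability_cst (c : R) : mu.-integrable [set: T] (EFin \o cst c).
Proof. exact: finite_measure_integrable_cst. Qed.

Lemma integrable_probability_bounded (f : T -> R) (M : R) :
  measurable_fun [set: T] f -> (forall x, `|f x| <= M) ->
  mu.-integrable [set: T] (EFin \o f).
Proof. by move=> mf fM; apply: le_integrableR mf fM (integrable_probability_cst M). Qed.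

End probability_cst.

Section real_limits.
Context {R : realType} (I : Type) (F : set_system I) {FF : Filter F}.
Implicit Types (u : I -> R) (l : R).

Lemma cvg_expR u l : u x @[x --> F] --> l -> expR (u x) @[x --> F] --> expR l.
Proof. by move=> ul; apply: continuous_cvg => //; exact: continuous_expR. Qed.

Lemma cvg_cos u l : u x @[x --> F] --> l -> cos (u x) @[x --> F] --> cos l.
Proof. by move=> ul; apply: continuous_cvg => //; exact: continuous_cos. Qed.

End real_limits.

Lemma cvg_natSinv (R : realType) : k.+1%:R^-1 @[k --> \oo] --> (0 : R).
Proof.
apply/cvgrPdist_lt => e e0; near=> k.
rewrite sub0r normrN gtr0_norm//; near: k.
exact: near_infty_natSinv_lt (PosNum e0).
Unshelve. all: by end_near. Qed.

Section real_derivatives.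
Context {R : realType}.
Implicit Types (f g : R -> R) (x a b : R).

(* not a type class, unlike is_derive: applying the rules below must not
   trigger instance search *)
Definition has_deriv f x a : Prop := is_derive x 1 f a.

Lemma has_deriv_eq f x a b : has_deriv f x a -> a = b -> has_deriv f x b.
Proof. by move=> ? <-. Qed.

Lemma has_derivD f g x a b : has_deriv f x a -> has_deriv g x b ->
  has_deriv (fun t => f t + g t) x (a + b).
Proof. by move=> fa gb; exact: is_deriveD. Qed.

Lemma has_derivB f g x a b : has_deriv f x a -> has_deriv g x b ->
  has_deriv (fun t => f t - g t) x (a - b).
Proof. by move=> fa gb; exact: is_deriveB. Qed.

Lemma has_derivM f g x a b : has_deriv f x a -> has_deriv g x b ->
  has_deriv (fun t => f t * g t) x (a * g x + f x * b).
Proof.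
move=> fa gb; apply: (has_deriv_eq (is_deriveM fa gb)).
by rewrite addrC [X in X + _]mulrC.
Qed.

Lemma has_deriv_cst x (c : R) : has_deriv (fun=> c) x 0.
Proof. exact: is_derive_cst. Qed.

Lemma has_deriv_id x : has_deriv id x 1.
Proof. exact: is_derive_id. Qed.

Lemma has_derivZ f x a (c : R) : has_deriv f x a ->
  has_deriv (fun t => c * f t) x (c * a).
Proof.
move=> fa; apply: (has_deriv_eq (has_derivM (has_deriv_cst x c) fa)).
by rewrite mul0r add0r.
Qed.

Lemma has_deriv_mull x (c : R) : has_deriv (fun t => c * t) x c.
Proof. by apply: (has_deriv_eq (has_derivZ c (has_deriv_id x))); rewrite mulr1. Qed.

Lemma has_deriv_mulr x (c : R) : has_deriv (fun t => t * c) x c.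
Proof.
rewrite (_ : (fun t => _) = (fun t => c * t)); first exact: has_deriv_mull.
by apply/funext => t; rewrite mulrC.
Qed.

Lemma has_deriv_comp f g x a b : has_deriv f (g x) a -> has_deriv g x b ->
  has_deriv (fun t => f (g t)) x (a * b).
Proof. by move=> fa gb; exact: (is_derive1_comp fa gb). Qed.

Lemma has_deriv_exp f x a : has_deriv f x a ->
  has_deriv (fun t => expR (f t)) x (expR (f x) * a).
Proof. by move=> fa; exact: (is_derive1_comp (is_derive_expR _) fa). Qed.

Lemma has_deriv_cos f x a : has_deriv f x a ->
  has_deriv (fun t => cos (f t)) x (- sin (f x) * a).
Proof. by move=> fa; exact: (is_derive1_comp (is_derive_cos _) fa). Qed.

Lemma has_deriv_sin f x a : has_deriv f x a ->
  has_deriv (fun t => sin (f t)) x (cos (f x) * a).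
Proof. by move=> fa; exact: (is_derive1_comp (is_derive_sin _) fa). Qed.

Lemma has_deriv_sum (I : Type) (s : seq I) (F : I -> R -> R) (dF : I -> R) x :
  (forall i, has_deriv (F i) x (dF i)) ->
  has_deriv (fun t => \sum_(i <- s) F i t) x (\sum_(i <- s) dF i).
Proof.
move=> H; elim: s => [|i s IH].
  rewrite big_nil (_ : (fun t => _) = fun=> 0); first exact: has_deriv_cst.
  by apply/funext => t; rewrite big_nil.
rewrite big_cons (_ : (fun t => _) = fun t => F i t + \sum_(j <- s) F j t).
  exact: has_derivD.
by apply/funext => t; rewrite big_cons.
Qed.

Lemma has_deriv_unique f x a b : has_deriv f x a -> has_deriv f x b -> a = b.
Proof. by move=> [_ <-] [_ <-]. Qed.

Lemma has_deriv_continuous f x a : has_deriv f x a -> {for x, continuous f}.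
Proof. by move=> [fx _]; apply: differentiable_continuous; exact/derivable1_diffP. Qed.

Lemma has_deriv_near_eq f g x a : (\forall t \near x, g t = f t) ->
  has_deriv g x a -> has_deriv f x a.
Proof.
move=> fg [H1 H2]; split; last by rewrite -H2; apply/esym/near_eq_derive.
by move: H1; apply: near_eq_derivable => //; exact: oner_neq0.
Qed.

Lemma has_deriv_MVT f df a b : a < b -> (forall x, has_deriv f x (df x)) ->
  exists2 c, a < c < b & f b - f a = df c * (b - a).
Proof.
move=> ab Hf; have [||c] := @MVT R f df a b ab.
- by move=> x _; exact: Hf.
- by apply: continuous_subspaceT => x; exact: has_deriv_continuous (Hf x).
- by rewrite in_itv /= => abc E; exists c.
Qed.

Lemma normr_sin_le1 x : `|sin x| <= 1.
Proof. by rewrite ler_norml sin_geN1 sin_le1. Qed.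

Lemma normr_cos_le1 x : `|cos x| <= 1.
Proof. by rewrite ler_norml cos_geN1 cos_le1. Qed.

Lemma measurable_sin : measurable_fun [set: R] (@sin R).
Proof. by apply: continuous_measurable_fun; exact: continuous_sin. Qed.

Lemma measurable_cos : measurable_fun [set: R] (@cos R).
Proof. by apply: continuous_measurable_fun; exact: continuous_cos. Qed.

End real_derivatives.

(** * Lebesgue measure on R^n *)

Section continuous_measurable.
Context {R : realType} {n : nat}.

Let grid (k : nat) (p : 'cV[int]_n) : 'cV[R]_n := \col_i ((p i 0)%:~R / k.+1%:R).
Let cell (k : nat) (x : 'cV[R]_n) : 'cV[int]_n :=
  \col_i Num.floor (k.+1%:R * x i 0).

Let measurable_cell k p : measurable [set x | cell k x = p].
Proof.
have -> : [set x | cell k x = p] = \bigcap_(i in [set: 'I_n])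
    [set x : 'cV[R]_n | [set` `[(p i 0)%:~R, (p i 0 + 1)%:~R[%R] (k.+1%:R * x i 0)].
  apply/seteqP; split => x /=.
    move=> <- i _ /=; rewrite in_itv/= mxE.
    by rewrite floor_le_tmp/= floorD1_gt.
  move=> H; apply/colP => i; rewrite mxE; apply: floor_def.
  by have := H i I; rewrite /= in_itv.
apply: fin_bigcap_measurable => // i _.
rewrite -[X in measurable X]setTI.
apply: (@measurable_funM _ _ R setT (cst k.+1%:R) (fun x : 'cV[R]_n => x i 0)) => //.
exact: measurable_coord.
Qed.

Let grid_cell_cvg (x : 'cV[R]_n) : grid k (cell k x) @[k --> \oo] --> x.
Proof.
apply/cvgrPdist_lt => e e0.
near=> k.
rewrite [ltLHS]mx_normrE.
apply/bigmax_ltP; split => //= -[i j] _ /=; rewrite !mxE (ord1 j).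
rewrite ltr_norml; apply/andP.
have k0 : (0 : R) < k.+1%:R by [].
have Hk : k.+1%:R^-1 < e by near: k; exact: near_infty_natSinv_lt (PosNum e0).
set a := k.+1%:R * x i 0.
have H1 : (Num.floor a)%:~R <= a by exact: floor_le_tmp.
have H2 : a < (Num.floor a + 1)%:~R by exact: floorD1_gt.
have -> : x i 0 = a / k.+1%:R by rewrite /a mulrC mulKf// gt_eqF.
rewrite -mulrBl; split.
  rewrite (@lt_le_trans _ _ 0) ?oppr_lt0// mulr_ge0 ?subr_ge0//.
apply: lt_trans Hk; rewrite -[ltRHS]mul1r ltr_pM2r ?invr_gt0//.
by move: H2; rewrite intrD; lra.
Unshelve. all: by end_near. Qed.

(** The sigma-algebra is generated by the coordinates, not by the open sets. Hence f is written as
    the pointwise limit of step functions, constant on the countably many cubes of side 1 / (k + 1),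
    each of which is a finite intersection of coordinate conditions. *)
Lemma continuous_measurable_cV (f : 'cV[R]_n -> R) : continuous f ->
  measurable_fun [set: 'cV[R]_n] f.
Proof.
move=> cf.
apply: (@measurable_fun_cvg _ _ _ _
  (fun k x => f (grid k (cell k x)))).
  move=> k _ Y mY; rewrite setTI.
  have -> : (fun x => f (grid k (cell k x))) @^-1` Y =
      \bigcup_p (if p \in [set p | Y (f (grid k p))] then [set x | cell k x = p] else set0).
    apply/seteqP; split => x /=.
      by move=> H; exists (cell k x) => //; rewrite mem_set.
    by move=> [p _]; case: ifPn => //; rewrite inE/= => H ->.
  apply: countable_bigcupT_measurable.
    exact: countableP.
  by move=> p; case: ifPn => // _; exact: measurable_cell.
move=> x _.
have H : f (grid k (cell k x)) @[k --> \oo] --> f x.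
  by apply: continuous_cvg; [exact: cf|exact: grid_cell_cvg].
exact: H.
Qed.

End continuous_measurable.

Section lebesgue_translation.
Context {R : realType}.

Lemma lebesgue_measure_shift (a : R) (A : set R) : measurable A ->
  pushforward lebesgue_measure
    ((fun x : R => x + a) : _ -> measurableTypeR R) A = lebesgue_measure A.
Proof.
have ma : measurable_fun [set: R] ((fun x : R => x + a) : _ -> measurableTypeR R).
  exact: measurable_funD.
move=> mA; apply/esym.
pose H := MeasurableFun.Pack (MeasurableFun.Class (isMeasurableFun.Build _ _ _ _ _ ma)).
apply: (@lebesgue_measure_unique R (pushforward lebesgue_measure H)) => //= _ [[x y]] _ <-.
rewrite /pushforward/= (_ : _ @^-1` _ = `]x - a, y - a]%classic); last first.
  by apply/seteqP; split => z /=; rewrite !in_itv/= => /andP[? ?]; apply/andP; split; lra.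
rewrite !lebesgue_measure_itv/= !lte_fin ltrD2r -!EFinB.
by case: ifPn => // _; congr EFin; lra.
Qed.

Lemma ge0_integral_shift (a : R) (f : R -> \bar R) : measurable_fun [set: R] f ->
  (forall x, 0 <= f x)%E ->
  (\int[lebesgue_measure]_x f (x + a)%R = \int[lebesgue_measure]_x f x)%E.
Proof.
move=> mf f0.
have ma : measurable_fun [set: R] ((fun x : R => x + a) : _ -> measurableTypeR R).
  exact: measurable_funD.
have := @ge0_integral_pushforward _ _ (measurableTypeR R) (measurableTypeR R) R _ ma
  lebesgue_measure setT f measurableT mf
  (fun x _ => f0 x).
rewrite preimage_setT /= => <-.
apply: eq_measure_integral => A mA _; exact: lebesgue_measure_shift.
Qed.

Lemma measurable_addcV n (a : 'cV[R]_n) : measurable_fun [set: 'cV[R]_n] (fun x : 'cV[R]_n => x + a).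
Proof.
apply: measurable_fun_coordP => i.
rewrite (_ : (fun _ => _) = (fun x : 'cV[R]_n => x i 0 + a i 0)); last first.
  by apply/funext => x; rewrite mxE.
by apply: measurable_funD => //; exact: measurable_coord.
Qed.

Lemma ge0_integral_consv n (f : 'cV[R]_n.+1 -> \bar R) : measurable_fun [set: 'cV[R]_n.+1] f ->
  (forall x, 0 <= f x)%E ->
  (\int[lebesgue_cV R n.+1]_x f x =
   \int[lebesgue_measure]_a \int[lebesgue_cV R n]_x f (consv (a, x)))%E.
Proof.
move=> mf f0.
rewrite [LHS](@ge0_integral_pushforward _ _ _ _ R _ (@measurable_consv R n) _ setT f)//.
rewrite preimage_setT (fubini_tonelli1 (f \o @consv R n))//; last first.
  by move=> x; exact: f0.
by apply: measurableT_comp => //; exact: measurable_consv.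
Qed.

(** Induction on the dimension: Tonelli splits off the first coordinate, where the one-dimensional
    translation invariance applies. *)
Lemma ge0_integral_cV_shift n (a : 'cV[R]_n) (f : 'cV[R]_n -> \bar R) :
  measurable_fun [set: 'cV[R]_n] f -> (forall x, 0 <= f x)%E ->
  (\int[lebesgue_cV R n]_x f (x + a)%R = \int[lebesgue_cV R n]_x f x)%E.
Proof.
elim: n a f => [|n IH] a f mf f0.
  by apply: eq_integral => x _; congr f; apply/colP => -[].
have mfa : measurable_fun [set: 'cV[R]_n.+1] (fun x => f (x + a)).
  by apply: measurableT_comp => //; exact: measurable_addcV.
rewrite [LHS]ge0_integral_consv; [|exact: mfa|by move=> x; exact: f0].
rewrite [RHS]ge0_integral_consv; [|exact: mf|exact: f0].
set u := (unconsv a).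
have E b x : consv (b, x) + a = consv (b + u.1, x + u.2).
  apply/colP => i; rewrite mxE; have [j ->|->] := unliftP ord0 i.
    by rewrite !consvS !mxE.
  by rewrite !consv0.
under eq_integral => b _.
  under eq_integral do rewrite E.
  rewrite (IH u.2 (fun x => f (consv (b + u.1, x))))//; last first.
    apply: measurableT_comp => //.
    by apply: (measurableT_comp (@measurable_consv R n)) => //; exact: pair1_measurable.
  over.
rewrite (ge0_integral_shift u.1 (f := fun b => \int[lebesgue_cV R n]_x f (consv (b, x)))%E)//.
- apply: (measurable_fun_fubini_tonelli_F (f \o @consv R n)) => //.
  by apply: measurableT_comp => //; exact: measurable_consv.
- by move=> [b x]; exact: f0.
- by move=> b; apply: integral_ge0 => x _; exact: f0.
Qed.

Lemma integral_cV_shift n (a : 'cV[R]_n) (f : 'cV[R]_n -> \bar R) :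
  measurable_fun [set: 'cV[R]_n] f ->
  (\int[lebesgue_cV R n]_x f (x + a)%R = \int[lebesgue_cV R n]_x f x)%E.
Proof.
move=> mf; rewrite [LHS]integralE [RHS]integralE; congr (_ - _)%E.
  rewrite (funepos_comp f (fun x : 'cV[R]_n => x + a)).
  exact: (ge0_integral_cV_shift a (measurable_funepos mf) (fun x => funepos_ge0 f x)).
rewrite (funeneg_comp f (fun x : 'cV[R]_n => x + a)).
exact: (ge0_integral_cV_shift a (measurable_funeneg mf) (fun x => funeneg_ge0 f x)).
Qed.

Lemma Rintegral_cV_shift n (a : 'cV[R]_n) (f : 'cV[R]_n -> R) :
  measurable_fun [set: 'cV[R]_n] f ->
  \int[lebesgue_cV R n]_x f (x + a)%R = \int[lebesgue_cV R n]_x f x.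
Proof.
move=> mf; rewrite /Rintegral (integral_cV_shift a (f := fun x => (f x)%:E))//.
exact/measurable_EFinP.
Qed.

End lebesgue_translation.

Section compact_support.
Context {R : realType} {n : nat}.
Local Notation E := 'cV[R]_n.

Lemma compact_continuous_bounded (K : set E) (f : E -> R) : compact K ->
  continuous f -> exists2 C : R, 0 <= C & forall x, K x -> `|f x| <= C.
Proof.
move=> cK cf.
have cfK : compact (f @` K).
  by apply: continuous_compact => //; apply: continuous_subspaceT.
have [M [_ HM]] := compact_bounded cfK.
exists (`|M| + 1); first by rewrite addr_ge0.
move=> x Kx; apply: (HM (`|M| + 1)); last by exists x.
by rewrite (le_lt_trans (ler_norm M))// ltrDl.
Qed.

Definition cV_box (r : R) : set E := [set x | forall j, - r <= x j 0 <= r].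

Lemma cV_coord_continuous (j : 'I_n) : continuous (fun x : E => x j 0).
Proof. exact: coord_continuous. Qed.

Lemma compact_sub_box (K : set E) : compact K ->
  exists2 r : R, 0 <= r & K `<=` cV_box r.
Proof.
move=> cK.
have H (j : 'I_n) : exists r : R, 0 <= r /\ forall x, K x -> `|x j 0| <= r.
  have [C C0 HC] := compact_continuous_bounded cK (@cV_coord_continuous j).
  by exists C.
have [r Hr] := choice H.
exists (\sum_j r j); first by apply: sumr_ge0 => j _; case: (Hr j).
move=> x Kx j /=; rewrite -ler_norml.
apply: (le_trans ((Hr j).2 x Kx)).
rewrite (bigD1 j)//= lerDl; apply: sumr_ge0 => k _; by case: (Hr k).
Qed.

Lemma measurable_cV_box (r : R) : measurable (cV_box r).
Proof.
have -> : cV_box r = \bigcap_(i in [set: 'I_n])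
    [set x : E | [set` `[- r, r]%R] (x i 0)].
  apply/seteqP; split => x /= H i; first by move=> _; have := H i; rewrite /= in_itv.
  by have := H i I; rewrite /= in_itv.
apply: fin_bigcap_measurable => // i _.
rewrite -[X in measurable X]setTI.
by apply: (@measurable_coord R n i) => //; exact: measurable_itv.
Qed.

Lemma lebesgue_cV_box_lty (r : R) : 0 <= r -> (lebesgue_cV R n (cV_box r) < +oo)%E.
Proof.
move=> r0.
have -> : cV_box r = [set x | forall i, (fun=> - r) i <= x i 0 <= (fun=> r) i] by [].
rewrite lebesgue_cV_box ?ltry// => i; lra.
Qed.

Lemma bounded_box_integrable (f : E -> R) (r C : R) : 0 <= r ->
  measurable_fun [set: E] f -> (forall x, `|f x| <= C * \1_(cV_box r) x) ->
  (lebesgue_cV R n).-integrable [set: E] (EFin \o f).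
Proof.
move=> r0 mf fC; apply: le_integrableR mf fC _.
rewrite /comp; under eq_fun do rewrite EFinM.
apply: integrableZl => //; apply: integrable_indic_lty.
  exact: measurable_cV_box.
exact: lebesgue_cV_box_lty.
Qed.

Lemma partial_eq0 (K : set E) (F : E -> R) (i : 'I_n) : compact K ->
  (forall x, ~ K x -> F x = 0) -> forall x, ~ K x -> partial i F x = 0.
Proof.
move=> cK F0 x nKx; rewrite /partial.
have -> : 'D_(delta_mx i 0) F x = 'D_(delta_mx i 0) (cst 0 : E -> R) x.
  apply: near_eq_derive.
  have oK : open (~` K).
    apply: closed_openC; apply: compact_closed => //.
    by have := open_nbhs_nbhs (conj oK nKx); apply: filterS => y /= /F0.
by rewrite derive_cst.
Qed.

Lemma support_partial_bounded (K : set E) (F : E -> R) (i : 'I_n) : compact K ->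
  (forall x, ~ K x -> F x = 0) -> continuous (partial i F) ->
  exists2 C : R, 0 <= C & forall x, `|partial i F x| <= C.
Proof.
move=> cK F0 cF; have [C C0 HC] := compact_continuous_bounded cK cF.
exists C => // x; have [Kx|nKx] := pselect (K x); first exact: HC.
by rewrite (partial_eq0 _ cK F0)// normr0.
Qed.

Lemma derivable_line (F : E -> R) (v x : E) (h : R) : derivable F (x + h *: v) v ->
  is_derive h 1 (fun h : R => F (x + h *: v)) ('D_v F (x + h *: v)).
Proof.
pose G (h : R) := F (x + h *: v).
have E : (fun t : R => t^-1 *: ((G \o shift h) (t *: (1 : R^o)) - G h)) =
    (fun t : R => t^-1 *: ((F \o shift (x + h *: v)) (t *: v) - F (x + h *: v))).
  by apply/funext => t; rewrite /G /= scaler1 scalerDl addrCA.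
move=> dF; split; first by move: dF; rewrite /derivable -E.
by rewrite /derive -E.
Qed.

(** By translation invariance every difference quotient of F has integral 0; dominated convergence
    passes this to the partial derivative. *)
Lemma Rintegral_partial_eq0 (K : set E) (F : E -> R) (i : 'I_n) : compact K ->
  (forall x, ~ K x -> F x = 0) -> continuous F ->
  (forall x, derivable F x (delta_mx i 0)) ->
  continuous (partial i F) ->
  \int[lebesgue_cV R n]_x partial i F x = 0.
Proof.
move=> cK F0 cF dF cpF.
have [C C0 HC] := support_partial_bounded cK F0 cpF.
have [r r0 Kr] := compact_sub_box cK.
set e : E := delta_mx i 0.
have mF : measurable_fun [set: E] F by exact: continuous_measurable_cV.
have [D D0 HD] := compact_continuous_bounded cK cF.
have iF : (lebesgue_cV R n).-integrable [set: E] (EFin \o F).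
  apply: (@bounded_box_integrable _ r D) => // x.
  have [Kx|nKx] := pselect (K x).
    rewrite indicE mem_set ?mulr1; [exact: HD|exact: Kr].
  by rewrite F0// normr0 mulr_ge0.
(* Steps of length at most 1 keep the support of every difference quotient inside the box of
   half-width r + 1. *)
pose h k : R := k.+1%:R^-1.
have h0 k : 0 < h k by rewrite /h.
have h1 k : h k <= 1 by rewrite /h invf_le1// ler1n.
have iFh k : (lebesgue_cV R n).-integrable [set: E] (EFin \o (fun x => F (x + h k *: e))).
  apply: (@bounded_box_integrable _ (r + 1) D); first by rewrite addr_ge0.
    by apply: measurableT_comp mF _; exact: measurable_addcV.
  move=> x; have [Kx|nKx] := pselect (K (x + h k *: e)).
    rewrite indicE mem_set ?mulr1; first exact: HD.
    move=> j; have := Kr _ Kx j; rewrite !mxE.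
    have : 0 <= h k * ((j == i) && (0 == 0 :> 'I_1))%:R <= 1.
      by rewrite mulr_ge0 ?(ltW (h0 k))//=; case: (j == i); rewrite /= ?mulr1 ?mulr0.
    by set u := h k * _ => /andP[? ?] /andP[? ?]; apply/andP; split; lra.
  by rewrite F0// normr0 mulr_ge0.
pose G k (x : E) := (h k)^-1 * (F (x + h k *: e) - F x).
have intG k : \int[lebesgue_cV R n]_x G k x = 0.
  rewrite RintegralZl//; last first.
    by have := integrableB measurableT (iFh k) iF.
  by rewrite RintegralB// Rintegral_cV_shift// subrr mulr0.
have mG k : measurable_fun [set: E] (G k).
  apply: measurable_funM => //; apply: measurable_funB => //.
  by apply: measurableT_comp mF _; exact: measurable_addcV.
have GC k x : `|G k x| <= C * \1_(cV_box (r + 1)) x.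
  have [Kx|nKx] := pselect (cV_box (r + 1) x); last first.
    rewrite /G F0 ?F0 ?subr0 ?mulr0 ?normr0 ?mulr_ge0//.
      apply: contra_not nKx => /Kr H j; have := H j; lra.
    apply: contra_not nKx => /Kr H j; have := H j; rewrite !mxE.
    have : 0 <= h k * ((j == i) && (0 == 0 :> 'I_1))%:R <= 1.
      by rewrite mulr_ge0 ?(ltW (h0 k))//=; case: (j == i); rewrite /= ?mulr1 ?mulr0.
    by set u := h k * _ => /andP[? ?] /andP[? ?]; apply/andP; split; lra.
  rewrite indicE mem_set// mulr1.
  have [||c _ E] := @MVT R (fun t => F (x + t *: e)) (fun t => 'D_e F (x + t *: e)) 0 (h k) (h0 k).
  - by move=> t _; exact: derivable_line.
  - apply: derivable_within_continuous => t _.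
    by have [] := derivable_line (dF (x + t *: e)).
  rewrite /G -[F x](_ : F (x + 0 *: e) = _) ?E; last by rewrite scale0r addr0.
  by rewrite subr0 mulrC mulfK ?gt_eqF//; exact: HC.
have [||||_ H] := @dominated_Rintegral _ _ _ (lebesgue_cV R n) G (partial i F)
    (fun x => C * \1_(cV_box (r + 1)) x).
  - exact: mG.
  - move=> x; have := dF x; rewrite /derivable => /cvg_ex[l Hl].
    have -> : partial i F x = l by apply/cvg_lim.
    have /cvgr_dnbhsP := Hl.
    have -> : G ^~ x = (fun k => (h k)^-1 *: ((F \o shift x) (h k *: delta_mx i 0) - F x)).
      by apply/funext => k; rewrite /G /= [x + _]addrC.
    move=> /(_ h); apply; split; first by move=> k; rewrite gt_eqF.
    exact: cvg_natSinv.
  - rewrite /comp; under eq_fun do rewrite EFinM.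
    apply: integrableZl => //; apply: integrable_indic_lty; first exact: measurable_cV_box.
    by apply: lebesgue_cV_box_lty; rewrite addr_ge0.
  - exact: GC.
have H0 : \int[lebesgue_cV R n]_x G k x @[k --> \oo] --> (0 : R).
  by under eq_fun do rewrite intG; exact: cvg_cst.
exact: (cvg_unique _ H H0).
Qed.

End compact_support.

(** * Gaussian integrals *)

Section dot_product.
Context {R : realType} {n : nat}.
Implicit Types (x y z : 'cV[R]_n) (A : 'M[R]_n).

Lemma dotvC x y : dotv x y = dotv y x.
Proof. by apply: eq_bigr => i _; rewrite mulrC. Qed.

Lemma dotvDl x y z : dotv (x + y) z = dotv x z + dotv y z.
Proof. by rewrite -big_split; apply: eq_bigr => i _; rewrite mxE mulrDl. Qed.

Lemma dotvZl a x y : dotv (a *: x) y = a * dotv x y.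
Proof. by rewrite mulr_sumr; apply: eq_bigr => i _; rewrite mxE mulrA. Qed.

Lemma dotvDr x y z : dotv x (y + z) = dotv x y + dotv x z.
Proof. by rewrite dotvC dotvDl !(dotvC x). Qed.

Lemma dotvZr a x y : dotv x (a *: y) = a * dotv x y.
Proof. by rewrite dotvC dotvZl dotvC. Qed.

Lemma dotvNl x y : dotv (- x) y = - dotv x y.
Proof. by rewrite -scaleN1r dotvZl mulN1r. Qed.

Lemma dotvNr x y : dotv x (- y) = - dotv x y.
Proof. by rewrite dotvC dotvNl dotvC. Qed.

Lemma dotvBr x y z : dotv x (y - z) = dotv x y - dotv x z.
Proof. by rewrite dotvDr dotvNr. Qed.

Lemma dotvBl x y z : dotv (x - y) z = dotv x z - dotv y z.
Proof. by rewrite dotvDl dotvNl. Qed.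

Lemma dotv0l x : dotv 0 x = 0.
Proof. by rewrite -(scale0r 0) dotvZl mul0r. Qed.

Lemma dotv0r x : dotv x 0 = 0.
Proof. by rewrite dotvC dotv0l. Qed.

Lemma dotv_trmx A x y : dotv (A *m x) y = dotv x (A^T *m y).
Proof.
rewrite /dotv; under eq_bigr do rewrite mxE mulr_suml.
rewrite exchange_big; apply: eq_bigr => j _; rewrite mxE mulr_sumr.
by apply: eq_bigr => i _; rewrite mxE; ring.
Qed.

Lemma dotv_delta x i : dotv x (delta_mx i 0) = x i 0.
Proof.
rewrite /dotv (bigD1 i)//= mxE !eqxx mulr1 big1 ?addr0// => j ji.
by rewrite mxE (negbTE ji) mulr0.
Qed.

Lemma dotv_eq0 x : dotv x x = 0 -> x = 0.
Proof.
move=> x0; apply/colP => i; rewrite mxE; apply/eqP; rewrite -sqrf_eq0 expr2.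
move/eqP: x0; rewrite psumr_eq0; last by move=> j _; rewrite -expr2 sqr_ge0.
by move=> /allP /(_ i); rewrite mem_index_enum => /(_ isT).
Qed.

Lemma measurable_dotv a : measurable_fun [set: 'cV[R]_n] (dotv a).
Proof.
apply: measurable_sum => i; apply: measurable_funM => //; exact: measurable_coord.
Qed.

Lemma dotv_continuous (a : 'cV[R]_n) : continuous (@dotv R n a).
Proof.
suff H (s : seq 'I_n) : continuous (fun x : 'cV[R]_n => \sum_(i <- s) a i 0 * x i 0).
  exact: H.
elim: s => [|i s IH].
  rewrite (_ : (fun x => _) = cst 0); first exact: cst_continuous.
  by apply/funext => x; rewrite big_nil.
rewrite (_ : (fun x => _) = (fun x : 'cV[R]_n => a i 0 * x i 0 + \sum_(i <- s) a i 0 * x i 0)).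
  move=> x; have H : {for x, continuous (fun x : 'cV[R]_n => a i 0 * x i 0)}.
    by apply: continuousM; [exact: cst_continuous|exact: coord_continuous].
  exact: (continuousD H (IH x)).
by apply/funext => x; rewrite big_cons.
Qed.

End dot_product.

Section differentiation.
Context d (T : measurableType d) (R : realType).
Variable mu : {measure set T -> \bar R}.

Lemma has_deriv_Rintegral (f df : R -> T -> R) (G : T -> R) (a : R) :
  (forall x, `|x - a| < 1 -> mu.-integrable [set: T] (EFin \o f x)) ->
  (forall x y, has_deriv (f ^~ y) x (df x y)) ->
  mu.-integrable [set: T] (EFin \o G) ->
  (forall x y, `|x - a| < 1 -> `|df x y| <= G y) ->
  has_deriv (fun x => \int[mu]_y f x y) a (\int[mu]_y df a y).
Proof.
move=> intf Hdf intG dfG.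
have dE x y : partial1of2 f x y = df x y.
  by rewrite partial1of2E; have [_ ->] := Hdf x y.
have I x : `]a - 1, a + 1[%classic x -> `|x - a| < 1.
  by rewrite /= in_itv/= ltr_norml => /andP[? ?]; apply/andP; split; lra.
have aI : `]a - 1, a + 1[%classic a by rewrite /= in_itv/=; apply/andP; split; lra.
have G0 y : 0 <= G y by apply: (le_trans _ (dfG a y _)); rewrite ?subrr ?normr0.
have H := @cvg_differentiation_under_integral R _ T mu f setT measurableT a _ _ aI
  (fun x Ix => intf x (I x Ix)) _ G G0 intG _.
have {H} /H : forall x y, `]a - 1, a + 1[%classic x -> [set: T] y ->
    derivable (f ^~ y) x 1 by move=> x y _ _; have [] := Hdf x y.
have Gb x y : `]a - 1, a + 1[%classic x -> [set: T] y -> `|partial1of2 f x y| <= G y.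
  by move=> /I xa _; rewrite dE; exact: dfG.
move=> /(_ Gb); rewrite (_ : \int[mu]_y partial1of2 f a y = \int[mu]_y df a y); last first.
  by apply: eq_Rintegral => y _; rewrite dE.
pose F x := \int[mu]_y f x y.
rewrite (_ : (fun h => _) = (fun h => h^-1 *: ((F \o shift a) (h *: (1 : R^o)) - F a))); last first.
  by apply/funext => h; rewrite /= scaler1.
move=> H; split; first by apply/cvg_ex; exists (\int[mu]_y df a y).
exact/cvg_lim.
Qed.

Lemma normr_le_expR (x : R) : `|x| <= expR x + expR (- x).
Proof.
have := expR_ge1Dx x; have := expR_ge1Dx (- x).
have := expR_ge0 x; have := expR_ge0 (- x); rewrite ler_norml => ? ? ? ?.
by apply/andP; split; lra.
Qed.

Lemma expR_le_cosh (h x : R) : `|h| <= 1 -> expR (h * x) <= expR x + expR (- x).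
Proof.
move=> h1; have [x0|x0] := leP 0 x.
  apply: (@le_trans _ _ (expR x)); last by rewrite lerDl expR_ge0.
  rewrite ler_expR ler_piMl// (le_trans (ler_norm h))//.
apply: (@le_trans _ _ (expR (- x))); last by rewrite lerDr expR_ge0.
rewrite ler_expR -mulN1r -subr_ge0 -mulrBl; apply: mulr_le0; last exact: ltW.
by move: h1; rewrite ler_norml => /andP[? ?]; lra.
Qed.

Variables (w X : T -> R) (s : R).
Hypothesis w0 : forall y, 0 <= w y.
Hypothesis mw : measurable_fun [set: T] w.
Hypothesis mX : measurable_fun [set: T] X.
Hypothesis intw : forall h, mu.-integrable [set: T] (EFin \o (fun y => w y * expR (h * X y))).
(** The translation formula of a Gaussian weight w for a linear form X of variance s. It determines
    the cosine transform of w up to the total mass, so no Gaussian integral is ever evaluated. *)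
Hypothesis shift_sin : forall h r th,
  \int[mu]_y (w y * expR (h * X y) * sin (r * X y + th)) =
  expR (2^-1 * h ^+ 2 * s) * \int[mu]_y (w y * sin (r * X y + (th + r * (h * s)))).

Let intw0 : mu.-integrable [set: T] (EFin \o w).
Proof. by have := intw 0; apply: eq_integrableR => y; rewrite mul0r expR0 mulr1. Qed.

Let intwb (b : T -> R) : measurable_fun [set: T] b -> (forall y, `|b y| <= 1) ->
  mu.-integrable [set: T] (EFin \o (fun y => w y * b y)).
Proof.
move=> mb b1; apply: le_integrableR intw0; first exact: measurable_funM.
by move=> y; rewrite normrM ger0_norm// ler_piMr.
Qed.

Let msin r th : measurable_fun [set: T] (fun y => sin (r * X y + th)).
Proof.
apply: measurableT_comp; first exact: measurable_sin.
by apply: measurable_funD => //; exact: measurable_funM.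
Qed.

Let mcos r th : measurable_fun [set: T] (fun y => cos (r * X y + th)).
Proof.
apply: measurableT_comp; first exact: measurable_cos.
by apply: measurable_funD => //; exact: measurable_funM.
Qed.

(** One dominating function for all differentiations under the integral below: one factor 2 cosh X
    bounds |X|, the other bounds exp(hX) for |h| <= 1. *)
Let G y := w y * ((expR (X y) + expR (- X y)) * (expR (X y) + expR (- X y))).

Let intG : mu.-integrable [set: T] (EFin \o G).
Proof.
have H := integrableD measurableT
  (integrableD measurableT (intw 2) (integrableZl measurableT 2 (intw 0))) (intw (-2)).
apply: eq_integrable H => // y _ /=.
rewrite -!EFinM -!EFinD; congr EFin; rewrite /G mul0r expR0 mulNr.
have -> : 2 * X y = X y + X y by ring.
rewrite opprD !expRD.
have : expR (X y) * expR (- X y) = 1 by rewrite -expRD subrr expR0.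
by move=> H; ring: H.
Qed.

Let f th r := \int[mu]_y (w y * cos (r * X y + th)).
Let g th r := \int[mu]_y (w y * sin (r * X y + th)).
Let k th r := \int[mu]_y (w y * (X y * sin (r * X y + th))).

Let XG (b : T -> R) y : `|b y| <= expR (X y) + expR (- X y) ->
  `|w y * (X y * b y)| <= G y.
Proof.
by move=> by1; rewrite normrM ger0_norm// ler_wpM2l// normrM ler_pM// normr_le_expR.
Qed.

Let cosh1 y : 1 <= expR (X y) + expR (- X y).
Proof. by have := expR_ge1Dx (X y); have := expR_ge1Dx (- X y); lra. Qed.

Let derive_f (th r : R) : has_deriv (f th) r (- k th r).
Proof.
have -> : - k th r = \int[mu]_y (w y * (X y * - sin (r * X y + th))).
  rewrite -mulN1r -RintegralZl//; first by apply: eq_Rintegral => y _; ring.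
  apply: le_integrableR intG; first by do 2! (apply: measurable_funM => //); exact: msin.
  by move=> y; apply: (@XG (fun y => sin (r * X y + th))); rewrite (le_trans (normr_sin_le1 _)).
apply: (@has_deriv_Rintegral (fun r y => w y * cos (r * X y + th))
  (fun r y => w y * (X y * - sin (r * X y + th))) G) => //.
- by move=> x _; apply: intwb => // y; exact: normr_cos_le1.
- move=> x y; apply: has_derivZ.
  have H : has_deriv (fun x => x * X y + th) x (X y).
    by apply: (has_deriv_eq (has_derivD (has_deriv_mulr _ _) (has_deriv_cst _ _))); rewrite addr0.
  by apply: (has_deriv_eq (has_deriv_cos H)); rewrite mulrC.
- move=> x y _; apply: (@XG (fun y => - sin (x * X y + th))).
  by rewrite normrN (le_trans (normr_sin_le1 _)).
Qed.

(** Gaussian integration by parts, obtained by differentiating both sides of [shift_sin] at h = 0: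
    the left side produces the factor X, the right side only moves the phase. *)
Let kE th r : k th r = r * s * f th r.
Proof.
have H1 : has_deriv (fun h => \int[mu]_y (w y * (expR (h * X y) * sin (r * X y + th)))) 0
    (k th r).
  have -> : k th r = \int[mu]_y (w y * (X y * (expR (0 * X y) * sin (r * X y + th)))).
    by apply: eq_Rintegral => y _; rewrite mul0r expR0 mul1r.
  apply: (@has_deriv_Rintegral (fun h y => w y * (expR (h * X y) * sin (r * X y + th)))
    (fun h y => w y * (X y * (expR (h * X y) * sin (r * X y + th)))) G) => //.
  - move=> x _; apply: le_integrableR (intw x).
      apply: measurable_funM => //; apply: measurable_funM => //.
        by apply: measurableT_comp => //; exact: measurable_funM.
    move=> y; rewrite !normrM (ger0_norm (w0 _)) ler_wpM2l// (ger0_norm (expR_ge0 _)).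
    by rewrite ler_piMr ?expR_ge0// normr_sin_le1.
  - move=> x y; apply: has_derivZ.
    apply: (has_deriv_eq (has_derivM (has_deriv_exp (has_deriv_mulr _ _)) (has_deriv_cst _ _))).
    by rewrite mulr0 addr0; ring.
  - move=> x y; rewrite subr0 => x1.
    apply: (@XG (fun y => expR (x * X y) * sin (r * X y + th))).
    rewrite normrM (ger0_norm (expR_ge0 _)) (@le_trans _ _ (expR (x * X y)))//.
      by rewrite ler_piMr ?expR_ge0// normr_sin_le1.
    exact/expR_le_cosh/ltW.
have H2 : has_deriv (fun h => \int[mu]_y (w y * (expR (h * X y) * sin (r * X y + th)))) 0
    (r * s * f th r).
  have -> : (fun h => \int[mu]_y (w y * (expR (h * X y) * sin (r * X y + th)))) =
      (fun h => expR (2^-1 * s * (h * h)) * (sin (r * s * h) * f th r + cos (r * s * h) * g th r)).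
    apply/funext => h.
    have -> : 2^-1 * s * (h * h) = 2^-1 * h ^+ 2 * s by ring.
    under eq_Rintegral do rewrite mulrA.
    rewrite shift_sin; congr (_ * _).
    rewrite /f /g -!RintegralZl//; last 2 first.
    - by apply: intwb => // y; exact: normr_sin_le1.
    - by apply: intwb => // y; exact: normr_cos_le1.
    rewrite -RintegralD//; last 2 first.
    - by apply: integrableRZ; apply: intwb => // y; exact: normr_cos_le1.
    - by apply: integrableRZ; apply: intwb => // y; exact: normr_sin_le1.
    apply: eq_Rintegral => y _.
    rewrite addrA sinD; have -> : r * (h * s) = r * s * h by ring.
    by ring.
  apply: has_deriv_eq.
    apply: has_derivM.
      by apply/has_deriv_exp/has_derivZ/has_derivM; exact: has_deriv_id.
    apply: has_derivD.
      apply: has_derivM; last exact: has_deriv_cst.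
      by apply/has_deriv_sin/has_deriv_mull.
    apply: has_derivM; last exact: has_deriv_cst.
    by apply/has_deriv_cos/has_deriv_mull.
  by rewrite !mulr0 !expR0 sin0 cos0; ring.
exact: has_deriv_unique H1 H2.
Qed.

(** By [derive_f] and [kE] the transform solves f' = - s r f, so its product with exp(s r^2 / 2) is
    constant. *)
Lemma gaussian_cos th r :
  \int[mu]_y (w y * cos (r * X y + th)) =
  expR (- (2^-1 * r ^+ 2 * s)) * cos th * \int[mu]_y w y.
Proof.
pose F r := expR (2^-1 * s * (r * r)) * f th r.
have dF (x : R) : has_deriv F x 0.
  apply: has_deriv_eq.
    apply: has_derivM; last exact: derive_f.
    by apply/has_deriv_exp/has_derivZ/has_derivM; exact: has_deriv_id.
  by rewrite kE; field.
have := is_derive_0_is_cst r 0 dF; rewrite /F !mulr0 expR0 mul1r => FE.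
have -> : - (2^-1 * r ^+ 2 * s) = - (2^-1 * s * (r * r)) by ring.
transitivity (expR (- (2^-1 * s * (r * r))) * F r).
  by rewrite /F mulrA -expRD addNr expR0 mul1r.
rewrite [F r]FE -(mulrA _ (cos th)); congr (_ * _).
rewrite -RintegralZl//; apply: eq_Rintegral => y _.
by rewrite mul0r add0r mulrC.
Qed.

End differentiation.

Section gaussian.
Context {R : realType} {n : nat}.
Variable S : 'M[R]_n.
Hypothesis Ssym : S^T = S.
Hypothesis Sunit : S \in unitmx.
Local Notation leb := (lebesgue_cV R n).

Definition gauss (y : 'cV[R]_n) : R := expR (- (2^-1 * dotv (invmx S *m y) y)).

Hypothesis gauss_neq0 : \int[leb]_y gauss y != 0.

Let gaussD y a : gauss (y + S *m a) * expR (dotv a (y + S *m a)) =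
  expR (2^-1 * dotv (S *m a) a) * gauss y.
Proof.
rewrite -!expRD; congr expR.
rewrite mulmxDr mulKmx// !dotvDl !dotvDr.
rewrite (dotv_trmx (invmx S) y (S *m a)) trmx_inv Ssym mulKmx//.
by rewrite (dotvC (S *m a) a) (dotvC y a); field.
Qed.

Lemma measurable_gauss : measurable_fun [set: 'cV[R]_n] gauss.
Proof.
apply: measurableT_comp => //; apply: measurableT_comp => //; apply: measurable_funM => //.
apply: measurable_sum => i; apply: measurable_funM; last exact: measurable_coord.
under eq_fun do rewrite mxE.
by apply: measurable_sum => j; apply: measurable_funM => //; exact: measurable_coord.
Qed.

Let gauss0 y : 0 <= gauss y. Proof. exact: expR_ge0. Qed.

(** [Rintegral] sends an infinite integral to 0, so the hypothesis [gauss_neq0] already contains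
    integrability; positivity of S is not assumed here. *)
Let integrable_gauss : leb.-integrable [set: 'cV[R]_n] (EFin \o gauss).
Proof.
apply/integrableP; split; first by apply/measurable_EFinP; exact: measurable_gauss.
rewrite (eq_integral (fun y => (gauss y)%:E)); last by move=> y _; rewrite gee0_abs// lee_fin.
rewrite ltey; apply: contra_neq gauss_neq0 => H.
by rewrite /Rintegral H.
Qed.

Lemma integrable_gauss_exp a :
  leb.-integrable [set: 'cV[R]_n] (EFin \o (fun y => gauss y * expR (dotv a y))).
Proof.
have m1 : measurable_fun [set: 'cV[R]_n] (fun y => gauss y * expR (dotv a y)).
  apply: measurable_funM; first exact: measurable_gauss.
  by apply: measurableT_comp => //; exact: measurable_dotv.
apply/integrableP; split; first exact/measurable_EFinP.
rewrite -(ge0_integral_cV_shift (S *m a)); last 2 first.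
- by apply: measurableT_comp => //; exact/measurable_EFinP.
- by move=> y; exact: abse_ge0.
have := integrableZl measurableT (expR (2^-1 * dotv (S *m a) a)) integrable_gauss.
move=> /integrableP[_]; apply: le_lt_trans.
rewrite le_eqVlt; apply/orP; left; apply/eqP; apply: eq_integral => y _.
by rewrite /comp gaussD EFinM.
Qed.

Let measurable_affine (F : R -> R) (x : 'cV[R]_n) th : measurable_fun [set: R] F ->
  measurable_fun [set: 'cV[R]_n] (fun y => F (dotv x y + th)).
Proof.
move=> mF; apply: measurableT_comp mF _; apply: measurable_funD => //; exact: measurable_dotv.
Qed.

Lemma gauss_shift (F : R -> R) (a x : 'cV[R]_n) (th : R) :
  measurable_fun [set: R] F -> (forall u, `|F u| <= 1) ->
  \int[leb]_y (gauss y * expR (dotv a y) * F (dotv x y + th)) =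
  expR (2^-1 * dotv (S *m a) a) *
  \int[leb]_y (gauss y * F (dotv x y + (th + dotv x (S *m a)))).
Proof.
move=> mF F1.
rewrite -(Rintegral_cV_shift (S *m a)); last first.
  apply: measurable_funM; last exact: measurable_affine.
  apply: measurable_funM; first exact: measurable_gauss.
  by apply: measurableT_comp => //; exact: measurable_dotv.
pose c := expR (2^-1 * dotv (S *m a) a).
transitivity (\int[leb]_y (c * (gauss y * F (dotv x y + (th + dotv x (S *m a)))))).
  apply: eq_Rintegral => y _.
  by rewrite gaussD dotvDr -(addrA (dotv x y)) (addrC _ th) -mulrA.
rewrite RintegralZl//; apply: le_integrableR integrable_gauss.
  by apply: measurable_funM; [exact: measurable_gauss|exact: measurable_affine].
by move=> y; rewrite normrM ger0_norm// ler_piMr.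
Qed.

(** The translation by S a removes the exponential and adds <x, S a> to the phase; what remains is
    [gaussian_cos] for the form <x, .>, of variance <S x, x>. *)
Lemma gauss_cos (a x : 'cV[R]_n) (th : R) :
  \int[leb]_y (gauss y * expR (dotv a y) * cos (dotv x y + th)) =
  expR (2^-1 * (dotv (S *m a) a - dotv (S *m x) x)) * cos (dotv (S *m a) x + th) *
  \int[leb]_y gauss y.
Proof.
rewrite (gauss_shift _ _ _ measurable_cos); last exact: normr_cos_le1.
have := @gaussian_cos _ _ _ leb gauss (dotv x) (dotv (S *m x) x) gauss0
  measurable_gauss (measurable_dotv x) _ _ (th + dotv x (S *m a)) 1.
under [X in (_ -> _ -> X = _) -> _]eq_Rintegral do rewrite mul1r.
move=> -> //.
- rewrite -mulrA mulrA -expRD (addrC th) (dotvC x) expr1n mulr1.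
  by rewrite mulrBr mulrA.
- move=> h; have := integrable_gauss_exp (h *: x).
  by apply: eq_integrableR => y; rewrite dotvZl.
- move=> h r th'.
  have := @gauss_shift sin (h *: x) (r *: x) th' measurable_sin
    (@normr_sin_le1 R).
  under eq_Rintegral do rewrite !dotvZl.
  move=> ->; rewrite -scalemxAr !dotvZr !dotvZl (dotvC x (S *m x)).
  congr (expR _ * _); first ring.
  by apply: eq_Rintegral => y _; rewrite dotvZl [h * (r * _)]mulrCA.
Qed.

End gaussian.

(** * The matrix exponential *)

Section matrix_exponential.
Context {R : realType}.

Lemma cvg_sumR (I : Type) (T : Type) (F : set_system T) {FF : Filter F}
    (s : seq I) (f : I -> T -> R) (l : I -> R) :
  (forall i, f i x @[x --> F] --> l i) ->
  \sum_(i <- s) f i x @[x --> F] --> \sum_(i <- s) l i.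
Proof.
move=> H; elim: s => [|i s IH].
  by rewrite big_nil; under eq_fun do rewrite big_nil; exact: cvg_cst.
by rewrite big_cons; under eq_fun do rewrite big_cons; exact: cvgD.
Qed.

Lemma cvg_coord_mx (T : Type) (F : set_system T) {FF : Filter F} m n
    (u : T -> 'M[R]_(m, n)) (M : 'M[R]_(m, n)) :
  (forall i j, u x i j @[x --> F] --> M i j) -> u x @[x --> F] --> M.
Proof.
move=> H; apply/cvgrPdist_lt => e e0.
have K (ij : 'I_m * 'I_n) : \near F, `|M ij.1 ij.2 - u F ij.1 ij.2| < e.
  by have /cvgrPdist_lt := H ij.1 ij.2; exact.
have : \near F, forall ij : 'I_m * 'I_n, `|M ij.1 ij.2 - u F ij.1 ij.2| < e.
  exact: filter_forall.
apply: filterS => x Hx; rewrite [ltLHS]mx_normrE.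
by apply/bigmax_ltP; split => //= ij _; rewrite !mxE; exact: Hx.
Qed.

(* the exponential generating function of v *)
Definition egf (v : nat -> R) (x : R) : R :=
  limn (pseries (fun k => v k * (k`!%:R)^-1) x).

Definition geometric_bound (v : nat -> R) : Prop :=
  exists C M : R, [/\ 0 <= C, 0 <= M & forall k, `|v k| <= C * M ^+ k].

Lemma geometric_boundS v : geometric_bound v -> geometric_bound (fun k => v k.+1).
Proof.
move=> [C [M [C0 M0 H]]]; exists (C * M), M; split => //; first exact: mulr_ge0.
by move=> k; rewrite -mulrA -exprS; exact: H.
Qed.

Lemma egf_cvg v x : geometric_bound v ->
  pseries (fun k => v k * (k`!%:R)^-1) x N @[N --> \oo] --> egf v x.
Proof.
move=> [C [M [C0 M0 H]]].
suff : cvgn (pseries (fun k => v k * (k`!%:R)^-1) x) by [].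
apply: normed_cvg.
apply: (@series_le_cvg _ _ (fun k => C * exp_coeff (M * `|x|) k)).
- by move=> k; rewrite normr_ge0.
- move=> k; rewrite /exp_coeff /= mulr_ge0// divr_ge0// exprn_ge0// mulr_ge0//.
- move=> k; rewrite /exp_coeff /= !normrM normrX exprMn normfV.
  rewrite (ger0_norm (ler0n _ _)) mulrAC mulrA mulrA ler_pM2r ?invr_gt0 ?ltr0n ?fact_gt0//.
  by rewrite ler_wpM2r ?exprn_ge0.
- rewrite (_ : (fun k => _) = C *: exp_coeff (M * `|x|)); last by apply/funext.
  by apply: is_cvg_seriesZ; exact: is_cvg_series_exp_coeff.
Qed.

Lemma has_deriv_egf v x : geometric_bound v ->
  has_deriv (egf v) x (egf (fun k => v k.+1) x).
Proof.
move=> bv.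
have D u : pseries_diffs (fun k => u k * (k`!%:R)^-1) = (fun k => u k.+1 * (k`!%:R)^-1) :> (nat -> R).
  apply/funext => k; rewrite /pseries_diffs factS natrM invfM mulrCA mulVKf//.
have c u y : geometric_bound u -> cvgn (pseries (fun k => u k * (k`!%:R)^-1) y).
  by move=> bu; have := @egf_cvg u y bu; exact: cvgP.
have := @pseries_snd_diffs R (fun k => v k * (k`!%:R)^-1) (`|x| + 1) x.
rewrite !D => H; apply: H.
- exact: c.
- exact/c/geometric_boundS.
- exact: (c _ _ (geometric_boundS (geometric_boundS bv))).
- by rewrite [ltRHS]ger0_norm ?addr_ge0// ltrDl.
Qed.

Lemma egf0 v : egf v 0 = v 0%N.
Proof.
apply/cvg_lim => //.
(* The partial sum with no term is skipped; from one term on, the sums at 0 are all equal to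
   [v 0]. *)
rewrite -(cvg_shiftS (pseries (fun k => v k * k`!%:R^-1) 0)).
rewrite (_ : (fun k => _) = cst (v 0%N)); first exact: cvg_cst.
apply/funext => k; rewrite /pseries /series /= big_nat_recl// expr0 fact0 invr1 !mulr1.
by rewrite big1 ?addr0// => i _; rewrite expr0n mulr0.
Qed.

Lemma egf_sum (I : finType) (c : I -> R) (v : I -> nat -> R) x :
  (forall i, geometric_bound (v i)) ->
  egf (fun k => \sum_i c i * v i k) x = \sum_i c i * egf (v i) x.
Proof.
move=> bv; apply/cvg_lim => //.
rewrite (_ : pseries _ _ = (fun N => \sum_i c i * pseries (fun k => v i k * (k`!%:R)^-1) x N)).
  by apply: cvg_sumR => i; apply: cvgM; [exact: cvg_cst|exact: egf_cvg].
apply/funext => N; rewrite /pseries /series /=.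
under [RHS]eq_bigr do rewrite mulr_sumr.
rewrite exchange_big; apply: eq_bigr => k _; rewrite !mulr_suml.
by apply: eq_bigr => i _; rewrite !mulrA.
Qed.

Context {n : nat}.
Implicit Types A : 'M[R]_n.

Lemma geometric_bound_expr A i j : geometric_bound (fun k => (A ^+ k) i j).
Proof.
pose M := \sum_i \sum_j `|A i j|.
have M0 : 0 <= M by apply: sumr_ge0 => a _; exact: sumr_ge0.
exists 1, M; split => // k; rewrite mul1r.
elim: k i => [|k IH] i; first by rewrite !expr0 mxE; case: (i == j); rewrite ?normr1 ?normr0.
rewrite exprS mxE (le_trans (ler_norm_sum _ _ _))//.
apply: (@le_trans _ _ (\sum_l `|A i l| * M ^+ k)).
  by apply: ler_sum => l _; rewrite normrM ler_wpM2l.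
rewrite -mulr_suml exprS ler_wpM2r ?exprn_ge0//.
by rewrite /M [leRHS](bigD1 i)//= lerDl; apply: sumr_ge0 => a _; exact: sumr_ge0.
Qed.

Lemma expmxE A s i j : expmx (s *: A) i j = egf (fun k => (A ^+ k) i j) s.
Proof.
pose M := \matrix_(i, j) egf (fun k => (A ^+ k) i j) s.
suff -> : expmx (s *: A) = M by rewrite mxE.
apply/cvg_lim; first exact: norm_hausdorff.
apply: cvg_coord_mx => a b; rewrite mxE.
have := @egf_cvg _ s (geometric_bound_expr A a b).
apply: cvg_trans; apply: near_eq_cvg; apply: nearW => N.
rewrite /pseries /series /= summxE; apply: eq_bigr => k _.
rewrite (_ : (s *: A) ^+ k = s ^+ k *: A ^+ k) ?mxE; first by ring.
elim: k => [|k IH]; first by rewrite !expr0 scale1r.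
rewrite !exprS IH; apply/matrixP => p q; rewrite !mxE mulr_sumr.
by apply: eq_bigr => l _; rewrite !mxE; ring.
Qed.

Lemma has_deriv_expmx A s i j :
  has_deriv (fun s => expmx (s *: A) i j) s ((A *m expmx (s *: A)) i j).
Proof.
rewrite (_ : (fun s => _) = egf (fun k => (A ^+ k) i j)); last first.
  by apply/funext => t; exact: expmxE.
apply: (has_deriv_eq (has_deriv_egf _ (geometric_bound_expr A i j))).
rewrite (_ : (fun k => _) = (fun k => \sum_l A i l * (A ^+ k) l j)); last first.
  by apply/funext => k; rewrite exprS mxE.
rewrite egf_sum; last by move=> l; exact: geometric_bound_expr.
by rewrite mxE; apply: eq_bigr => l _; rewrite expmxE.
Qed.

Lemma expmx_comm A s : A *m expmx (s *: A) = expmx (s *: A) *m A.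
Proof.
apply/matrixP => i j; rewrite !mxE.
under eq_bigr do rewrite expmxE.
under [RHS]eq_bigr do rewrite expmxE mulrC.
rewrite -!egf_sum; [|move=> l; exact: geometric_bound_expr..].
congr egf; apply/funext => k.
have := exprSr A k; rewrite exprS => /(congr1 (fun M : 'M[R]_n => M i j)); rewrite !mxE => ->.
by apply: eq_bigr => l _; rewrite mulrC.
Qed.

Lemma expmx0 A : expmx (0 *: A) = 1%:M.
Proof. by apply/matrixP => i j; rewrite expmxE egf0 expr0. Qed.

Lemma expmx_tr A s : expmx (s *: A^T) = (expmx (s *: A))^T.
Proof.
apply/matrixP => i j; rewrite mxE !expmxE; congr egf; apply/funext => k.
elim: k i j => [|k IH] i j; first by rewrite !expr0 !mxE eq_sym.
rewrite exprS exprSr !mxE; apply: eq_bigr => l _; by rewrite mxE IH mulrC.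
Qed.

Lemma has_deriv_mulmx (F G dF dG : R -> 'M[R]_n) (s : R) :
  (forall i j, has_deriv (fun s => F s i j) s (dF s i j)) ->
  (forall i j, has_deriv (fun s => G s i j) s (dG s i j)) ->
  forall i j, has_deriv (fun s => (F s *m G s) i j) s ((dF s *m G s + F s *m dG s) i j).
Proof.
move=> HF HG i j.
rewrite (_ : (fun s => _) = (fun s => \sum_l F s i l * G s l j)); last first.
  by apply/funext => t; rewrite mxE.
have := has_deriv_sum (index_enum 'I_n) (fun l => has_derivM (HF i l) (HG l j)).
by move/has_deriv_eq; apply; rewrite big_split !mxE.
Qed.

(** The product exp(-rA) exp((r + t')A) has zero derivative in r, hence equals its value exp(t'A) at
    r = 0. The case t' = 0 gives the inverse of exp(sA). *)
Lemma expmxD A s t : expmx ((s + t) *: A) = expmx (s *: A) *m expmx (t *: A).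
Proof.
have dN r i j : has_deriv (fun s => expmx ((- s) *: A) i j) r ((- (A *m expmx ((- r) *: A))) i j).
  have H : has_deriv (fun x : R => - x) r (-1).
    have := has_deriv_mull r (-1); rewrite (_ : (fun t => _) = -%R)//.
    by apply/funext => x; rewrite mulN1r.
  by have := @has_deriv_comp _ (fun s => expmx (s *: A) i j) _ _ _ _
    (has_deriv_expmx A (- r) i j) H; rewrite mulrN1 [X in _ -> has_deriv _ _ X]mxE.
have dT t' r i j : has_deriv (fun s => expmx ((s + t') *: A) i j) r ((A *m expmx ((r + t') *: A)) i j).
  have H : has_deriv (fun x : R => x + t') r 1.
    by apply: (has_deriv_eq (has_derivD (has_deriv_id r) (has_deriv_cst r t'))); rewrite addr0.
  by have := @has_deriv_comp _ (fun s => expmx (s *: A) i j) (fun x => x + t') r _ _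
    (has_deriv_expmx A (r + t') i j) H; rewrite mulr1.
have C t' r : expmx ((- r) *: A) *m expmx ((r + t') *: A) = expmx (t' *: A).
  apply/matrixP => i j.
  have D x := has_deriv_mulmx (dF := fun r => - (A *m expmx ((- r) *: A)))
    (dG := fun r => A *m expmx ((r + t') *: A)) (dN x) (dT t' x) i j.
  have Z x : has_deriv (fun s => (expmx ((- s) *: A) *m expmx ((s + t') *: A)) i j) x 0.
    apply: (has_deriv_eq (D x)).
    by rewrite mulNmx (expmx_comm A (- x)) -!mulmxA addNr mxE.
  by rewrite (is_derive_0_is_cst r 0 Z) oppr0 expmx0 mul1mx add0r.
have I : expmx (s *: A) *m expmx ((- s) *: A) = 1%:M.
  by apply: mulmx1C; rewrite -{2}(addr0 s) C expmx0.
by rewrite -(C t s) mulmxA I mul1mx.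
Qed.

Lemma has_deriv_flow A (w v : 'cV[R]_n) s :
  has_deriv (fun s => dotv w (expmx (s *: A) *m v)) s (dotv w (A *m (expmx (s *: A) *m v))).
Proof.
apply: has_deriv_eq.
  apply: has_deriv_sum => i; apply: has_derivZ.
  rewrite (_ : (fun s => _) = (fun s => \sum_j expmx (s *: A) i j * v j 0)); last first.
    by apply/funext => t; rewrite mxE.
  apply: has_deriv_sum => j; apply: has_derivM; [exact: has_deriv_expmx|exact: has_deriv_cst].
apply: eq_bigr => i _; congr (_ * _); rewrite mulmxA mxE.
by apply: eq_bigr => j _; rewrite mulr0 addr0.
Qed.

End matrix_exponential.

(** * Integrals over intervals, quadratic forms and the covariance S_t *)

Section interval_integral.
Context {R : realType}.
Local Notation leb := (@lebesgue_measure R).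

Lemma continuous_integrable_itv (f : R -> R) (a b : R) : continuous f ->
  leb.-integrable `[a, b] (EFin \o f).
Proof.
move=> cf; apply: continuous_compact_integrable; first exact: segment_compact.
exact: continuous_subspaceT.
Qed.

Lemma Rintegral_itv_add (f : R -> R) (t h : R) : continuous f ->
  (forall x, 0 <= f x) -> 0 <= t -> 0 <= h ->
  \int[leb]_(s in `[0, t + h]) f s =
  \int[leb]_(s in `[0, t]) f s + \int[leb]_(s in `[0, h]) f (s + t).
Proof.
move=> cf f0 t0 h0.
have := @Rintegral_itvB R f (BLeft 0) (BRight (t + h)) t
   (continuous_integrable_itv _ _ cf).
rewrite !bnd_simp => /(_ t0); rewrite lerDl => /(_ h0) H.
move/eqP: H; rewrite subr_eq => /eqP H.
etransitivity; first exact: H.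
rewrite addrC; congr (_ + _).
have cft : continuous (fun s => f (s + t)).
  move=> x; apply: (@cvg_comp _ _ _ (fun s => s + t) f _ _ _ _ (cf (x + t))).
  by apply: cvgD; [exact: cvg_id|exact: cvg_cst].
(* Splitting at t leaves the half-open interval ]t, t + h], so the left endpoint is dropped on the
   other side too before translating. *)
rewrite -[RHS]Rintegral_itv_obnd_cbnd; last first.
  apply: integrableS (continuous_integrable_itv 0 h cft) => //.
  exact: subset_itv_oc_cc.
rewrite /Rintegral; congr fine.
rewrite integral_mkcond [RHS]integral_mkcond.
rewrite -(@ge0_integral_shift R t ((EFin \o f) \_ `]t, (t + h)%R])%E); last 2 first.
- apply/(measurable_restrictT _ _).1 => //; apply/measurable_EFinP.
  apply: measurable_funTS; exact: continuous_measurable_fun.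
- by move=> x; rewrite erestrict_ge0// => y _; rewrite lee_fin.
apply: eq_integral => x _; rewrite !patchE.
have -> : (x + t \in `]t, t + h]%classic) = (x \in `]0, h]%classic).
  by apply/idP/idP; rewrite !inE /= !in_itv /= => /andP[? ?]; apply/andP; split; lra.
by [].
Qed.

Lemma has_deriv_Rintegral_itv (f : R -> R) (t : R) : continuous f -> 0 < t ->
  has_deriv (fun t => \int[leb]_(s in `[0, t]) f s) t (f t).
Proof.
move=> cf t0.
(* The interval is extended to t + 1 so that t is an interior point. *)
have [||||H1 H2] := @continuous_FTC1_closed R f 0 t (t + 1).
- by rewrite ltrDl.
- exact: continuous_integrable_itv.
- exact: t0.
- exact: cf.
by split; [exact: H1|rewrite -derive1E; exact: H2].
Qed.

End interval_integral.

Section quadratic_forms.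
Context {R : realType} {n : nat}.
Variable S : 'M[R]_n.
Hypothesis Ssym : S^T = S.
Hypothesis S0 : forall x, 0 <= dotv (S *m x) x.

Lemma dotv_sym x y : dotv (S *m x) y = dotv (S *m y) x.
Proof. by rewrite dotv_trmx Ssym dotvC. Qed.

Lemma psd_cauchy_schwarz x y :
  dotv (S *m x) y ^+ 2 <= dotv (S *m x) x * dotv (S *m y) y.
Proof.
set a := dotv (S *m x) x; set b := dotv (S *m x) y; set c := dotv (S *m y) y.
have H u v : 0 <= u ^+ 2 * a + 2 * u * v * b + v ^+ 2 * c.
  have := S0 (u *: x + v *: y).
  rewrite mulmxDr -!scalemxAr !dotvDl !dotvDr !dotvZl !dotvZr (dotv_sym y x) -/a -/b -/c.
  by congr (_ <= _); ring.
have a0 : 0 <= a := S0 x; have c0 : 0 <= c := S0 y.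
have [a1|a1] := eqVneq a 0.
  rewrite a1 mul0r.
  (* With a = 0 the form is linear in u; this choice turns it into - b^2 (c + 2), which forces b =
     0. *)
  have := H (- (c + 1)) b; rewrite a1 mulr0 add0r.
  have -> : 2 * - (c + 1) * b * b + b ^+ 2 * c = - (b ^+ 2 * (c + 2)) by ring.
  by rewrite oppr_ge0 pmulr_lle0//; lra.
have a2 : 0 < a by rewrite lt_def a1.
have := H (- b) a; have -> : (- b) ^+ 2 * a + 2 * - b * a * b + a ^+ 2 * c = a * (a * c - b ^+ 2) by ring.
by rewrite pmulr_rge0// subr_ge0.
Qed.

Lemma psd_ker x : dotv (S *m x) x = 0 -> S *m x = 0.
Proof.
move=> x0; apply: dotv_eq0; apply/eqP; rewrite -sqrf_eq0 eq_le sqr_ge0 andbT.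
by rewrite (le_trans (psd_cauchy_schwarz x (S *m x)))// x0 mul0r.
Qed.

Hypothesis Sunit : S \in unitmx.

Lemma psd_unit_gt0 x : x != 0 -> 0 < dotv (S *m x) x.
Proof.
move=> x0; rewrite lt_def S0 andbT; apply: contra_neq x0 => /psd_ker H.
by rewrite -[x](mulKmx Sunit) H mulmx0.
Qed.

(** Cauchy-Schwarz against the vector that S maps to the i-th basis vector. It lets decay of the
    form imply decay of the coordinates. *)
Lemma psd_unit_coord (x : 'cV[R]_n) i :
  x i 0 ^+ 2 <= dotv (delta_mx i 0) (invmx S *m delta_mx i 0) * dotv (S *m x) x.
Proof.
have := psd_cauchy_schwarz (invmx S *m delta_mx i 0) x.
by rewrite mulKVmx// dotvC dotv_delta.
Qed.

End quadratic_forms.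

Section finite_sums.
Context d (T : measurableType d) (R : realType).
Variable mu : {measure set T -> \bar R}.

Lemma integrableR_sum (D : set T) (I : Type) (s : seq I) (f : I -> T -> R) : measurable D ->
  (forall i, mu.-integrable D (EFin \o f i)) ->
  mu.-integrable D (EFin \o (fun x => \sum_(i <- s) f i x)).
Proof.
move=> mD H; rewrite /comp; under eq_fun do rewrite -sumEFin.
by apply: integrable_sum => // i _; exact: H.
Qed.

Lemma Rintegral_sum (D : set T) (I : Type) (s : seq I) (f : I -> T -> R) : measurable D ->
  (forall i, mu.-integrable D (EFin \o f i)) ->
  \int[mu]_(x in D) (\sum_(i <- s) f i x) = \sum_(i <- s) \int[mu]_(x in D) f i x.
Proof.
move=> mD H; elim: s => [|i s IH].
  rewrite big_nil; under eq_Rintegral do rewrite big_nil.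
  by rewrite Rintegral_cst// mul0r.
rewrite big_cons -IH -RintegralD//; last exact: integrableR_sum.
by apply: eq_Rintegral => x _; rewrite big_cons.
Qed.

End finite_sums.

Section covariance.
Context {R : realType} {n : nat}.
Variables Q B : 'M[R]_n.
Hypothesis Qsym : Q^T = Q.
Hypothesis Qpsd : forall x : 'cV[R]_n, 0 <= dotv (Q *m x) x.
Local Notation leb := (@lebesgue_measure R).
Local Notation S := (Qt Q B).

Definition flow (x : 'cV[R]_n) (t : R) : 'cV[R]_n := expmx (t *: B^T) *m x.

Lemma flow0 x : flow x 0 = x.
Proof. by rewrite /flow expmx0 mul1mx. Qed.

Lemma flowD x s t : flow x (s + t) = flow (flow x t) s.
Proof. by rewrite /flow expmxD mulmxA. Qed.

Lemma flowZ a x t : flow (a *: x) t = a *: flow x t.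
Proof. by rewrite /flow scalemxAr. Qed.

Lemma flow_zero t : flow 0 t = 0.
Proof. by rewrite /flow mulmx0. Qed.

Lemma dotv_flow x y t : dotv x (expmx (t *: B) *m y) = dotv (flow x t) y.
Proof. by rewrite /flow expmx_tr dotv_trmx trmxK. Qed.

Lemma has_deriv_dotv_flow w x t :
  has_deriv (fun t => dotv w (flow x t)) t (dotv w (B^T *m flow x t)).
Proof. exact: has_deriv_flow. Qed.

Lemma has_deriv_flow_coord x i t :
  has_deriv (fun t => flow x t i 0) t ((B^T *m flow x t) i 0).
Proof.
have E (y : 'cV[R]_n) : y i 0 = dotv (delta_mx i 0) y :> R by rewrite dotvC dotv_delta.
rewrite E (_ : (fun t => _) = (fun t => dotv (delta_mx i 0) (flow x t))); last first.
  by apply/funext => s; rewrite E.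
exact: has_deriv_dotv_flow.
Qed.

Lemma has_deriv_form_flow (M : 'M[R]_n) x y t :
  has_deriv (fun t => dotv (M *m flow x t) (flow y t)) t
    (dotv (M *m (B^T *m flow x t)) (flow y t) + dotv (M *m flow x t) (B^T *m flow y t)).
Proof.
apply: has_deriv_eq.
  apply: has_deriv_sum => i; apply: has_derivM; last exact: has_deriv_flow_coord.
  rewrite (_ : (fun s => _) = (fun s => dotv (row i M)^T (flow x s))); last first.
    by apply/funext => s; rewrite mxE /dotv; apply: eq_bigr => j _; rewrite !mxE.
  exact: has_deriv_dotv_flow.
rewrite big_split /=; congr (_ + _); apply: eq_bigr => i _; congr (_ * _).
by rewrite mxE /dotv; apply: eq_bigr => j _; rewrite !mxE.
Qed.

Let f x s : R := dotv (Q *m flow x s) (flow x s).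

Let flow_form x y s : dotv (Q *m flow x s) (flow y s) =
  dotv ((expmx (s *: B) *m Q *m expmx (s *: B^T)) *m x) y.
Proof. by rewrite /flow -!mulmxA [RHS]dotv_trmx expmx_tr. Qed.

Let f_continuous x : continuous (f x).
Proof. by move=> s; exact: has_deriv_continuous (has_deriv_form_flow Q x x s). Qed.

Lemma Qt_form x t : dotv (S t *m x) x = \int[leb]_(s in `[0, t]) f x s.
Proof.
pose q i j s : R := (expmx (s *: B) *m Q *m expmx (s *: B^T)) i j.
have cq i j : continuous (q i j).
  have -> : q i j = fun s => dotv (Q *m flow (delta_mx j 0) s) (flow (delta_mx i 0) s).
    apply/funext => s; rewrite flow_form dotv_delta.
    by rewrite /q -colE [RHS]mxE.
  by move=> s; exact: has_deriv_continuous (has_deriv_form_flow Q _ _ s).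
transitivity (\int[leb]_(s in `[0, t]) (\sum_i \sum_j x i 0 * x j 0 * q i j s)).
  rewrite Rintegral_sum//; last first.
    move=> i; apply: integrableR_sum => // j; apply: continuous_integrable_itv => s.
    by apply: cvgM; [exact: cvg_cst|exact: cq].
  apply: eq_bigr => i _; rewrite mxE mulr_suml Rintegral_sum//; last first.
    move=> j; apply: continuous_integrable_itv => s.
    by apply: cvgM; [exact: cvg_cst|exact: cq].
  apply: eq_bigr => j _; rewrite RintegralZl//; last exact: continuous_integrable_itv.
  by rewrite mxE; ring.
apply: eq_Rintegral => s _; rewrite /f.
rewrite flow_form.
rewrite /dotv; apply: eq_bigr => i _; rewrite mxE mulr_suml.
by apply: eq_bigr => j _; rewrite /q; ring.
Qed.

Lemma Qt_sym t : (S t)^T = S t.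
Proof.
apply/matrixP => i j; rewrite !mxE; apply: eq_Rintegral => s _.
have E : (expmx (s *: B) *m Q *m expmx (s *: B^T))^T = expmx (s *: B) *m Q *m expmx (s *: B^T).
  by rewrite !trmx_mul Qsym expmx_tr trmxK mulmxA.
by rewrite -[in LHS]E [LHS]mxE.
Qed.

Lemma Qt_psd t x : 0 <= dotv (S t *m x) x.
Proof. by rewrite Qt_form; apply: Rintegral_ge0 => s _; exact: Qpsd. Qed.

(** The cocycle identity S_(t+h) = S_t + exp(tB) S_h exp(tB^T), from which monotonicity in t, the
    limit and the Lyapunov equation all follow. *)
Lemma Qt_add t h x : 0 <= t -> 0 <= h ->
  dotv (S (t + h) *m x) x = dotv (S t *m x) x + dotv (S h *m flow x t) (flow x t).
Proof.
move=> t0 h0; rewrite !Qt_form Rintegral_itv_add//; last by move=> s; exact: Qpsd.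
by congr (_ + _); apply: eq_Rintegral => s _; rewrite /f flowD.
Qed.

Lemma has_deriv_Qt_form x t : 0 < t ->
  has_deriv (fun t => dotv (S t *m x) x) t (dotv (Q *m flow x t) (flow x t)).
Proof.
move=> t0; rewrite (_ : (fun t => _) = (fun t => \int[leb]_(s in `[0, t]) f x s)).
  exact: has_deriv_Rintegral_itv.
by apply/funext => s; exact: Qt_form.
Qed.

End covariance.

(** * The invariant measure is Gaussian *)

Section invariant_measure_gaussian.
Context {R : realType} {n : nat}.
Variables (Q B : 'M[R]_n) (mu : probability 'cV[R]_n R).
Hypothesis Qsym : Q^T = Q.
Hypothesis Qpsd : forall x : 'cV[R]_n, 0 <= dotv (Q *m x) x.
Hypothesis inv : OU_invariant Q B mu.
Local Notation S := (Qt Q B).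
Local Notation leb := (lebesgue_cV R n).
Local Notation flow := (flow B).

Let mass t : R := \int[leb]_y gauss (S t) y.

(** Invariance tested with f = 1 says that the prefactor times [mass t] equals 1. Neither factor can
    then vanish; since the inverse of 0 is 0, a zero determinant would make the prefactor 0. So the
    Gaussian integral never has to be computed. *)
Lemma OU_semigroup_kernel t : 0 < t -> [/\ S t \in unitmx, mass t != 0 &
  forall f x, OU_semigroup Q B t f x =
    (mass t)^-1 * \int[leb]_y (gauss (S t) y * f (expmx (t *: B) *m x - y))].
Proof.
move=> t0.
set c := ((2 * pi) `^ (n%:R / 2) * Num.sqrt (\det (S t)))^-1.
have E f x : OU_semigroup Q B t f x =
    c * \int[leb]_y (gauss (S t) y * f (expmx (t *: B) *m x - y)) by [].
have := inv (f := cst 1) t0.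
rewrite (_ : OU_semigroup Q B t (cst 1) = cst (c * mass t)); last first.
  by apply/funext => x; rewrite E; congr (_ * _); apply: eq_Rintegral => y _; rewrite mulr1.
rewrite !Rintegral_probability_cst => H.
have cm : c * mass t = 1.
  by apply: H; [exact: cst_continuous|exact: bounded_cst].
have m0 : mass t != 0 by apply/eqP => m0; move: cm; rewrite m0 mulr0 => /esym/eqP; rewrite oner_eq0.
have cE : c = (mass t)^-1 by apply: (mulIf m0); rewrite cm mulVf.
split => //; last by move=> f x; rewrite E cE.
rewrite unitmxE unitfE; apply/eqP => d0; move/eqP: cm.
by rewrite /c d0 sqrtr0 mulr0 invr0 mul0r eq_sym oner_eq0.
Qed.

(** The real part of exp(<a + i b, x> + i th). *)
Definition wave (a b : 'cV[R]_n) (th : R) (x : 'cV[R]_n) : R :=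
  expR (dotv a x) * cos (dotv b x + th).

Lemma measurable_exp_dotv a : measurable_fun [set: 'cV[R]_n] (fun x => expR (dotv a x)).
Proof. by apply: measurableT_comp => //; exact: measurable_dotv. Qed.

Lemma measurable_cos_dotv b th : measurable_fun [set: 'cV[R]_n] (fun x => cos (dotv b x + th)).
Proof.
apply: measurableT_comp; first exact: measurable_cos.
by apply: measurable_funD => //; exact: measurable_dotv.
Qed.

Lemma measurable_wave a b th : measurable_fun [set: 'cV[R]_n] (wave a b th).
Proof. by apply: measurable_funM; [exact: measurable_exp_dotv|exact: measurable_cos_dotv]. Qed.

Lemma wave_le a b th x : `|wave a b th x| <= expR (dotv a x).
Proof. by rewrite normrM (ger0_norm (expR_ge0 _)) ler_piMr ?expR_ge0// normr_cos_le1. Qed.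

(** In complex form, with zeta = a + i b: exp <zeta, x> is sent to exp(<S_t zeta, zeta> / 2) exp
    <zeta(t), x>. The real part of <S_t zeta, zeta> / 2 is the amplitude, its imaginary part the
    added phase. *)
Lemma OU_semigroup_wave t a b th x : 0 < t ->
  OU_semigroup Q B t (wave a b th) x =
  expR (2^-1 * (dotv (S t *m a) a - dotv (S t *m b) b)) *
  wave (flow a t) (flow b t) (th + dotv (S t *m a) b) x.
Proof.
move=> t0; have [Su m0 ->] := OU_semigroup_kernel t0.
pose F y := gauss (S t) y * expR (dotv (- a) y) *
  cos (dotv b y + (- (dotv (flow b t) x + th))).
have intF : leb.-integrable [set: 'cV[R]_n] (EFin \o F).
  apply: le_integrableR (integrable_gauss_exp (Qt_sym _ _ _) Su m0 (- a)) => //.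
    apply: measurable_funM; last exact: measurable_cos_dotv.
    by apply: measurable_funM; [exact: measurable_gauss|exact: measurable_exp_dotv].
  move=> y; rewrite normrM ger0_norm ?ler_piMr ?normr_cos_le1//.
    by rewrite mulr_ge0 ?expR_ge0.
  by rewrite mulr_ge0 ?expR_ge0.
transitivity ((mass t)^-1 * (expR (dotv (flow a t) x) *
   \int[leb]_y (gauss (S t) y * expR (dotv (- a) y) * cos (dotv b y + (- (dotv (flow b t) x + th)))))).
  congr (_ * _); rewrite -RintegralZl//.
  apply: eq_Rintegral => y _; rewrite /wave !dotvBr !dotv_flow expRD dotvNl.
  have -> : dotv b y + - (dotv (flow b t) x + th) = - (dotv (flow b t) x - dotv b y + th) by ring.
  by rewrite cosN; ring.
rewrite gauss_cos//; last exact: Qt_sym.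
rewrite -/(mass t) mulmxN !dotvNl dotvNr opprK /wave.
have -> : - dotv (S t *m a) b - (dotv (flow b t) x + th) =
  - (dotv (flow b t) x + (th + dotv (S t *m a) b)) by ring.
by rewrite cosN; field.
Qed.

Lemma bounded_funP (f : 'cV[R]_n -> R) (M : R) : (forall x, `|f x| <= M) -> bounded_fun f.
Proof.
move=> fM; exists M; split; first exact: num_real.
by move=> y My x _; apply: (le_trans (fM x)); exact: ltW.
Qed.

Lemma invariant_cos t b th : 0 < t ->
  \int[mu]_x cos (dotv b x + th) =
  expR (- (2^-1 * dotv (S t *m b) b)) * \int[mu]_x cos (dotv (flow b t) x + th).
Proof.
move=> t0.
have E c s : wave 0 c s = fun x => cos (dotv c x + s).
  by apply/funext => x; rewrite /wave dotv0l expR0 mul1r.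
have -> : (fun x => cos (dotv b x + th)) = wave 0 b th by rewrite E.
rewrite -(inv (f := wave 0 b th) t0).
- rewrite -RintegralZl//.
    apply: eq_Rintegral => x _; rewrite OU_semigroup_wave// flow_zero E.
    by rewrite mulmx0 !dotv0l addr0 sub0r mulrN.
  apply: (@integrable_probability_bounded _ _ _ _ _ 1); first exact: measurable_cos_dotv.
  by move=> x; exact: normr_cos_le1.
- rewrite E => x; apply: continuous_comp; last exact: continuous_cos.
  by apply: continuousD; [exact: dotv_continuous|exact: cst_continuous].
- by apply: (@bounded_funP _ 1) => x; rewrite E normr_cos_le1.
Qed.

(** Tightness of a single probability: its characteristic function exceeds 1/2 at some small
    multiple of b, whereas invariance bounds it there by exp(- <S_t ., .> / 2) for every t. *)
Lemma Qt_form_bounded b : exists C, forall t, 0 < t -> dotv (S t *m b) b <= C.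
Proof.
have [k Hk] : exists k : nat, 2^-1 < \int[mu]_x cos (dotv (k.+1%:R^-1 *: b) x + 0).
  have [||||_ H] := @dominated_Rintegral _ _ _ mu
    (fun k x => cos (dotv (k.+1%:R^-1 *: b) x + 0)) (cst 1) (cst 1).
  - by move=> k; exact: measurable_cos_dotv.
  - move=> x.
    have : cos (k.+1%:R^-1 * dotv b x) @[k --> \oo] --> cos (0 * dotv b x).
      by apply: cvg_cos; apply: cvgMl; exact: cvg_natSinv.
    rewrite mul0r cos0; apply: cvg_trans; apply: near_eq_cvg; apply: nearW => k.
    by rewrite dotvZl addr0.
  - exact: integrable_probability_cst.
  - by move=> k x; exact: normr_cos_le1.
  move: H; rewrite Rintegral_probability_cst => H.
  have /(cvgr_gt 1) := H; move=> /(_ 2^-1) [|m _ Hm].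
    by rewrite invf_lt1// ltr1n.
  by exists m; apply: Hm => /=.
set r := k.+1%:R^-1 in Hk; have r0 : 0 < r by rewrite invr_gt0.
(* With u = r^2 <S_t b, b> / 2, the bound exp(-u) > 1/2 gives u < 1. *)
exists (2 / r ^+ 2) => t t0.
move: Hk; rewrite (invariant_cos _ _ t0) => Hk.
have I1 : \int[mu]_x cos (dotv (flow (r *: b) t) x + 0) <= 1.
  have <- : \int[mu]_x cst 1 x = 1 by rewrite Rintegral_probability_cst.
  apply: le_Rintegral => //.
  - apply: (@integrable_probability_bounded _ _ _ _ _ 1); first exact: measurable_cos_dotv.
    by move=> x; exact: normr_cos_le1.
  - exact: integrable_probability_cst.
  - by move=> x _; exact: cos_le1.
set u := 2^-1 * _ in Hk.
have u0 : 0 <= u by rewrite mulr_ge0// Qt_psd.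
have H1 : 2^-1 < expR (- u).
  by rewrite (lt_le_trans Hk)// ler_piMr ?expR_ge0.
have : u < 1.
  have := expR_ge1Dx u; have := expRxMexpNx_1 u; have := expR_ge0 (- u).
  nra.
rewrite /u -scalemxAr dotvZl dotvZr ler_pdivlMr ?exprn_gt0//.
by set q := dotv _ _; rewrite expr2; lra.
Qed.


Let Qt_nondecreasing b t u : 0 <= t -> t <= u ->
  dotv (S t *m b) b <= dotv (S u *m b) b.
Proof.
move=> t0 tu; have -> : u = t + (u - t) by ring.
by rewrite Qt_add ?subr_ge0// lerDl Qt_psd.
Qed.

(** Monotone and bounded in time. The limit is the same along t + k for every real t >= 0, so that
    limits starting at 0 and at t can be compared. *)
Let form_limit b : exists l : R, forall t : R, 0 <= t ->
  dotv (S (t + k%:R) *m b) b @[k --> \oo] --> l.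
Proof.
have [C HC] := Qt_form_bounded b.
have HC' t : 0 <= t -> dotv (S t *m b) b <= C.
  move=> t0; apply: (@le_trans _ _ (dotv (S (t + 1) *m b) b)).
    by apply: Qt_nondecreasing => //; rewrite lerDl.
  by apply: HC; rewrite ltr_wpDl.
pose u k := dotv (S k%:R *m b) b.
have cu : cvgn u.
  apply: nondecreasing_is_cvgn.
    by move=> k l kl; apply: Qt_nondecreasing => //; rewrite ler_nat.
  by exists C => _ [k _ <-]; exact: HC'.
exists (limn u) => t t0.
have [m tm] : exists m : nat, t <= m%:R.
  by exists (Num.bound t); apply/ltW; rewrite archi_boundP.
apply: (@squeeze_cvgr _ _ _ _ u (fun k => u (k + m)%N)); [|exact: cu|by rewrite cvg_shiftn].
apply: nearW => k; apply/andP; split; apply: Qt_nondecreasing.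
- exact: ler0n.
- by rewrite lerDr.
- by rewrite addr_ge0.
- by rewrite natrD addrC lerD2l.
Qed.

Let polar (M : 'M[R]_n) i j : M^T = M ->
  M i j = 2^-1 * (dotv (M *m (delta_mx i 0 + delta_mx j 0)) (delta_mx i 0 + delta_mx j 0)
    - dotv (M *m delta_mx i 0) (delta_mx i 0) - dotv (M *m delta_mx j 0) (delta_mx j 0)).
Proof.
move=> Msym; rewrite mulmxDr !dotvDl !dotvDr (dotv_sym Msym (delta_mx i 0) (delta_mx j 0)).
have -> : M i j = dotv (M *m delta_mx j 0) (delta_mx i 0) by rewrite dotv_delta -colE [RHS]mxE.
by field.
Qed.

(* the covariance of the invariant measure *)
Lemma Qinf_exists : exists Qinf : 'M[R]_n, Qinf^T = Qinf /\
  forall t x y, 0 <= t -> dotv (S (t + k%:R) *m x) y @[k --> \oo] --> dotv (Qinf *m x) y.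
Proof.
have [q Hq] := choice form_limit.
pose e i : 'cV[R]_n := delta_mx i 0.
pose Qi := \matrix_(i, j) (2^-1 * (q (e i + e j) - q (e i) - q (e j))).
have Hc t i j : 0 <= t -> S (t + k%:R) i j @[k --> \oo] --> Qi i j.
  move=> t0; rewrite mxE.
  have : 2^-1 * (dotv (S (t + k%:R) *m (e i + e j)) (e i + e j)
      - dotv (S (t + k%:R) *m e i) (e i) - dotv (S (t + k%:R) *m e j) (e j)) @[k --> \oo] -->
      2^-1 * (q (e i + e j) - q (e i) - q (e j)).
    apply: cvgMr; apply: cvgB; last exact: Hq.
    by apply: cvgB; exact: Hq.
  apply: cvg_trans; apply: near_eq_cvg; apply: nearW => k.
  by rewrite -polar//; exact: Qt_sym.
exists Qi; split.
  apply/matrixP => i j; rewrite !mxE [e j + e i]addrC; ring.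
move=> t x y t0; apply: cvg_sumR => i; apply: cvgMl; rewrite mxE.
under eq_fun do rewrite mxE.
by apply: cvg_sumR => j; apply: cvgMl; exact: Hc.
Qed.

Variable Qinf : 'M[R]_n.
Hypothesis Qinf_sym : Qinf^T = Qinf.
Hypothesis Qinf_lim : forall t x y, 0 <= t ->
  dotv (S (t + k%:R) *m x) y @[k --> \oo] --> dotv (Qinf *m x) y.

(** [Qt_add] with the second time going to infinity along the integers. *)
Lemma Qinf_flow t x : 0 <= t ->
  dotv (Qinf *m x) x = dotv (S t *m x) x + dotv (Qinf *m flow x t) (flow x t).
Proof.
move=> t0; have H1 := @Qinf_lim t x x t0.
have H2 := @Qinf_lim 0 (flow x t) (flow x t) (lexx 0).
have H3 : dotv (S (t + k%:R) *m x) x @[k --> \oo] -->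
    dotv (S t *m x) x + dotv (Qinf *m flow x t) (flow x t).
  have : dotv (S t *m x) x + dotv (S (0 + k%:R) *m flow x t) (flow x t) @[k --> \oo] -->
      dotv (S t *m x) x + dotv (Qinf *m flow x t) (flow x t).
    by apply: cvgD; [exact: cvg_cst|exact: H2].
  apply: cvg_trans; apply: near_eq_cvg; apply: nearW => k.
  by rewrite add0r (@Qt_add R n Q B Qpsd t k%:R x t0 (ler0n R k)).
exact: cvg_unique H1 H3.
Qed.

Lemma Qinf_psd x : 0 <= dotv (Qinf *m x) x.
Proof.
have := @Qinf_lim 0 x x (lexx 0) => H; rewrite -(cvg_lim _ H)//.
by apply: limr_ge; [exact: cvgP H|apply: nearW => k; exact: Qt_psd].
Qed.

Lemma Qt_gt0 t x : 0 < t -> x != 0 -> 0 < dotv (S t *m x) x.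
Proof.
move=> t0; have [Su _ _] := OU_semigroup_kernel t0.
by apply: psd_unit_gt0 => //; [exact: Qt_sym|move=> y; exact: Qt_psd].
Qed.

Lemma Qinf_gt0 x : x != 0 -> 0 < dotv (Qinf *m x) x.
Proof.
move=> x0; rewrite (@Qinf_flow 1 x)// ltr_wpDr ?Qinf_psd//.
exact: Qt_gt0.
Qed.

(** This stands in for the stability of B. The S_1 form of x(k + 1) is at most its [Qinf] form,
    which by [Qinf_flow] is the difference between the [Qinf] and S_(k+1) forms of x and tends to 0.
    As S_1 is invertible, its form controls every coordinate. *)
Lemma flow_cvg0 x i : flow x k.+1%:R i 0 @[k --> \oo] --> (0 : R).
Proof.
have [Su _ _] := OU_semigroup_kernel (@ltr01 R).
pose c := dotv (delta_mx i 0) (invmx (S 1) *m delta_mx i 0).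
have H : c * (dotv (Qinf *m x) x - dotv (S (1 + k%:R) *m x) x) @[k --> \oo] -->
    c * (dotv (Qinf *m x) x - dotv (Qinf *m x) x).
  apply: cvgMr.
  by apply: cvgB; [exact: cvg_cst|exact: Qinf_lim].
rewrite subrr mulr0 in H.
have K : (flow x k.+1%:R i 0) ^+ 2 @[k --> \oo] --> (0 : R).
  apply: (@squeeze_cvgr _ _ _ _ (cst 0) _ _ _ _ _ H); last exact: cvg_cst.
  apply: nearW => k; rewrite sqr_ge0/= (addrC 1) natr1.
  apply: (le_trans (psd_unit_coord (Qt_sym _ _ _) _ Su (flow x k.+1%:R) i)) => //.
    by move=> y; exact: Qt_psd.
  have c0 : 0 <= c.
    rewrite /c -{1}(mulKVmx Su (delta_mx i 0)); exact: Qt_psd.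
  rewrite ler_wpM2l// (@Qinf_flow k.+1%:R x)// addrAC subrr add0r.
  by rewrite (@Qinf_flow 1 (flow x k.+1%:R))// lerDl Qinf_psd.
apply/norm_cvg0P.
have : Num.sqrt ((flow x k.+1%:R i 0) ^+ 2) @[k --> \oo] --> Num.sqrt (0 : R).
  by apply: continuous_cvg => //; exact: sqrt_continuous.
by rewrite sqrtr0; under eq_fun do rewrite sqrtr_sqr.
Qed.

Lemma dotv_flow_cvg0 x y : dotv (flow x k.+1%:R) y @[k --> \oo] --> (0 : R).
Proof.
have H : \sum_i flow x k.+1%:R i 0 * y i 0 @[k --> \oo] --> \sum_(i < n) 0 * y i 0.
  apply: cvg_sumR => i; apply: cvgMl.
  exact: flow_cvg0.
by move: H; rewrite big1// => i _; rewrite mul0r.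
Qed.

Lemma Qinf_lyapunov x : dotv (Qinf *m x) (B^T *m x) = - (2^-1 * dotv (Q *m x) x).
Proof.
(* The identity [Qinf_flow] is differentiated in time. The derivative of S_t is available for t > 0
   only, so the flow starts at time -1 and reaches x at t = 1. *)
pose y := flow x (-1).
have yx : flow y 1 = x by rewrite /y -flowD subrr flow0.
have D1 : has_deriv (fun t => dotv (S t *m y) y + dotv (Qinf *m flow y t) (flow y t)) 1
    (dotv (Q *m flow y 1) (flow y 1) +
    (dotv (Qinf *m (B^T *m flow y 1)) (flow y 1) + dotv (Qinf *m flow y 1) (B^T *m flow y 1))).
  by apply: has_derivD; [exact: has_deriv_Qt_form|exact: has_deriv_form_flow].
have D2 : has_deriv (fun t => dotv (S t *m y) y + dotv (Qinf *m flow y t) (flow y t)) 1 0.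
  apply: has_deriv_near_eq (has_deriv_cst 1 (dotv (Qinf *m y) y)).
  near=> t; apply: Qinf_flow; apply: ltW; near: t; exact: (lt_nbhsr ltr01).
have := has_deriv_unique D1 D2; rewrite yx (dotv_sym Qinf_sym (B^T *m x)).
lra.
Unshelve. all: by end_near. Qed.

Let shiftE t (x y : 'cV[R]_n) i :
  (expmx (t *: B) *m x - y) i 0 = \sum_j expmx (t *: B) i j * x j 0 - y i 0 :> R.
Proof. by rewrite !mxE. Qed.

Let measurable_kernel t (f : 'cV[R]_n -> R) : measurable_fun [set: 'cV[R]_n] f ->
  measurable_fun [set: 'cV[R]_n * 'cV[R]_n]
    (fun p => gauss (S t) p.2 * f (expmx (t *: B) *m p.1 - p.2)).
Proof.
move=> mf; apply: measurable_funM.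
  by apply: (measurableT_comp (measurable_gauss _)); exact: measurable_snd.
apply: measurableT_comp mf _; apply: measurable_fun_coordP => i.
under eq_fun do rewrite shiftE.
apply: measurable_funB.
  apply: measurable_sum => j; apply: measurable_funM => //.
  by apply: (measurableT_comp (measurable_coord j)); exact: measurable_fst.
by apply: (measurableT_comp (measurable_coord i)); exact: measurable_snd.
Qed.

Let measurable_kernel1 t (f : 'cV[R]_n -> R) x : measurable_fun [set: 'cV[R]_n] f ->
  measurable_fun [set: 'cV[R]_n]
    (fun y => gauss (S t) y * f (expmx (t *: B) *m x - y)).
Proof.
move=> mf; apply: measurable_funM; first exact: measurable_gauss.
apply: measurableT_comp mf _; apply: measurable_fun_coordP => i.
under eq_fun do rewrite shiftE.
by apply: measurable_funB => //; exact: measurable_coord.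
Qed.

Let gauss0 t y : 0 <= gauss (S t) y. Proof. exact: expR_ge0. Qed.

Let integrable_mass t : 0 < t -> leb.-integrable [set: 'cV[R]_n] (EFin \o gauss (S t)).
Proof.
move=> t0; have [Su m0 _] := OU_semigroup_kernel t0.
have := integrable_gauss_exp (Qt_sym _ _ _) Su m0 0 => // H.
by apply: eq_integrableR (H Qsym) => y; rewrite dotv0l expR0 mulr1.
Qed.

Let mass_gt0 t : 0 < t -> 0 < mass t.
Proof.
move=> t0; have [_ m0 _] := OU_semigroup_kernel t0.
by rewrite lt_def m0 Rintegral_ge0.
Qed.

Let integrable_kernel t (f : 'cV[R]_n -> R) (M : R) x : 0 < t -> measurable_fun [set: 'cV[R]_n] f ->
  (forall x, `|f x| <= M) -> leb.-integrable [set: 'cV[R]_n]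
    (EFin \o (fun y => gauss (S t) y * f (expmx (t *: B) *m x - y))).
Proof.
move=> t0 mf fM; apply: le_integrableR (integrableRZ M (integrable_mass t0)).
  exact: measurable_kernel1.
by move=> y; rewrite normrM ger0_norm// mulrC ler_wpM2r.
Qed.

Let OU_semigroup_cst t (c : R) x : 0 < t -> OU_semigroup Q B t (cst c) x = c.
Proof.
move=> t0; have [_ m0 ->] := OU_semigroup_kernel t0.
by rewrite RintegralZr//; [rewrite mulrA mulVf// mul1r|exact: integrable_mass].
Qed.

Lemma OU_semigroup_le t f g x : 0 < t ->
  leb.-integrable [set: 'cV[R]_n]
    (EFin \o (fun y => gauss (S t) y * f (expmx (t *: B) *m x - y))) ->
  leb.-integrable [set: 'cV[R]_n]
    (EFin \o (fun y => gauss (S t) y * g (expmx (t *: B) *m x - y))) ->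
  (forall x, f x <= g x) -> OU_semigroup Q B t f x <= OU_semigroup Q B t g x.
Proof.
move=> t0 If Ig fg; have [_ m0 E] := OU_semigroup_kernel t0.
rewrite !E ler_wpM2l//; first by rewrite invr_ge0 ltW// mass_gt0.
by apply: le_Rintegral => // y _; rewrite ler_wpM2l.
Qed.

Lemma measurable_OU_semigroup t (f : 'cV[R]_n -> R) (M : R) : 0 < t -> measurable_fun [set: 'cV[R]_n] f ->
  (forall x, `|f x| <= M) -> measurable_fun [set: 'cV[R]_n] (OU_semigroup Q B t f).
Proof.
move=> t0 mf fM; have [_ m0 E] := OU_semigroup_kernel t0.
rewrite (_ : OU_semigroup Q B t f = fun x => (mass t)^-1 *
  \int[leb]_y (gauss (S t) y * f (expmx (t *: B) *m x - y))); last exact/funext/E.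
apply: measurable_funM => //; apply: measurableT_comp => //.
pose h (p : 'cV[R]_n * 'cV[R]_n) := (gauss (S t) p.2 * f (expmx (t *: B) *m p.1 - p.2))%:E.
(* Measurability in x is extracted from Fubini, for which some measure on the x side is needed; [mu]
   serves, because f is bounded and [mu] finite. *)
apply: (@measurable_fubini_F _ _ _ _ _ mu leb h).
have mh : measurable_fun setT h by apply/measurable_EFinP; exact: measurable_kernel.
apply/integrable12ltyP => //.
apply: (@le_lt_trans _ _ (\int[mu]_x (M * mass t)%:E)%E); last first.
  rewrite integral_cst// [X in (_ * X)%E](@probability_setT _ _ _ mu) mule1.
  exact: ltry.
apply: ge0_le_integral => //.
- by move=> x _; exact: integral_ge0.
- apply: (measurable_fun_fubini_tonelli_F (abse \o h)) => //.
    exact: measurableT_comp.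
  by move=> x; exact: abse_ge0.
- move=> x _; rewrite EFinM /mass /Rintegral fineK; last first.
    exact: (integrable_fin_num _ (integrable_mass t0)).
  rewrite -integralZl//; last exact: integrable_mass.
  apply: ge0_le_integral => //.
  + apply: measurableT_comp => //; apply/measurable_EFinP; exact: measurable_kernel1.
  + by apply/measurable_EFinP; apply: measurable_funM => //; exact: measurable_gauss.
  + move=> y _; rewrite /h/= -EFinM lee_fin normrM ger0_norm// mulrC ler_wpM2r//.
Qed.

(** Invariance is given for bounded continuous functions only, so exponentials are approached by
    these truncations. *)
Let exp_trunc (a : 'cV[R]_n) (k : nat) (x : 'cV[R]_n) : R := Num.min (expR (dotv a x)) (k%:R : R).

Let exp_trunc_ge0 a k x : 0 <= exp_trunc a k x.
Proof. by rewrite le_min expR_ge0/=. Qed.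

Let exp_trunc_le a k x : exp_trunc a k x <= k%:R.
Proof. by rewrite ge_min lexx orbT. Qed.

Let exp_trunc_le_exp a k x : exp_trunc a k x <= expR (dotv a x).
Proof. by rewrite ge_min lexx. Qed.

Let exp_trunc_continuous a k : continuous (exp_trunc a k).
Proof.
move=> x; apply: (@continuous_min _ _ (fun x => expR (dotv a x)) (cst k%:R)); last exact: cst_continuous.
by apply: continuous_comp; [exact: dotv_continuous|exact: continuous_expR].
Qed.

Let exp_trunc_cvg a x : exp_trunc a k x @[k --> \oo] --> expR (dotv a x).
Proof.
apply: cvg_near_cst; near=> k; apply/min_idPl.
near: k; apply: nbhs_infty_ger.
Unshelve. all: by end_near. Qed.

Let exp_trunc_le2 a x : {homo (fun k => exp_trunc a k x) : k l / (k <= l)%N >-> k <= l}.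
Proof. by move=> k l kl; rewrite le_min exp_trunc_le_exp ge_min ler_nat kl orbT. Qed.

Let wave_exp a : wave a 0 0 = fun x => expR (dotv a x).
Proof. by apply/funext => x; rewrite /wave dotv0l addr0 cos0 mulr1. Qed.

Let integrable_kernel_wave t a b th x : 0 < t ->
  leb.-integrable [set: 'cV[R]_n]
    (EFin \o (fun y => gauss (S t) y * wave a b th (expmx (t *: B) *m x - y))).
Proof.
move=> t0; have [Su m0 _] := OU_semigroup_kernel t0.
apply: le_integrableR (integrableRZ (expR (dotv (flow a t) x))
    (integrable_gauss_exp (Qt_sym B Qsym t) Su m0 (- a))).
  by apply: measurable_kernel1; exact: measurable_wave.
move=> y; rewrite normrM ger0_norm// mulrCA ler_wpM2l// (le_trans (wave_le _ _ _ _))//.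
by rewrite dotvBr dotv_flow dotvNl expRD.
Qed.

Let Qt_le_Qinf t x : 0 <= t -> dotv (S t *m x) x <= dotv (Qinf *m x) x.
Proof. by move=> t0; rewrite (Qinf_flow _ t0) lerDl Qinf_psd. Qed.

(** By invariance the truncation may be replaced by its image at time m + 1, which is at most both k
    and C exp <flow a (m + 1), x>. As m grows the flow tends to 0, and the integral of the minimum
    tends to min(C, k). The bound does not depend on k, which monotone convergence needs. *)
Let exp_trunc_integral a k :
  \int[mu]_x exp_trunc a k x <= expR (2^-1 * dotv (Qinf *m a) a).
Proof.
set C := expR _.
have mtr c l : measurable_fun [set: 'cV[R]_n] (exp_trunc c l).
  by apply: measurable_minr; [exact: measurable_exp_dotv|exact: measurable_cst].
have btr c l x : `|exp_trunc c l x| <= l%:R by rewrite ger0_norm.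
pose v m x := Num.min (C * expR (dotv (flow a m.+1%:R) x)) (k%:R : R).
have mv m : measurable_fun [set: 'cV[R]_n] (v m).
  by apply: measurable_minr => //; apply: measurable_funM => //; exact: measurable_exp_dotv.
have bv m x : `|v m x| <= k%:R.
  by rewrite ger0_norm ?ge_min ?lexx ?orbT// le_min ler0n mulr_ge0 ?expR_ge0.
have [|||_ H] := @dominated_Rintegral _ _ _ mu v (cst (Num.min C k%:R)) (cst k%:R) mv.
- move=> x; rewrite /v /cst.
  have cmin : continuous (fun y : R => Num.min y k%:R).
    by move=> y; apply: (@continuous_min _ _ id (cst k%:R)); [exact: cvg_id|exact: cst_continuous].
  have K : C * expR (dotv (flow a m.+1%:R) x) @[m --> \oo] --> C * expR 0.
    by apply: cvgMr; apply: cvg_expR; exact: dotv_flow_cvg0.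
  rewrite expR0 mulr1 in K.
  exact: (@continuous_cvg _ _ _ _ _ (fun m => C * expR (dotv (flow a m.+1%:R) x))
    (fun y : R => Num.min y k%:R) C (cmin C) K).
- exact: integrable_probability_cst.
- by move=> m x; exact: bv.
rewrite Rintegral_probability_cst in H.
apply: (@le_trans _ _ (Num.min C k%:R)); last by rewrite ge_min lexx.
rewrite -(cvg_lim _ H)//; apply: limr_ge; first exact: cvgP H.
apply: nearW => m; set t : R := m.+1%:R; have t0 : 0 < t by [].
rewrite -(inv t0); last 2 first.
- exact: exp_trunc_continuous.
- by apply: (@bounded_funP _ k%:R); exact: btr.
have Tk x : OU_semigroup Q B t (exp_trunc a k) x <= k%:R.
  rewrite -[leRHS](OU_semigroup_cst k%:R x t0); apply: OU_semigroup_le => //.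
  - exact: integrable_kernel (btr a k).
  - by apply: (integrable_kernel (M := k%:R)) => // y; rewrite ger0_norm.
have Te x : OU_semigroup Q B t (exp_trunc a k) x <= C * expR (dotv (flow a t) x).
  apply: (@le_trans _ _ (OU_semigroup Q B t (wave a 0 0) x)).
    apply: OU_semigroup_le => //.
    - exact: integrable_kernel (btr a k).
    - exact: integrable_kernel_wave.
    - by move=> y; rewrite wave_exp.
  rewrite OU_semigroup_wave// flow_zero mulmx0 !dotv0r subr0 addr0 wave_exp.
  by rewrite ler_wpM2r ?expR_ge0// ler_expR ler_wpM2l// Qt_le_Qinf// ltW.
have T0 x : 0 <= OU_semigroup Q B t (exp_trunc a k) x.
  have [_ _ ->] := OU_semigroup_kernel t0.
  by rewrite mulr_ge0 ?invr_ge0 ?(ltW (mass_gt0 t0))// Rintegral_ge0// => y _; rewrite mulr_ge0.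
apply: le_Rintegral => //.
- apply: (@integrable_probability_bounded _ _ _ _ _ k%:R).
    exact: measurable_OU_semigroup (btr a k).
  by move=> x; rewrite ger0_norm.
- exact: integrable_probability_bounded (bv m).
- by move=> x _; rewrite le_min Te Tk.
Qed.

Lemma integrable_exp_dotv a : mu.-integrable [set: 'cV[R]_n] (EFin \o (fun x => expR (dotv a x))).
Proof.
have mtr k : measurable_fun [set: 'cV[R]_n] (exp_trunc a k).
  by apply: measurable_minr; [exact: measurable_exp_dotv|exact: measurable_cst].
apply/integrableP; split; first by apply/measurable_EFinP; exact: measurable_exp_dotv.
have E x : limn (fun k => (exp_trunc a k x)%:E) = `|(expR (dotv a x))%:E|%E.
  rewrite gee0_abs ?lee_fin ?expR_ge0//; apply/cvg_lim => //.
  by apply: cvg_EFin; [exact: nearW|exact: exp_trunc_cvg].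
have tr0 k x : [set: 'cV[R]_n] x -> (0 <= (exp_trunc a k x)%:E)%E by rewrite lee_fin.
have trS x : [set: 'cV[R]_n] x -> {homo (fun k => (exp_trunc a k x)%:E) : k l / (k <= l)%N >-> (k <= l)%E}.
  by move=> _ k l kl; rewrite lee_fin exp_trunc_le2.
have mtrE k : measurable_fun [set: 'cV[R]_n] (fun x => (exp_trunc a k x)%:E).
  by apply/measurable_EFinP; exact: mtr.
have := @cvg_monotone_convergence _ _ _ mu setT measurableT _ mtrE tr0 trS.
rewrite (eq_integral (fun x => `|(expR (dotv a x))%:E|)%E); last by move=> x _; exact: E.
move=> H; rewrite -(cvg_lim _ H)//.
apply: (@le_lt_trans _ _ (expR (2^-1 * dotv (Qinf *m a) a))%:E); last exact: ltry.
apply: lime_le; first exact: cvgP H.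
apply: nearW => k; rewrite -[leLHS]fineK.
  by rewrite lee_fin; exact: exp_trunc_integral.
apply: (@integrable_fin_num _ _ _ _ _ measurableT (EFin \o exp_trunc a k)).
by apply: (@integrable_probability_bounded _ _ _ _ _ k%:R) => // x; rewrite ger0_norm.
Qed.

Lemma integrable_wave a b th : mu.-integrable [set: 'cV[R]_n] (EFin \o wave a b th).
Proof.
apply: le_integrableR (integrable_exp_dotv a); first exact: measurable_wave.
exact: wave_le.
Qed.

(** Invariance extended to an unbounded function: the exponential factor is truncated, and dominated
    convergence is used for the kernel integral, then for both integrals over [mu]. *)
Let invariant_wave t a b th : 0 < t ->
  \int[mu]_x wave a b th x = expR (2^-1 * (dotv (S t *m a) a - dotv (S t *m b) b)) *
  \int[mu]_x wave (flow a t) (flow b t) (th + dotv (S t *m a) b) x.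
Proof.
move=> t0.
pose f k x := exp_trunc a k x * cos (dotv b x + th).
have mf k : measurable_fun [set: 'cV[R]_n] (f k).
  apply: measurable_funM; last exact: measurable_cos_dotv.
  by apply: measurable_minr; [exact: measurable_exp_dotv|exact: measurable_cst].
have f_le k x : `|f k x| <= exp_trunc a k x.
  by rewrite normrM ger0_norm// ler_piMr// normr_cos_le1.
have f_k k x : `|f k x| <= k%:R := le_trans (f_le k x) (exp_trunc_le a k x).
have f_exp k x : `|f k x| <= expR (dotv a x) := le_trans (f_le k x) (exp_trunc_le_exp a k x).
have f_cvg x : f k x @[k --> \oo] --> wave a b th x.
  by apply: cvgMl; exact: exp_trunc_cvg.
have [_ H1] := dominated_Rintegral mf f_cvg (integrable_exp_dotv a) f_exp.
have [_ m0 TE] := OU_semigroup_kernel t0.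
have Tf_cvg x : OU_semigroup Q B t (f k) x @[k --> \oo] --> OU_semigroup Q B t (wave a b th) x.
  rewrite TE; under eq_fun do rewrite TE; apply: cvgMr.
  have [||||_ H] := @dominated_Rintegral _ _ _ leb
    (fun k y => gauss (S t) y * f k (expmx (t *: B) *m x - y))
    (fun y => gauss (S t) y * wave a b th (expmx (t *: B) *m x - y))
    (fun y => gauss (S t) y * wave a 0 0 (expmx (t *: B) *m x - y)).
  - by move=> k; exact: measurable_kernel1.
  - by move=> y; apply: cvgMr; exact: f_cvg.
  - exact: integrable_kernel_wave.
  - by move=> k y; rewrite normrM ger0_norm// ler_wpM2l// wave_exp.
  exact: H.
have Tf_le k x : `|OU_semigroup Q B t (f k) x| <= OU_semigroup Q B t (wave a 0 0) x.
  rewrite !TE normrM gtr0_norm ?invr_gt0 ?mass_gt0//.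
  rewrite ler_wpM2l ?invr_ge0 ?(ltW (mass_gt0 t0))//.
  apply: (le_trans (le_normr_Rintegral measurableT _)).
    exact: integrable_kernel (f_k k).
  apply: le_Rintegral => //.
  - apply: integrableR_norm; exact: integrable_kernel (f_k k).
  - exact: integrable_kernel_wave.
  - by move=> y _; rewrite normrM ger0_norm// ler_wpM2l// wave_exp.
have IT : mu.-integrable [set: 'cV[R]_n] (EFin \o OU_semigroup Q B t (wave a 0 0)).
  apply: (eq_integrableR _ (integrableRZ (expR (2^-1 * (dotv (S t *m a) a - dotv (S t *m 0) 0)))
    (integrable_wave (flow a t) (flow 0 t) (0 + dotv (S t *m a) 0)))) => x.
  by rewrite OU_semigroup_wave.
have [_ H2] := dominated_Rintegral
  (fun k => measurable_OU_semigroup t0 (mf k) (f_k k)) Tf_cvg IT Tf_le.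
have E k : \int[mu]_x f k x = \int[mu]_x OU_semigroup Q B t (f k) x.
  rewrite inv//; last exact: bounded_funP (f_k k).
  move=> x; apply: continuousM; first exact: exp_trunc_continuous.
  apply: continuous_comp; last exact: continuous_cos.
  by apply: continuousD; [exact: dotv_continuous|exact: cst_continuous].
move: H2; rewrite (_ : (fun k => _) = (fun k => \int[mu]_x f k x)); last first.
  by apply/funext => k; rewrite E.
move=> H2; rewrite (cvg_unique _ H1 H2)//.
rewrite -RintegralZl//; last exact: integrable_wave.
by apply: eq_Rintegral => x _; rewrite OU_semigroup_wave.
Qed.

(** A single integrable function above exp <a, x> for all a with entries bounded by c: <a, x> is at
    most c n times the largest |x_i|, and that exponential is bounded by one of the summands. The
    term 1 covers dimension 0. *)
Definition exp_dom (c : R) (x : 'cV[R]_n) : R :=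
  1 + \sum_i (expR (dotv ((c * n%:R) *: delta_mx i 0) x) +
               expR (dotv (- ((c * n%:R) *: delta_mx i 0)) x)).

Lemma exp_dom_ge0 c (x : 'cV[R]_n) : 0 <= exp_dom c x.
Proof. by rewrite /exp_dom addr_ge0// sumr_ge0// => i _; rewrite addr_ge0 ?expR_ge0. Qed.

Lemma integrable_exp_dom c : mu.-integrable [set: 'cV[R]_n] (EFin \o exp_dom c).
Proof.
apply: integrableRD; first exact: (integrable_probability_cst mu 1).
apply: integrableR_sum => // i; apply: integrableRD; exact: integrable_exp_dotv.
Qed.

Lemma exp_dotv_le_dom (c : R) (a x : 'cV[R]_n) : (forall i, `|a i 0| <= c) -> expR (dotv a x) <= exp_dom c x.
Proof.
move=> ac; rewrite /exp_dom.
have S0 : 0 <= \sum_i (expR (dotv ((c * n%:R) *: delta_mx i 0) x) +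
               expR (dotv (- ((c * n%:R) *: delta_mx i 0)) x)).
  by apply: sumr_ge0 => i _; rewrite addr_ge0 ?expR_ge0.
have [i0 _|n0] := pickP (fun _ : 'I_n => true); last first.
  by rewrite /dotv big_pred0 ?expR0 ?lerDl.
have [i _ Hi] := @arg_maxP _ _ _ i0 xpredT (fun i => `|x i 0|) isT.
have H : dotv a x <= c * n%:R * `|x i 0|.
  apply: (@le_trans _ _ (\sum_(j < n) c * `|x i 0|)); last first.
    by rewrite sumr_const card_ord -mulr_natr; lra.
  apply: ler_sum => j _; rewrite (le_trans (ler_norm _))// normrM.
  by apply: ler_pM => //; exact: Hi.
apply: (@le_trans _ _ (expR (c * n%:R * x i 0) + expR (- (c * n%:R * x i 0)))).
  apply: (@le_trans _ _ (expR (c * n%:R * `|x i 0|))); first by rewrite ler_expR.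
  have [x0|x0] := leP 0 (x i 0); first by rewrite ger0_norm// lerDl expR_ge0.
  by rewrite ltr0_norm// mulrN lerDr expR_ge0.
rewrite (bigD1 i)//= addrCA -!(dotvC x) dotvNr !dotvZr dotv_delta lerDl.
by rewrite addr_ge0// sumr_ge0// => j _; rewrite addr_ge0 ?expR_ge0.
Qed.

(** Let the time go to infinity in [invariant_wave]: the flowed frequencies vanish, so the wave
    flattens to a constant cosine while S_t tends to [Qinf]. This is the complex exponential moment
    of a centred Gaussian of covariance [Qinf]. *)
Lemma Rintegral_wave a b th : \int[mu]_x wave a b th x =
  expR (2^-1 * (dotv (Qinf *m a) a - dotv (Qinf *m b) b)) * cos (dotv (Qinf *m a) b + th).
Proof.
pose u k x := wave (flow a k.+1%:R) (flow b k.+1%:R) (th + dotv (S k.+1%:R *m a) b) x.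
have Slim x y : dotv (S k.+1%:R *m x) y @[k --> \oo] --> dotv (Qinf *m x) y.
  have := @Qinf_lim 1 x y ler01; apply: cvg_trans; apply: near_eq_cvg; apply: nearW => k.
  by rewrite -natr1 addrC.
have [c Hc] : exists c, forall k i, `|flow a k.+1%:R i 0| <= c.
  have H i : exists c, forall k, `|flow a k.+1%:R i 0| <= c.
    have := flow_cvg0 a i => /cvgP /cvg_seq_bounded [M [_ HM]].
    by exists (M + 1) => k; apply: (HM (M + 1)) => //; rewrite ltrDl.
  have [f Hf] := choice H.
  exists (\sum_i `|f i|) => k i; apply: (le_trans (Hf i k)).
  rewrite (bigD1 i)//= (le_trans (ler_norm (f i)))// lerDl.
  by apply: sumr_ge0.
have [||||_ H] := @dominated_Rintegral _ _ _ mu u (cst (cos (th + dotv (Qinf *m a) b))) (exp_dom c).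
- by move=> k; exact: measurable_wave.
- move=> x; rewrite /cst -[X in _ --> X]mul1r -[X in X * _]expR0.
  apply: cvgM; first by apply: cvg_expR; exact: dotv_flow_cvg0.
  apply: cvg_cos; rewrite -[X in _ --> X]add0r.
  apply: cvgD; first exact: dotv_flow_cvg0.
  by apply: cvgD; [exact: cvg_cst|exact: Slim].
- exact: integrable_exp_dom.
- by move=> k x; rewrite (le_trans (wave_le _ _ _ _))// exp_dotv_le_dom.
rewrite Rintegral_probability_cst in H.
have H1 : expR (2^-1 * (dotv (S k.+1%:R *m a) a - dotv (S k.+1%:R *m b) b)) *
    \int[mu]_x u k x @[k --> \oo] -->
    expR (2^-1 * (dotv (Qinf *m a) a - dotv (Qinf *m b) b)) * cos (th + dotv (Qinf *m a) b).
  by apply: cvgM H; apply: cvg_expR; apply: cvgMr; apply: cvgB; exact: Slim.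
have H2 : expR (2^-1 * (dotv (S k.+1%:R *m a) a - dotv (S k.+1%:R *m b) b)) *
    \int[mu]_x u k x @[k --> \oo] --> \int[mu]_x wave a b th x.
  by under eq_fun do rewrite -invariant_wave//; exact: cvg_cst.
by rewrite (cvg_unique _ H2 H1)// (addrC th).
Qed.

End invariant_measure_gaussian.

(** * Phases *)

Section scalar_estimates.
Context {R : realType}.

(** The mean value theorem for f - A s^2 / 2, whose derivative is o(s); differentiability of f' at 0
    alone is enough. *)
Lemma taylor2 (f f' : R -> R) (A : R) : (forall s, has_deriv f s (f' s)) ->
  has_deriv f' 0 A -> f 0 = 0 -> f' 0 = 0 ->
  forall e, 0 < e -> exists2 d, 0 < d &
    forall s, `|s| <= d -> `|f s - 2^-1 * A * s ^+ 2| <= e * s ^+ 2.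
Proof.
move=> df [df' AE] f0 f'0 e e0.
have : h^-1 *: ((f' \o shift 0) (h *: (1 : R^o)) - f' 0) @[h --> 0^'] --> A.
  by rewrite -AE; exact: df'.
move=> /cvgrPdist_le /(_ _ e0) [d /= d0 Hd].
have Hb s : `|s| < d -> `|f' s - A * s| <= e * `|s|.
  move=> sd; have [->|s0] := eqVneq s 0; first by rewrite f'0 mulr0 subr0 normr0 mulr0.
  have := Hd s; rewrite /= sub0r normrN => /(_ sd s0).
  rewrite scaler1 addr0 f'0 subr0 => H.
  have -> : f' s - A * s = - (s * (A - s^-1 *: f' s)).
    by rewrite -[_ *: _]/(_ * _) mulrBr mulrA mulfV// mul1r opprB (mulrC A).
  by rewrite normrN normrM mulrC ler_wpM2r.
pose g s := f s - 2^-1 * A * (s * s).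
have dg s : has_deriv g s (f' s - A * s).
  apply: has_deriv_eq.
    apply: has_derivB; first exact: df.
    by apply/has_derivZ/has_derivM; exact: has_deriv_id.
  by rewrite /=; field.
have g0 : g 0 = 0 by rewrite /g f0; ring.
exists (d / 2); first by rewrite divr_gt0.
move=> s sd; rewrite expr2 -/(g s).
have sd' : `|s| < d by rewrite (le_lt_trans sd)// ltr_pdivrMr//; lra.
have [s0|s0|->] := ltgtP s 0; last by rewrite g0 normr0; nra.
- have [c /andP[sc c0]] := has_deriv_MVT s0 dg.
  rewrite g0 sub0r sub0r => /(congr1 (fun x => `|x|)); rewrite normrN => ->.
  rewrite normrM normrN (ltr0_norm s0).
  have := Hb c; rewrite (ltr0_norm c0) => Hc.
  have : - c < d by move: sd'; rewrite (ltr0_norm s0); lra.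
  move=> /Hc H; have H1 : `|f' c - A * c| <= e * - s by rewrite (le_trans H)// ler_wpM2l// ?ltW//; lra.
  have := ler_wpM2r (_ : 0 <= - s) H1; rewrite oppr_ge0 ltW// => /(_ isT); lra.
- have [c /andP[c0 cs]] := has_deriv_MVT s0 dg.
  rewrite g0 !subr0 => ->; rewrite normrM (gtr0_norm s0).
  have := Hb c; rewrite (gtr0_norm c0) => Hc.
  have : c < d by move: sd'; rewrite (gtr0_norm s0); lra.
  move=> /Hc H; have H1 : `|f' c - A * c| <= e * s by rewrite (le_trans H)// ler_wpM2l// ltW.
  have := ler_wpM2r (ltW s0) H1; lra.
Qed.

Lemma cos_ge (v : R) : 1 - v ^+ 2 / 2 <= cos v.
Proof.
have H (x : R) : 0 <= x -> sin x <= x.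
  move=> x0; have [->|xn] := eqVneq x 0; first by rewrite sin0.
  have x1 : 0 < x by rewrite lt_def xn.
  have [c _] := @has_deriv_MVT _ sin cos 0 x x1 (fun y => is_derive_sin y).
  rewrite sin0 !subr0 => ->; have := cos_le1 c; nra.
have K (w : R) : 0 <= w -> 1 - w ^+ 2 / 2 <= cos w.
  move=> w0; have [->|wn] := eqVneq w 0; first by rewrite cos0; lra.
  have w1 : 0 < w by rewrite lt_def wn.
  pose g (x : R) : R := cos x + 2^-1 * (x * x).
  have dg x : has_deriv g x (- sin x + x).
    apply: has_deriv_eq.
      apply: has_derivD; first exact: is_derive_cos.
      by apply/has_derivZ/has_derivM; exact: has_deriv_id.
    by rewrite /=; field.
  have [c /andP[c0 _]] := has_deriv_MVT w1 dg.
  rewrite /g cos0 !mulr0 !addr0 => E.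
  have := H c (ltW c0) => Hc.
  have : 0 <= (- sin c + c) * (w - 0) by rewrite mulr_ge0//; lra.
  rewrite -E expr2; lra.
by have [v0|v0] := leP 0 v; [exact: K|rewrite -cosN -sqrrN; apply: K; lra].
Qed.

(* A minorant of Re exp(-Y (1 + o(1))) which is integrated in closed form: with
   Y = k t s^2, the left-hand side is (1/4) d/ds (s / (1 + Y)). *)
Lemma oscillation_minorant (Y : R) : 0 <= Y ->
  4^-1 * ((1 - Y) / (1 + Y) ^+ 2) <=
  2^-1 * expR (- (5 / 4 * Y)) - 20^-1 ^+ 2 * Y ^+ 2 * expR (- (3 / 4 * Y)).
Proof.
move=> Y0.
have E3 : expR (- (3 / 4 * Y)) <= 1 by rewrite -[leRHS]expR0 ler_expR; lra.
have E30 := expR_ge0 (- (3 / 4 * Y)).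
have E50 := expR_ge0 (- (5 / 4 * Y)).
have p1 : 1 <= (1 + Y) ^+ 2 by rewrite expr2; nra.
have p0 : 0 < (1 + Y) ^+ 2 by lra.
(* Up to 6/5, exp(-5Y/4) is at least the square of 1 - 5Y/8, which stays positive. Beyond, the left
   side is negative and has to beat the error term alone; the cut lies above 1 because the left side
   vanishes at Y = 1. *)
have [Y1|Y1] := leP Y (6 / 5).
  have E5 : (1 - 5 / 8 * Y) ^+ 2 <= expR (- (5 / 4 * Y)).
    have -> : - (5 / 4 * Y) = - (5 / 8 * Y) + - (5 / 8 * Y) by lra.
    rewrite expRD expr2; have := expR_ge1Dx (- (5 / 8 * Y)) => H.
    by apply: ler_pM; lra.
  have H1 : 4^-1 * ((1 - Y) / (1 + Y) ^+ 2) <= 4^-1 * Num.max 0 (1 - Y).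
    rewrite ler_wpM2l// ler_pdivrMr//.
    by have [?|?] := leP (1 - Y) 0; nra.
  have H2 : 20^-1 ^+ 2 * Y ^+ 2 * expR (- (3 / 4 * Y)) <= 20^-1 ^+ 2 * Y ^+ 2.
    by rewrite ler_piMr// mulr_ge0// sqr_ge0.
  apply: (le_trans H1); rewrite lerBrDr; move: H2 E5; rewrite !expr2.
  by have [?|?] := leP (1 - Y) 0; nra.
have H1 : 4^-1 * ((1 - Y) / (1 + Y) ^+ 2) <= - (20^-1 ^+ 2 * Y ^+ 2 * expR (- (3 / 4 * Y))).
  have e3 : 1 <= expR (- (3 / 4 * Y)) * expR (3 / 4 * Y).
    by rewrite -expRD addNr expR0.
  have E : (1 + Y / 4) ^+ 3 <= expR (3 / 4 * Y).
    have -> : 3 / 4 * Y = Y / 4 + Y / 4 + Y / 4 by lra.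
    rewrite !expRD -[_ * _ * _]/(_ * _ * _) exprS expr2 mulrA.
    have H := expR_ge1Dx (Y / 4).
    by apply: ler_pM; [nra|lra|apply: ler_pM; lra|lra].
  set e := expR (- _) in e3 E30 *; set f := expR (3 / 4 * Y) in e3 E.
  have f0 : 0 < f by exact: expR_gt0.
  have ef : e = f^-1.
    by rewrite /e expRN.
  have Y2 : 0 <= Y ^+ 2 by exact: sqr_ge0.
  have M : 4 * 20^-1 ^+ 2 * Y ^+ 2 * (1 + Y) ^+ 2 <= (Y - 1) * f.
    apply: (@le_trans _ _ ((Y - 1) * (1 + Y / 4) ^+ 3)); last by rewrite ler_wpM2l//; lra.
    (* Expanded in z = Y - 6/5, the difference of the two sides has nonnegative coefficients. *)
    have -> : Y = (Y - 6 / 5) + 6 / 5 by lra.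
    have : 0 <= Y - 6 / 5 by lra.
    set z := Y - 6 / 5 => z0; rewrite -subr_ge0.
    have z2 : 0 <= z ^+ 2 by exact: sqr_ge0.
    have z3 : 0 <= z ^+ 3 by exact: exprn_ge0.
    have z4 : 0 <= z ^+ 4 by exact: exprn_ge0.
    lra.
  have : 20^-1 ^+ 2 * Y ^+ 2 * f^-1 <= 4^-1 * ((Y - 1) / (1 + Y) ^+ 2).
    rewrite ler_pdivrMr//.
    have -> : 4^-1 * ((Y - 1) / (1 + Y) ^+ 2) * f = 4^-1 * (Y - 1) * f / (1 + Y) ^+ 2 by ring.
    by rewrite ler_pdivlMr//; lra.
  rewrite ef -[1 - Y]opprB mulNr mulrN; lra.
apply: (le_trans H1); rewrite lerBrDr; lra.
Qed.


Lemma Rintegral_FTC (F f : R -> R) (a b : R) : a < b ->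
  (forall x, has_deriv F x (f x)) -> continuous f ->
  \int[lebesgue_measure]_(x in `[a, b]) f x = F b - F a.
Proof.
move=> ab dF cf.
have cF x : {for x, continuous F} by exact: has_deriv_continuous (dF x).
rewrite /Rintegral (@continuous_FTC2 _ f F)//.
- exact: continuous_subspaceT.
- split; first by move=> x _; have [] := dF x.
  + by apply: cvg_at_right_filter; exact: cF.
  + by apply: cvg_at_left_filter; exact: cF.
- by move=> x _; rewrite derive1E; have [_ ->] := dF x.
Qed.

(** The integrand is bounded below by the derivative of F(s) = s / (4 (1 + k t s^2)), and F(d) -
    F(-d) is the claimed bound. This gives the decay in 1/t without comparison with a Gaussian
    integral over the line. *)
Lemma oscillatory_lower_bound (tau k d t : R) (chir chii : R -> R) :
  0 < k -> 0 < d -> 0 < t -> `|tau| * d <= 4^-1 ->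
  continuous chir -> continuous chii ->
  (forall s, `|s| <= d -> - (5 / 4 * (k * s ^+ 2)) <= chir s <= - (3 / 4 * (k * s ^+ 2))) ->
  (forall s, `|s| <= d -> `|chii s| <= 20^-1 * (k * s ^+ 2)) ->
  d / (2 * (1 + k * t * d ^+ 2)) <=
  \int[lebesgue_measure]_(s in `[- d, d]) (expR (tau * s + t * chir s) * cos (t * chii s)).
Proof.
move=> k0 d0 t0 taud cr ci Hr Hi.
pose D (s : R) : R := 1 + k * t * (s * s).
have D1 s : 1 <= D s by rewrite /D lerDl -expr2 mulr_ge0 ?sqr_ge0// mulr_ge0 ?ltW.
have D0 s : 0 < D s by rewrite (lt_le_trans ltr01).
have n0 s : D s != 0 by rewrite gt_eqF.
pose F s := 4^-1 * (s * (D s)^-1).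
pose F' s := 4^-1 * ((1 - k * t * (s * s)) * ((D s)^-1 * (D s)^-1)).
have dss (c s : R) : has_deriv (fun s => c * (s * s)) s (2 * c * s).
  apply: has_deriv_eq; first by apply/has_derivZ/has_derivM; exact: has_deriv_id.
  by rewrite /=; ring.
have dD s : has_deriv D s (2 * (k * t) * s).
  apply: has_deriv_eq; first by apply: has_derivD; [exact: has_deriv_cst|exact: dss].
  by rewrite add0r.
have dV s : has_deriv (fun s => (D s)^-1) s (- (D s) ^- 2 * (2 * (k * t) * s)).
  exact: (is_deriveV (n0 s) (dD s)).
have dF s : has_deriv F s (F' s).
  apply: has_deriv_eq; first by apply/has_derivZ/has_derivM; [exact: has_deriv_id|exact: dV].
  have E : k * t * (s * s) = D s - 1 by rewrite /D; ring.
  rewrite /F' E /=.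
  have -> : s * (- D s ^- 2 * (2 * (k * t) * s)) = - (2 * (k * t * (s * s)) * D s ^- 2) by ring.
  by rewrite E; field.
have cF' : continuous F'.
  move=> s; apply: has_deriv_continuous; apply: has_derivZ; apply: has_derivM.
    by apply: has_derivB; [exact: has_deriv_cst|exact: dss].
  by apply: has_derivM; exact: dV.
have -> : d / (2 * (1 + k * t * d ^+ 2)) =
    \int[lebesgue_measure]_(s in `[- d, d]) F' s.
  rewrite (Rintegral_FTC (F := F))//; last by lra.
  have -> : 1 + k * t * d ^+ 2 = D d by rewrite /D; ring.
  rewrite /F; have -> : D (- d) = D d by rewrite /D; ring.
  by field.
apply: le_Rintegral => //.
- exact: continuous_integrable_itv.
- have ce : continuous (fun s => expR (tau * s + t * chir s)).
    move=> s; apply: continuous_comp; last exact: continuous_expR.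
    apply: (@continuousD _ _ _ (fun s => tau * s) (fun s => t * chir s)).
      by apply: has_deriv_continuous; exact: has_deriv_mull.
    apply: (@continuousM _ _ (fun=> t) chir); [exact: cst_continuous|exact: cr].
  have cc : continuous (fun s => cos (t * chii s)).
    move=> s; apply: (@continuous_comp _ _ _ (fun s => t * chii s)); last exact: continuous_cos.
    apply: (@continuousM _ _ (fun=> t) chii); [exact: cst_continuous|exact: ci].
  apply: continuous_integrable_itv => s.
  exact: (continuousM (ce s) (cc s)).
move=> s; rewrite /= in_itv /= => /andP[s1 s2].
have sd : `|s| <= d by rewrite ler_norml s1.
pose Y := k * t * s ^+ 2.
have Y0 : 0 <= Y by rewrite mulr_ge0 ?sqr_ge0// mulr_ge0 ?ltW.
have -> : F' s = 4^-1 * ((1 - Y) / (1 + Y) ^+ 2).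
  rewrite /F' -expr2 -/Y; have -> : D s = 1 + Y by rewrite /D /Y expr2.
  by rewrite -invfM -expr2.
apply: (le_trans (oscillation_minorant Y0)).
have tauS : `|tau * s| <= 4^-1 by rewrite normrM (le_trans _ taud)// ler_wpM2l.
(* The bound |tau s| <= 1/4 costs a factor 2 either way. Together with cos v >= 1 - v^2 / 2 and |v|
   <= Y / 20 this produces exactly the right side of [oscillation_minorant]. *)
have [E1 E2] : 2^-1 <= expR (tau * s) /\ expR (tau * s) <= 2.
  have := tauS; rewrite ler_norml => /andP[T1 T2].
  have A1 := expR_ge1Dx (tau * s); have A2 := expR_ge1Dx (- (tau * s)).
  have A3 := expRxMexpNx_1 (tau * s); have A4 := expR_gt0 (tau * s).
  by split; nra.
have /andP[R1 R2] := Hr s sd.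
have [X1 X2] : expR (- (5 / 4 * Y)) <= expR (t * chir s) /\
    expR (t * chir s) <= expR (- (3 / 4 * Y)).
  rewrite !ler_expR /Y; split.
    have := ler_wpM2l (ltW t0) R1; lra.
  have := ler_wpM2l (ltW t0) R2; lra.
have V : (t * chii s) ^+ 2 <= 20^-1 ^+ 2 * Y ^+ 2.
  have H : `|t * chii s| <= 20^-1 * Y.
    rewrite normrM (gtr0_norm t0) /Y; have := ler_wpM2l (ltW t0) (Hi s sd); lra.
  rewrite -(real_normK (num_real _)); have := normr_ge0 (t * chii s).
  rewrite !expr2; nra.
rewrite expRD.
set E := expR (tau * s) in E1 E2 *; set X := expR (t * chir s) in X1 X2 *.
have X0 : 0 <= X by exact: expR_ge0.
have := cos_ge (t * chii s); set v := (_ ^+ 2) in V * => C.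
have v0 : 0 <= v by exact: sqr_ge0.
have Z0 : 0 <= 20^-1 ^+ 2 * Y ^+ 2 by rewrite mulr_ge0 ?sqr_ge0.
have EX0 : 0 <= E * X by rewrite mulr_ge0//; lra.
apply: (@le_trans _ _ (E * X * (1 - v / 2))); last by rewrite ler_wpM2l.
have P1 : 2^-1 * X <= E * X by rewrite ler_wpM2r.
have P2 : E * X * v <= 2 * X * v by rewrite !ler_wpM2r.
have P3 : X * v <= expR (- (3 / 4 * Y)) * (20^-1 ^+ 2 * Y ^+ 2) by apply: ler_pM.
lra.
Qed.

End scalar_estimates.

(** * The covariance inner product and the choice of the curve *)

Section bracket.
Context {R : realType} {n : nat}.
Variables (Q B C : 'M[R]_n).
Hypothesis Qsym : Q^T = Q.
Hypothesis Qpsd : forall x : 'cV[R]_n, 0 <= dotv (Q *m x) x.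
Hypothesis Csym : C^T = C.
Hypothesis C_gt0 : forall x, x != 0 -> 0 < dotv (C *m x) x.
Hypothesis lyapunov : forall x, dotv (C *m x) (B^T *m x) = - (2^-1 * dotv (Q *m x) x).
Local Notation A := B^T.
Local Notation flow := (flow B).

Lemma mulmx_flow x s : A *m flow x s = flow (A *m x) s.
Proof. by rewrite /flow mulmxA expmx_comm mulmxA. Qed.

Definition ip (u v : 'cV[R]_n) : R := dotv (C *m u) v.

Lemma ipC u v : ip u v = ip v u.
Proof. exact: dotv_sym. Qed.

Lemma ipDl u v w : ip (u + v) w = ip u w + ip v w.
Proof. by rewrite /ip mulmxDr dotvDl. Qed.

Lemma ipDr u v w : ip u (v + w) = ip u v + ip u w.
Proof. by rewrite /ip dotvDr. Qed.

Lemma ipZl a u v : ip (a *: u) v = a * ip u v.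
Proof. by rewrite /ip -scalemxAr dotvZl. Qed.

Lemma ipZr a u v : ip u (a *: v) = a * ip u v.
Proof. by rewrite /ip dotvZr. Qed.

Lemma ipNl u v : ip (- u) v = - ip u v.
Proof. by rewrite -scaleN1r ipZl mulN1r. Qed.

Lemma ipNr u v : ip u (- v) = - ip u v.
Proof. by rewrite -scaleN1r ipZr mulN1r. Qed.

Lemma ip_lyapunov u v : ip (A *m u) v + ip u (A *m v) = - dotv (Q *m u) v.
Proof.
have := lyapunov (u + v); rewrite !mulmxDr !dotvDl !dotvDr !lyapunov.
rewrite -!/(ip _ _) (ipC v (A *m u)) (dotv_sym Qsym v u); lra.
Qed.

Lemma has_deriv_ip_flow x w s : has_deriv (fun s => ip (flow x s) w) s (ip (flow (A *m x) s) w).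
Proof.
have E y : ip y w = dotv (C *m w) y by rewrite ipC.
rewrite (_ : (fun s => _) = (fun s => dotv (C *m w) (flow x s))); last first.
  by apply/funext => t; rewrite E.
by rewrite E -mulmx_flow; exact: has_deriv_dotv_flow.
Qed.

Lemma has_deriv_ip_flow2 x s : has_deriv (fun s => ip (flow x s) (flow x s)) s
  (- dotv (Q *m flow x s) (flow x s)).
Proof.
apply: has_deriv_eq; first exact: has_deriv_form_flow.
exact: ip_lyapunov.
Qed.

(* the exponents of <g(s), g(0)> (real and imaginary parts) and of |g(s)|^2,
   for the curve zeta = flow al + i flow be *)
Definition phase_re (zr : R) (al be : 'cV[R]_n) s : R :=
  zr * s + (ip (flow al s) al + ip (flow be s) be) - (ip al al + ip be be).

Definition phase_im (zi : R) (al be : 'cV[R]_n) s : R :=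
  zi * s + (ip (flow be s) al - ip (flow al s) be).

Definition weight (zr : R) (al be : 'cV[R]_n) s : R :=
  2 * zr * s + (ip (flow al s) (flow al s) + ip (flow be s) (flow be s)) -
  (ip al al + ip be be).

Variable eta : 'cV[R]_n.
Hypothesis Qeta : Q *m eta = 0.
Hypothesis QAeta : Q *m (A *m eta) != 0.

Let th := A *m eta.
Let th2 := A *m th.
Let th3 := A *m th2.
Let q := dotv (Q *m th) th.
Let m := ip th th.

Let q_gt0 : 0 < q.
Proof.
rewrite /q lt_def Qpsd andbT; apply: contra_neq QAeta; exact: psd_ker.
Qed.

Let m_gt0 : 0 < m.
Proof. by apply: C_gt0; apply/eqP => th0; move/eqP: QAeta; rewrite -/th th0 mulmx0. Qed.

Let Qe x : dotv (Q *m x) eta = 0.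
Proof. by rewrite (dotv_sym Qsym) Qeta dotv0l. Qed.

(** By the polarized Lyapunov equation A is antisymmetric for [ip] up to - Q. Since Q kills eta, the
    antisymmetry is exact as soon as one argument is eta; this and the next three values come from
    moving A across. *)
Let ip_th_eta : ip th eta = 0.
Proof. by have := ip_lyapunov eta eta; rewrite Qe -/th (ipC eta); lra. Qed.

Let ip_th2_eta : ip th2 eta = - m.
Proof. by have := ip_lyapunov th eta; rewrite Qe -/th -/th2 -/m; lra. Qed.

Let ip_th2_th : ip th2 th = - (q / 2).
Proof. by have := ip_lyapunov th th; rewrite -/th2 (ipC th th2) -/q; lra. Qed.

Let ip_th3_eta : ip th3 eta = q / 2.
Proof. by have := ip_lyapunov th2 eta; rewrite Qe -/th -/th3 ip_th2_th; lra. Qed.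

(** All three functions vanish at s = 0. The scalar b cancels the first derivatives of [phase_re]
    and [weight] simultaneously, c cancels that of [phase_im], and a large a makes the second
    derivatives of [phase_re] and [weight] negative, the former dominating that of [phase_im]. The
    rest is Taylor's formula on a small interval. *)
Lemma phase_geometry (zr zi tau : R) : 0 < zr -> exists (al be : 'cV[R]_n) (k d g : R),
  [/\ [/\ 0 < k, 0 < d, 0 < g & `|tau| * d <= 4^-1],
     forall s, `|s| <= d ->
       - (5 / 4 * (k * s ^+ 2)) <= phase_re zr al be s <= - (3 / 4 * (k * s ^+ 2)),
     forall s, `|s| <= d -> `|phase_im zi al be s| <= 20^-1 * (k * s ^+ 2),
     weight zr al be d <= - g & weight zr al be (- d) <= - g].
Proof.
move=> zr0.
(* At s = 0 the derivative of [phase_re] is zr - b^2 q / 2 and that of [weight] is twice that. *)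
pose b := Num.sqrt (2 * zr / q).
have b2 : b ^+ 2 = 2 * zr / q by rewrite sqr_sqrtr// divr_ge0 ?ltW// mulr_gt0.
have b0 : 0 < b by rewrite sqrtr_gt0 divr_gt0// mulr_gt0.
have b2q : b ^+ 2 * q = 2 * zr by rewrite b2 divfK// gt_eqF.
(* At s = 0 the derivative of [phase_im] is zi + 2 c b m. *)
pose c := - zi / (2 * b * m).
have cbm : 2 * (c * b * m) = - zi.
  have bn := lt0r_neq0 b0; have mn := lt0r_neq0 m_gt0.
  by rewrite /c; field; rewrite bn mn.
pose r3 := ip th3 th.
pose p := dotv (Q *m th2) th.
(* The second summand ensures kk > 20 |c b q|, so the phase oscillates far less than the amplitude
   decays; the third ensures w > 0. *)
pose a := 1 + (b ^+ 2 * `|r3| + 40 * `|c * b * q| + 1) / m + b * `|p| / q.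
have a1 : 1 <= a.
  rewrite /a -addrA lerDl addr_ge0// divr_ge0 ?(ltW m_gt0) ?(ltW q_gt0)//.
    by rewrite !addr_ge0// mulr_ge0// sqr_ge0.
  by rewrite mulr_ge0// ltW.
have am : b ^+ 2 * `|r3| + 40 * `|c * b * q| + 1 <= a * m.
  rewrite -ler_pdivrMr// /a; set X := _ / m.
  have : 0 <= b * `|p| / q by rewrite divr_ge0 ?(ltW q_gt0)// mulr_ge0// ltW.
  lra.
have aq : b * `|p| < a * q.
  rewrite -ltr_pdivrMr// /a; set Y := _ / q.
  have : 0 <= (b ^+ 2 * `|r3| + 40 * `|c * b * q| + 1) / m.
    by rewrite divr_ge0 ?(ltW m_gt0)// !addr_ge0// mulr_ge0// sqr_ge0.
  lra.
pose al := a *: eta + b *: th.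
pose be := c *: eta.
pose kk := ((a ^+ 2 + c ^+ 2) * m - b ^+ 2 * r3) / 2.
have kk0 : 20 * `|c * b * q| < kk.
  rewrite /kk ltr_pdivlMr//.
  have : 0 <= c ^+ 2 * m by rewrite mulr_ge0 ?sqr_ge0 ?(ltW m_gt0).
  have : b ^+ 2 * r3 <= b ^+ 2 * `|r3| by rewrite ler_wpM2l ?sqr_ge0 ?ler_norm.
  have : a * m <= a ^+ 2 * m by rewrite ler_wpM2r ?(ltW m_gt0)// expr2 ler_peMl//; lra.
  lra.
have k0 : 0 < kk by rewrite (le_lt_trans _ kk0)// mulr_ge0.
have Aal : A *m al = a *: th + b *: th2 by rewrite /al mulmxDr -!scalemxAr.
have A2al : A *m (A *m al) = a *: th2 + b *: th3 by rewrite Aal mulmxDr -!scalemxAr.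
have Abe : A *m be = c *: th by rewrite /be -scalemxAr.
have A2be : A *m (A *m be) = c *: th2 by rewrite Abe -scalemxAr.
have [ipe ipt] : ip eta th = 0 /\ ip eta th2 = - m by rewrite ipC ip_th_eta ipC ip_th2_eta.
have dlin (u s : R) : has_deriv (fun s => u * s) s u by exact: has_deriv_mull.
have [d1 d10 Hre] : exists2 d, 0 < d & forall s, `|s| <= d ->
    `|phase_re zr al be s - 2^-1 * (- (2 * kk)) * s ^+ 2| <= kk / 4 * s ^+ 2.
  apply: (@taylor2 _ _ (fun s => zr + (ip (flow (A *m al) s) al + ip (flow (A *m be) s) be))).
  - move=> s; apply: has_deriv_eq.
      apply: has_derivB; last exact: has_deriv_cst.
      apply: has_derivD; first exact: dlin.
      by apply: has_derivD; exact: has_deriv_ip_flow.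
    by rewrite subr0.
  - apply: has_deriv_eq.
      apply: has_derivD; first exact: has_deriv_cst.
      by apply: has_derivD; exact: has_deriv_ip_flow.
    rewrite !flow0 A2al A2be /al /be !ipDl !ipDr !ipZl !ipZr.
    rewrite ip_th2_eta ip_th2_th ip_th3_eta -/r3 /kk; by field.
  - by rewrite /phase_re !flow0 mulr0 add0r subrr.
  - rewrite !flow0 Aal Abe /al /be !ipDl !ipDr !ipZl !ipZr.
    rewrite ip_th_eta ip_th2_eta ip_th2_th -/m.
    have -> : zr = b ^+ 2 * q / 2 by rewrite b2q; field.
    by field.
  - by rewrite divr_gt0.
have [d2 d20 Him] : exists2 d, 0 < d & forall s, `|s| <= d ->
    `|phase_im zi al be s - 2^-1 * (- (c * b * q)) * s ^+ 2| <= kk / 40 * s ^+ 2.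
  apply: (@taylor2 _ _ (fun s => zi + (ip (flow (A *m be) s) al - ip (flow (A *m al) s) be))).
  - move=> s; apply: has_derivD; first exact: dlin.
    by apply: has_derivB; exact: has_deriv_ip_flow.
  - apply: has_deriv_eq.
      apply: has_derivD; first exact: has_deriv_cst.
      by apply: has_derivB; exact: has_deriv_ip_flow.
    rewrite !flow0 A2al A2be /al /be !ipDl !ipDr !ipZl !ipZr.
    by rewrite ip_th2_eta ip_th2_th ip_th3_eta; field.
  - by rewrite /phase_im !flow0 mulr0 add0r (ipC be) subrr.
  - rewrite !flow0 Aal Abe /al /be !ipDl !ipDr !ipZl !ipZr.
    rewrite ip_th_eta ip_th2_eta -/m.
    have -> : zi = - (2 * (c * b * m)) by rewrite cbm opprK.
    by ring.
  - by rewrite divr_gt0.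
(* The derivative at 0 of <Q zeta, conj zeta>. Its leading part 2 a b q couples eta to B^T eta,
   while eta contributes nothing to the value at 0. *)
pose w := 2 * (a * b * q + b ^+ 2 * p).
have w0 : 0 < w.
  have : b * (b * `|p|) < b * (a * q) by rewrite ltr_pM2l.
  have : b ^+ 2 * - p <= b ^+ 2 * `|p| by rewrite ler_wpM2l ?sqr_ge0// -normrN ler_norm.
  rewrite /w; lra.
have [d3 d30 Hw] : exists2 d, 0 < d & forall s, `|s| <= d ->
    `|weight zr al be s - 2^-1 * (- w) * s ^+ 2| <= w / 4 * s ^+ 2.
  apply: (@taylor2 _ _ (fun s => 2 * zr - (dotv (Q *m flow al s) (flow al s) +
    dotv (Q *m flow be s) (flow be s)))).
  - move=> s; apply: has_deriv_eq.
      apply: has_derivB; last exact: has_deriv_cst.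
      apply: has_derivD; first exact: dlin.
      by apply: has_derivD; exact: has_deriv_ip_flow2.
    by rewrite subr0 opprD.
  - apply: has_deriv_eq.
      apply: has_derivB; first exact: has_deriv_cst.
      by apply: has_derivD; exact: has_deriv_form_flow.
    rewrite !flow0 Aal Abe /al /be !mulmxDr -!scalemxAr Qeta !scaler0 add0r.
    rewrite !dotvDl !dotvDr !dotvZl !dotvZr !dotv0l !Qe.
    rewrite (dotv_sym Qsym th th2) -/q -/p /w; ring.
  - by rewrite /weight !flow0 mulr0 add0r subrr.
  - rewrite !flow0 /al /be !mulmxDr -!scalemxAr Qeta !scaler0 add0r.
    rewrite !dotvDr !dotvZl !dotvZr !dotv0l !Qe -/q -b2q; ring.
  - by rewrite divr_gt0.
(* The three Taylor radii, and a last bound that gives |tau| d <= 1/4. *)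
pose d := Num.min (Num.min d1 d2) (Num.min d3 (4 * (`|tau| + 1))^-1).
have d_gt0 : 0 < d by rewrite !lt_min d10 d20 d30 invr_gt0 mulr_gt0// ltr_wpDl.
have dd1 : d <= d1 by rewrite !ge_min lexx.
have dd2 : d <= d2 by rewrite !ge_min lexx orbT.
have dd3 : d <= d3 by rewrite !ge_min lexx orbT.
have dt : d <= (4 * (`|tau| + 1))^-1 by rewrite !ge_min lexx !orbT.
(* Taylor's formula gives [weight] at most - (w/2 - w/4) s^2; take s = d and s = - d. *)
exists al, be, kk, d, (w / 4 * d ^+ 2); split.
- split => //; first by rewrite mulr_gt0 ?exprn_gt0// divr_gt0.
  have t1 : 0 < `|tau| + 1 by rewrite ltr_wpDl.
  apply: (@le_trans _ _ ((`|tau| + 1) * (4 * (`|tau| + 1))^-1)).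
    by apply: ler_pM => //; [exact: ltW|rewrite lerDl].
  by rewrite invfM mulrCA mulfV ?gt_eqF// mulr1.
- move=> s sd; have := Hre s (le_trans sd dd1); rewrite ler_norml.
  by move=> /andP[? ?]; apply/andP; split; lra.
- move=> s sd; have := Him s (le_trans sd dd2); rewrite ler_norml => /andP[H1 H2].
  have s2 : 0 <= s ^+ 2 := sqr_ge0 s.
  have H3 : `|c * b * q| * s ^+ 2 <= kk / 20 * s ^+ 2 by rewrite ler_wpM2r//; lra.
  have H4 : c * b * q * s ^+ 2 <= `|c * b * q| * s ^+ 2 by rewrite ler_wpM2r// ler_norm.
  have H5 : - (c * b * q) * s ^+ 2 <= `|c * b * q| * s ^+ 2.
    by rewrite ler_wpM2r// -normrN ler_norm.
  by rewrite ler_norml; apply/andP; split; lra.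
- have := Hw d; rewrite gtr0_norm// => /(_ dd3); rewrite ler_norml => /andP[? ?]; lra.
- have := Hw (- d); rewrite normrN gtr0_norm// => /(_ dd3); rewrite ler_norml sqrrN => /andP[? ?]; lra.
Qed.

End bracket.

(** * Fubini on an interval, L^2 norms and the bracket vector *)

Section Fubini_interval.
Context d (T : measurableType d) (R : realType).
Variable m : {sigma_finite_measure set T -> \bar R}.
Variables (F : R -> T -> R) (a b : R) (D : T -> R).
Hypothesis mF : measurable_fun [set: measurableTypeR R * T] (fun p => F p.1 p.2).
Hypothesis FD : forall s x, a <= s <= b -> `|F s x| <= D x.
Hypothesis D0 : forall x, 0 <= D x.
Hypothesis iD : m.-integrable [set: T] (EFin \o D).

Let ab : set (measurableTypeR R) := [set` `[a, b]%R].
(** Cutting off by the indicator turns the interval integral into one over the line, so that Fubini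
    applies to the full product space. *)
Let G (s : R) (x : T) : R := \1_ab s * F s x.

Let mab : measurable ab. Proof. exact: measurable_itv. Qed.

Let ab_lty : (lebesgue_measure ab < +oo)%E.
Proof. by rewrite /ab lebesgue_measure_itv/=; case: ifP => _; rewrite ?ltry. Qed.

Let GD s x : `|G s x| <= \1_ab s * D x.
Proof.
rewrite /G normrM ger0_norm//.
rewrite indicE; have [sab|_] := boolP (s \in ab); rewrite ?mul0r// !mul1r.
by apply: FD; move: sab; rewrite inE /ab/= in_itv.
Qed.

Let mG : measurable_fun [set: measurableTypeR R * T] (fun p => G p.1 p.2).
Proof.
apply: measurable_funM => //; apply: measurableT_comp; last exact: measurable_fst.
exact: measurable_indic.
Qed.

Let mGs s : measurable_fun [set: T] (G s).
Proof. by apply: (measurableT_comp mG (pair1_measurable s)). Qed.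

Let mGx x : measurable_fun [set: measurableTypeR R] (fun s : R => G s x).
Proof. by apply: (measurableT_comp mG (pair2_measurable x)). Qed.

Let iGs s : m.-integrable [set: T] (EFin \o G s).
Proof. by apply: le_integrableR (mGs s) (GD s) _; exact: integrableRZ. Qed.

Let iGx x : (@lebesgue_measure R).-integrable [set: measurableTypeR R] (EFin \o (fun s : R => G s x)).
Proof.
have H s : `|G s x| <= D x * \1_ab s by rewrite mulrC.
apply: le_integrableR (mGx x) H _; apply: integrableRZ.
exact: integrable_indic_lty.
Qed.

Let iG : (m \x (@lebesgue_measure R))%E.-integrable setT (EFin \o (fun p => G p.2 p.1)).
Proof.
have mH : measurable_fun [set: T * measurableTypeR R] (fun p => \1_ab p.2 * D p.1).
  apply: measurable_funM; apply: measurableT_comp => //.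
  exact: integrableR_measurable iD.
have mG' : measurable_fun [set: T * measurableTypeR R] (fun p => G p.2 p.1).
  have := measurableT_comp mG (@measurable_swap _ _ T (measurableTypeR R)); exact.
apply: le_integrableR mG' (fun p => GD p.2 p.1) _.
apply/integrable21ltyP; first exact/measurable_EFinP.
rewrite (eq_integral (fun s => ((\int[m]_x D x) * \1_ab s)%:E)); last first.
  move=> s _; rewrite /=.
  under eq_integral => x _ do rewrite ger0_norm ?mulr_ge0//.
  rewrite -[LHS]fineK; last by apply: integrable_fin_num => //; exact: integrableRZ.
  by rewrite -/(Rintegral _ _ _) RintegralZl// mulrC.
have := @integrable_indic_lty _ _ R lebesgue_measure _ mab ab_lty.
move/(integrableRZ (\int[m]_x D x)) => /integrableP[_].
apply: le_lt_trans; apply: ge0_le_integral => //.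
- move=> s _; rewrite lee_fin mulr_ge0// Rintegral_ge0//.
- by apply/measurable_EFinP; apply: measurable_funM => //.
- by apply: measurableT_comp => //; apply/measurable_EFinP; apply: measurable_funM.
- by move=> s _; rewrite /= lee_fin ler_norm.
Qed.

Let GE x : \int[lebesgue_measure]_(s in `[a, b]) F s x = \int[lebesgue_measure]_s G s x.
Proof.
by rewrite Rintegral_mkcond; apply: eq_Rintegral => s _; rewrite patch_indic /G mulrC.
Qed.

Lemma integrable_Rintegral_itv :
  m.-integrable [set: T] (EFin \o (fun x => \int[lebesgue_measure]_(s in `[a, b]) F s x)).
Proof.
have := integrable_fubini_F iG.
rewrite (_ : fubini_F _ _ = EFin \o (fun x => \int[lebesgue_measure]_(s in `[a, b]) F s x))//.
by apply/funext => x /=; rewrite GE fineK//; exact: integrable_fin_num (iGx x).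
Qed.

Lemma Rintegral_itvC : \int[m]_x (\int[lebesgue_measure]_(s in `[a, b]) F s x) =
  \int[lebesgue_measure]_(s in `[a, b]) (\int[m]_x F s x).
Proof.
rewrite [RHS]Rintegral_mkcond.
have := Fubini iG; rewrite /= => H.
have -> : \int[m]_x (\int[lebesgue_measure]_(s in `[a, b]) F s x) =
    fine (\int[m]_x \int[lebesgue_measure]_s (G s x)%:E).
  congr fine; apply: eq_integral => x _; rewrite GE fineK//.
  exact: integrable_fin_num (iGx x).
rewrite H; congr fine; apply: eq_integral => s _.
rewrite patch_indic -[LHS]fineK; last exact: integrable_fin_num (iGs s).
rewrite -/(Rintegral _ _ _) /G; congr EFin.
rewrite /= indicE; case: (s \in ab); rewrite ?mulr1 ?mulr0.
  by apply: eq_Rintegral => x _; rewrite mul1r.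
by rewrite /Rintegral; under eq_integral do rewrite mul0r; rewrite integral0.
Qed.

End Fubini_interval.

Section normL2.
Context d (T : measurableType d) (R : realType).
Variable mu : {measure set T -> \bar R}.
Local Open Scope complex_scope.

Definition sqmod (f : T -> R[i]) (x : T) : R :=
  complex.Re (f x) ^+ 2 + complex.Im (f x) ^+ 2.

Lemma normL2E (f : T -> R[i]) : mu.-integrable [set: T] (EFin \o sqmod f) ->
  normL2 mu f = (Num.sqrt (\int[mu]_x sqmod f x))%:E.
Proof.
move=> If; rewrite /normL2 unlock /=.
rewrite (eq_integral (EFin \o sqmod f)); last first.
  move=> x _; rewrite /sqmod /=; case: (f x) => u v /=.
  rewrite ger0_norm ?sqrtr_ge0// powR_mulrn ?sqrtr_ge0// sqr_sqrtr//.
  by rewrite addr_ge0 ?sqr_ge0.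
rewrite -[X in poweR X _]fineK; last exact: integrable_fin_num.
rewrite poweR_EFin powR12_sqrt//.
by apply: Rintegral_ge0 => x _; rewrite addr_ge0 ?sqr_ge0.
Qed.

End normL2.

Section kernel_vector.
Context {R : realType} {n : nat}.
Variables Q B : 'M[R]_n.
Hypothesis Qsym : Q^T = Q.
Hypothesis Qpsd : forall x : 'cV[R]_n, 0 <= dotv (Q *m x) x.
Hypothesis degenerate : \det Q = 0.
Hypothesis Qt_gt0 : forall x : 'cV[R]_n, x != 0 -> 0 < dotv (Qt Q B 1 *m x) x.

Lemma degenerate_bracket : exists eta : 'cV[R]_n,
  Q *m eta = 0 /\ Q *m (B^T *m eta) != 0.
Proof.
(* otherwise B^T preserves the kernel of Q, on which Qt then vanishes *)
apply: contrapT => H.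
have H' (eta : 'cV[R]_n) : Q *m eta = 0 -> Q *m (B^T *m eta) = 0.
  by move=> Qe; apply/eqP/negPn/negP => QA; apply: H; exists eta.
have [v v0 vQ] : exists2 v : 'cV[R]_n, v != 0 & Q *m v = 0.
  have /det0P[v v0 vQ] : \det Q == 0 by rewrite degenerate.
  exists v^T; first by rewrite trmx_eq0.
  by rewrite -Qsym -trmx_mul vQ trmx0.
have HA k : Q *m (B^T ^+ k *m v) = 0.
  by elim: k => [|k IH]; rewrite ?expr0 ?mul1mx// exprS -mulmxE -mulmxA H'.
(* The coordinates of [flow B v s] are exponential generating functions of the coordinates of the
   iterates of B^T on v, so applying Q yields the generating function of a zero sequence. *)
have Hf s : Q *m flow B v s = 0.
  apply/colP => i; rewrite !mxE.
  have E j : flow B v s j 0 = egf (fun k => (B^T ^+ k *m v) j 0) s.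
    rewrite /flow mxE.
    under eq_bigr => l _ do rewrite mulrC expmxE.
    rewrite -egf_sum; last by move=> l; exact: geometric_bound_expr.
    by congr egf; apply/funext => k; rewrite mxE; apply: eq_bigr => l _; rewrite mulrC.
  have gb j : geometric_bound (fun k => (B^T ^+ k *m v) j 0).
    have [f Hf'] := choice (fun l => geometric_bound_expr (B^T) j l).
    have {Hf'}[g Hg] := choice Hf'.
    exists (\sum_l f l * `|v l 0|), (\sum_l g l).
    split.
    - by apply: sumr_ge0 => l _; rewrite mulr_ge0//; have [] := Hg l.
    - by apply: sumr_ge0 => l _; have [] := Hg l.
    - move=> k; rewrite mxE (le_trans (ler_norm_sum _ _ _))// mulr_suml.
      apply: ler_sum => l _; rewrite normrM mulrAC ler_wpM2r//.
      have [f0 g0 fg] := Hg l; apply: (le_trans (fg k)); rewrite ler_wpM2l//.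
      rewrite lerXn2r ?nnegrE//; first by apply: sumr_ge0 => l' _; have [] := Hg l'.
      by rewrite (bigD1 l)//= lerDl; apply: sumr_ge0 => l' _; have [] := Hg l'.
  under eq_bigr => j _ do rewrite E.
  rewrite -egf_sum// (_ : (fun k => _) = cst 0); last first.
    by apply/funext => k; have /colP/(_ i) := HA k; rewrite !mxE.
  by rewrite /egf (_ : pseries _ _ = cst 0) ?lim_cst//; apply/funext => N;
    rewrite /pseries /series/= big1// => k _; rewrite !mul0r.
have := Qt_gt0 v0; rewrite Qt_form//.
rewrite /Rintegral (eq_integral (cst 0%E)); last by move=> s _; rewrite Hf dotv0l.
by rewrite integral0 ltxx.
Qed.

End kernel_vector.

(** * Plane waves as weak solutions *)

Section c1_functions.
Context {R : realType} {n : nat}.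
Local Notation E := 'cV[R]_n.
Local Notation leb := (lebesgue_cV R n).

Lemma is_derive_line (F : E -> R) (x v : E) (a : R) :
  has_deriv (fun h => F (x + h *: v)) 0 a -> is_derive x v F a.
Proof.
pose G (h : R) := F (x + h *: v).
have Q : (fun t : R => t^-1 *: ((G \o shift 0) (t *: (1 : R^o)) - G 0)) =
    (fun t : R => t^-1 *: ((F \o shift x) (t *: v) - F x)).
  apply/funext => t; rewrite /G /= scaler1 addr0 scale0r addr0.
  by rewrite (addrC x).
move=> [d1 d2]; split; first by move: d1; rewrite /derivable -Q.
by rewrite -d2 /derive -Q.
Qed.

Definition c1_on (K : set E) (f : E -> R) : Prop :=
  [/\ forall x, ~ K x -> f x = 0, continuous f &
      forall i, (forall x, derivable f x (delta_mx i 0)) /\ continuous (partial i f)].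

Variable K : set E.
Hypothesis cK : compact K.

Lemma compact_support_integrable (f : E -> R) : continuous f ->
  (forall x, ~ K x -> f x = 0) -> leb.-integrable [set: E] (EFin \o f).
Proof.
move=> cf f0; have [D D0 HD] := compact_continuous_bounded cK cf.
have [r r0 Kr] := compact_sub_box cK.
apply: (@bounded_box_integrable _ _ _ r D) => //.
  exact: continuous_measurable_cV.
move=> x; have [Kx|nKx] := pselect (K x).
  rewrite indicE mem_set ?mulr1; [exact: HD|exact: Kr].
by rewrite f0// normr0 mulr_ge0.
Qed.

Lemma c1_on_partial_support f i x : c1_on K f -> ~ K x -> partial i f x = 0.
Proof. by move=> [f0 _ _]; exact: partial_eq0. Qed.

Lemma Rintegral_partialM (f : E -> R) (df : E -> R) (g : E -> R) i : c1_on K g ->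
  continuous f -> continuous df ->
  (forall x, is_derive x (delta_mx i 0) f (df x)) ->
  \int[leb]_x (f x * partial i g x) = - \int[leb]_x (df x * g x).
Proof.
move=> gK cf cdf Hf; have [g0 cg /(_ i)[dg cpg]] := gK.
have D x : is_derive x (delta_mx i 0) (fun y => f y * g y) (f x * partial i g x + df x * g x).
  have Hg : is_derive x (delta_mx i 0) g (partial i g x) by split.
  have [d1 d2] := is_deriveM (Hf x) Hg; split => //; rewrite d2.
  by rewrite /= -[X in _ + X]/(g x * df x) [g x * _]mulrC.
have PE : partial i (fun y => f y * g y) = fun x => f x * partial i g x + df x * g x.
  by apply/funext => x; have [_] := D x.
have c1 : continuous (fun x => f x * partial i g x).
  by move=> x; exact: (continuousM (cf x) (cpg x)).
have c2 : continuous (fun x => df x * g x).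
  by move=> x; exact: (continuousM (cdf x) (cg x)).
have := @Rintegral_partial_eq0 R n K (fun y => f y * g y) i cK.
rewrite PE RintegralD//; first last.
- by apply: compact_support_integrable => // x nKx; rewrite g0// mulr0.
- apply: compact_support_integrable => // x nKx.
  by rewrite (c1_on_partial_support _ gK)// mulr0.
move=> H; apply/eqP; rewrite -addr_eq0; apply/eqP; apply: H.
- by move=> x /g0 ->; rewrite mulr0.
- by move=> x; exact: (continuousM (cf x) (cg x)).
- by move=> x; have [] := D x.
- by move=> x; exact: (continuousD (c1 x) (c2 x)).
Qed.

Lemma c1_onM_coord (f : E -> R) j : c1_on K f -> c1_on K (fun x => x j 0 * f x).
Proof.
move=> [f0 cf df].
have cj : continuous (fun x : E => x j 0) by exact: cV_coord_continuous.
split.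
- by move=> x /f0 ->; rewrite mulr0.
- by move=> x; exact: (continuousM (cj x) (cf x)).
move=> i; have [di ci] := df i.
have dj x : is_derive x (delta_mx i 0) (fun y : E => y j 0) (j == i)%:R.
  apply: is_derive_line.
  rewrite (_ : (fun h => _) = fun h => x j 0 + h * (j == i)%:R); last first.
    by apply/funext => h; rewrite !mxE eqxx andbT.
  apply: has_deriv_eq; first by apply: has_derivD; [exact: has_deriv_cst|exact: has_deriv_mulr].
  by rewrite add0r.
have D x : is_derive x (delta_mx i 0) (fun y => y j 0 * f y)
    (x j 0 * partial i f x + (j == i)%:R * f x).
  have Hf : is_derive x (delta_mx i 0) f (partial i f x) by split.
  have [d1 d2] := is_deriveM (dj x) Hf; split => //; rewrite d2.
  by rewrite /= -[X in _ + X]/(f x * _) [f x * _]mulrC.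
split; first by move=> x; have [] := D x.
rewrite (_ : partial i _ = fun x => x j 0 * partial i f x + (j == i)%:R * f x); last first.
  by apply/funext => x; have [_] := D x.
move=> x; apply: (@continuousD _ _ _ (fun x : E => x j 0 * partial i f x) (fun x => (j == i)%:R * f x)).
  exact: (continuousM (cj x) (ci x)).
exact: (continuousM (@cst_continuous E R (j == i)%:R x) (cf x)).
Qed.

Lemma test_on_c1 (phi : E -> R) : test_on K phi -> c1_on K phi.
Proof.
move=> [sm phi0]; split => //.
  by move=> x; have [] := sm [::] x I.
move=> i; split => x; first by have [_] := sm [::] x I.
by have [] := sm [:: i] x I.
Qed.

Lemma test_on_c1_partial (phi : E -> R) i : test_on K phi -> c1_on K (partial i phi).
Proof.
move=> tphi; have [sm phi0] := tphi; split.
- by move=> x nKx; exact: c1_on_partial_support (test_on_c1 tphi) nKx.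
- by move=> x; have [] := sm [:: i] x I.
move=> j; split => x; first by have [_] := sm [:: i] x I.
by have [] := sm [:: j; i] x I.
Qed.

End c1_functions.

Section pairing.
Context {R : realType} {n : nat}.
Local Notation E := 'cV[R]_n.
Local Notation leb := (lebesgue_cV R n).
Variable K : set E.

Definition continuous_supported_in (f : E -> R) : Prop :=
  continuous f /\ (forall x, ~ K x -> f x = 0).
Local Notation cs := continuous_supported_in.

Lemma c1_on_cs f : c1_on K f -> cs f.
Proof. by case. Qed.

Lemma cs_partial f i : compact K -> c1_on K f -> cs (partial i f).
Proof.
move=> cK Hf; split; last by move=> x; exact: c1_on_partial_support.
by case: Hf => _ _ /(_ i)[].
Qed.

Lemma csD f g : cs f -> cs g -> cs (fun x => f x + g x).
Proof.
move=> [cf f0] [cg g0]; split; first by move=> x; exact: (continuousD (cf x) (cg x)).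
by move=> x nKx; rewrite f0// g0// addr0.
Qed.

Lemma csZ (c : R) f : cs f -> cs (fun x => c * f x).
Proof.
move=> [cf f0]; split; last by move=> x nKx; rewrite f0// mulr0.
by move=> x; exact: (continuousM (@cst_continuous _ _ c x) (cf x)).
Qed.

Lemma cs_sum (I : Type) (r : seq I) (F : I -> E -> R) : (forall i, cs (F i)) ->
  cs (fun x => \sum_(i <- r) F i x).
Proof.
move=> HF; elim: r => [|i r IH].
  rewrite (_ : (fun x => _) = fun=> 0); first by split => //; exact: cst_continuous.
  by apply/funext => x; rewrite big_nil.
rewrite (_ : (fun x => _) = fun x => F i x + \sum_(j <- r) F j x); first exact: csD.
by apply/funext => x; rewrite big_cons.
Qed.

(** Integrability against continuous functions supported in K is all that pairing with test
    functions requires; for a packet it follows from Fubini, without continuity in x. *)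
Definition locally_integrable (f : E -> R) : Prop :=
  forall g, cs g -> leb.-integrable [set: E] (EFin \o (fun x => f x * g x)).

Definition pairing (f g : E -> R) : R := \int[leb]_x (f x * g x).

Lemma continuous_locally_integrable (f : E -> R) : compact K -> continuous f ->
  locally_integrable f.
Proof.
move=> cK cf g [cg g0]; apply: (compact_support_integrable cK); last by move=> x /g0 ->; rewrite mulr0.
by move=> x; exact: (continuousM (cf x) (cg x)).
Qed.

Variable f : E -> R.
Hypothesis Hf : locally_integrable f.

Lemma pairingD g h : cs g -> cs h -> pairing f (fun x => g x + h x) = pairing f g + pairing f h.
Proof.
move=> Hg Hh; rewrite /pairing -RintegralD//; try exact: Hf.
by apply: eq_Rintegral => x _; rewrite mulrDr.
Qed.

Lemma pairingZ (c : R) g : cs g -> pairing f (fun x => c * g x) = c * pairing f g.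
Proof.
move=> Hg; rewrite /pairing -RintegralZl//; last exact: Hf.
by apply: eq_Rintegral => x _; rewrite mulrCA.
Qed.

Lemma pairing_sum (I : Type) (r : seq I) (F : I -> E -> R) : (forall i, cs (F i)) ->
  pairing f (fun x => \sum_(i <- r) F i x) = \sum_(i <- r) pairing f (F i).
Proof.
move=> HF; elim: r => [|i r IH].
  rewrite big_nil /pairing /Rintegral; under eq_integral => x _ do rewrite big_nil mulr0.
  by rewrite integral0.
rewrite big_cons -IH -pairingD//; last exact: cs_sum.
by apply: eq_Rintegral => x _; rewrite big_cons.
Qed.

End pairing.

Section formal_adjoint.
Context {R : realType} {n : nat}.
Local Notation E := 'cV[R]_n.
Variables Q B : 'M[R]_n.

(** The formal adjoint of P for Lebesgue measure rather than for [mu], because [distr_of] embeds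
    functions through [lebesgue_cV]. *)
Definition OUadj (phi : E -> R) (x : E) : R :=
  2^-1 * (\sum_i \sum_j Q i j * partial j (partial i phi) x) -
  \sum_i \sum_j B i j * partial i (fun y => y j 0 * phi y) x.

Variables (K : set E) (phi : E -> R).
Hypothesis cK : compact K.
Hypothesis tphi : test_on K phi.

Let OUadjE : OUadj phi = fun x =>
  2^-1 * (\sum_i \sum_j Q i j * partial j (partial i phi) x) +
  -1 * \sum_i \sum_j B i j * partial i (fun y => y j 0 * phi y) x.
Proof. by apply/funext => x; rewrite /OUadj mulN1r. Qed.

Let cs2 i j : continuous_supported_in K (fun x => Q i j * partial j (partial i phi) x).
Proof. by apply: csZ; apply: cs_partial => //; exact: test_on_c1_partial. Qed.

Let cs1 i j : continuous_supported_in K (fun x => B i j * partial i (fun y => y j 0 * phi y) x).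
Proof. by apply: csZ; apply: cs_partial => //; apply: c1_onM_coord; exact: test_on_c1. Qed.

Lemma OUadj_cs : continuous_supported_in K (OUadj phi).
Proof.
by rewrite OUadjE; apply: csD; apply: csZ; apply: cs_sum => i; apply: cs_sum.
Qed.

Lemma pairing_OUadj f : locally_integrable K f -> pairing f (OUadj phi) =
  2^-1 * (\sum_i \sum_j Q i j * pairing f (partial j (partial i phi))) -
  \sum_i \sum_j B i j * pairing f (partial i (fun y => y j 0 * phi y)).
Proof.
move=> Hf; have cs2' i := cs_sum (index_enum 'I_n) (cs2 i).
have cs1' i := cs_sum (index_enum 'I_n) (cs1 i).
have cs2s := cs_sum (index_enum 'I_n) cs2'; have cs1s := cs_sum (index_enum 'I_n) cs1'.
rewrite OUadjE (pairingD Hf (csZ _ cs2s) (csZ _ cs1s)).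
rewrite (pairingZ Hf _ cs2s) (pairingZ Hf _ cs1s) mulN1r.
rewrite (pairing_sum Hf _ cs2') (pairing_sum Hf _ cs1').
congr (_ * _ - _); apply: eq_bigr => i _.
  rewrite (pairing_sum Hf _ (cs2 i)); apply: eq_bigr => j _.
  by apply: (pairingZ Hf); apply: cs_partial => //; exact: test_on_c1_partial.
rewrite (pairing_sum Hf _ (cs1 i)); apply: eq_bigr => j _.
by apply: (pairingZ Hf); apply: cs_partial => //; apply: c1_onM_coord; exact: test_on_c1.
Qed.

End formal_adjoint.

(** * The exponential solutions g and their weak equation *)

Section beam.
Context {R : realType} {n : nat}.
Variables (Q B C : 'M[R]_n).
Hypothesis Qsym : Q^T = Q.
Hypothesis Csym : C^T = C.
Hypothesis lyapunov : forall x, dotv (C *m x) (B^T *m x) = - (2^-1 * dotv (Q *m x) x).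
Local Notation A := B^T.
Local Notation flow := (flow B).
Local Notation ip := (ip C).
Local Notation E := 'cV[R]_n.
Local Notation leb := (lebesgue_cV R n).

Variables (al be : E) (sr si k0 : R).
Local Notation als := (flow al).
Local Notation bes := (flow be).

(* With zeta = als s + i bes s, which solves zeta' = B^T zeta, lnamp + i arg is
   k0 + (sr + i si) s + <zeta, x> - <C zeta, zeta> / 2.  By the Lyapunov equation,
   its exponential g satisfies P g = dg/ds - (sr + i si) g.  The real and imaginary
   parts of g are beam 0 and beam (- (pi / 2)); adding pi / 2 to th multiplies g by i. *)
Definition lnamp0 s : R := k0 + sr * s - 2^-1 * (ip (als s) (als s) - ip (bes s) (bes s)).
Definition lnamp s x : R := lnamp0 s + dotv (als s) x.
Definition arg s x : R := si * s - ip (als s) (bes s) + dotv (bes s) x.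
Definition beam th s x : R := expR (lnamp s x) * cos (arg s x + th).

Definition dlnamp s x : R := sr + 2^-1 * (dotv (Q *m als s) (als s) - dotv (Q *m bes s) (bes s)) +
  dotv (flow (A *m al) s) x.
Definition darg s x : R := si + dotv (Q *m als s) (bes s) + dotv (flow (A *m be) s) x.

Lemma has_deriv_dotv_flowl w x s : has_deriv (fun s => dotv (flow w s) x) s (dotv (flow (A *m w) s) x).
Proof.
rewrite (_ : (fun s => _) = fun s => dotv x (flow w s)); last by apply/funext => t; rewrite dotvC.
by apply: has_deriv_eq; [exact: has_deriv_dotv_flow|rewrite dotvC mulmx_flow].
Qed.

Lemma has_deriv_lnamp s x : has_deriv (fun s => lnamp s x) s (dlnamp s x).
Proof.
apply: has_deriv_eq.
  apply: has_derivD; last exact: has_deriv_dotv_flowl.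
  apply: has_derivB.
    by apply: has_derivD; [exact: has_deriv_cst|exact: has_deriv_mull].
  by apply: has_derivZ; apply: has_derivB; exact: (has_deriv_ip_flow2 Qsym Csym lyapunov).
by rewrite /dlnamp; ring.
Qed.

Lemma has_deriv_arg s x : has_deriv (fun s => arg s x) s (darg s x).
Proof.
apply: has_deriv_eq.
  apply: has_derivD; last exact: has_deriv_dotv_flowl.
  apply: has_derivB; [exact: has_deriv_mull|exact: has_deriv_form_flow].
by rewrite /darg (ip_lyapunov Qsym Csym lyapunov) opprK.
Qed.

Lemma cos_quarter (y : R) : cos (y + pi / 2) = - sin y.
Proof. by rewrite cosD cos_pihalf sin_pihalf mulr0 mulr1 sub0r. Qed.

Lemma beam_quarter2 th s x : beam (th + pi / 2 + pi / 2) s x = - beam th s x.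
Proof.
rewrite /beam -mulrN; congr (_ * _).
rewrite !addrA cos_quarter sinD cos_pihalf sin_pihalf mulr0 mulr1 add0r //.
Qed.

Lemma has_deriv_beam th s x : has_deriv (fun s => beam th s x) s
  (dlnamp s x * beam th s x + darg s x * beam (th + pi / 2) s x).
Proof.
apply: has_deriv_eq.
  apply: has_derivM; first by apply: has_deriv_exp; exact: has_deriv_lnamp.
  by apply: has_deriv_cos; apply: has_derivD; [exact: has_deriv_arg|exact: has_deriv_cst].
by rewrite /beam addrA cos_quarter; ring.
Qed.

(** The real form of dg/dx_i = zeta_i g, a quarter turn of the phase being multiplication by i. *)
Lemma is_derive_beam th s x i : is_derive x (delta_mx i 0) (beam th s)
  (als s i 0 * beam th s x + bes s i 0 * beam (th + pi / 2) s x).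
Proof.
apply: is_derive_line.
rewrite (_ : (fun h => _) = fun h => expR (lnamp s x + h * als s i 0) *
    cos (arg s x + h * bes s i 0 + th)); last first.
  by apply/funext => h; rewrite /beam /lnamp /arg !dotvDr !dotvZr !dotv_delta !addrA.
apply: has_deriv_eq.
  apply: has_derivM.
    by apply: has_deriv_exp; apply: has_derivD; [exact: has_deriv_cst|exact: has_deriv_mulr].
  apply: has_deriv_cos; apply: has_derivD; last exact: has_deriv_cst.
  by apply: has_derivD; [exact: has_deriv_cst|exact: has_deriv_mulr].
rewrite /= !mul0r !addr0 !add0r /beam addrA cos_quarter; ring.
Qed.

Lemma continuous_beam th s : continuous (beam th s).
Proof.
have c1 : continuous (fun x => expR (lnamp s x)).
  move=> x; apply: continuous_comp; last exact: continuous_expR.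
  by apply: (@continuousD _ _ _ (fun=> lnamp0 s)); [exact: cst_continuous|exact: dotv_continuous].
have c2 : continuous (fun x => cos (arg s x + th)).
  move=> x; apply: (@continuous_comp _ _ _ (fun x => arg s x + th)); last exact: continuous_cos.
  apply: (@continuousD _ _ _ (arg s) (fun=> th)); last exact: cst_continuous.
  by apply: (@continuousD _ _ _ (fun=> si * s - ip (als s) (bes s)));
    [exact: cst_continuous|exact: dotv_continuous].
by move=> x; exact: (continuousM (c1 x) (c2 x)).
Qed.

Section weak_identity.
Variables (K : set E) (phi : E -> R).
Hypothesis cK : compact K.
Hypothesis tphi : test_on K phi.

Local Notation cs := (continuous_supported_in K).
Local Notation L th s := (pairing (beam th s)).

Let Lli th s : locally_integrable K (beam th s).
Proof. by apply: continuous_locally_integrable => //; exact: continuous_beam. Qed.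

Let L_partial th s f i : c1_on K f ->
  L th s (partial i f) = - (als s i 0 * L th s f + bes s i 0 * L (th + pi / 2) s f).
Proof.
move=> Hf; rewrite /pairing.
pose df x := als s i 0 * beam th s x + bes s i 0 * beam (th + pi / 2) s x.
have cdf : continuous df.
  move=> x; apply: (@continuousD _ _ _ (fun x => als s i 0 * beam th s x)).
    exact: (continuousM (@cst_continuous _ _ (als s i 0) x) (@continuous_beam th s x)).
  exact: (continuousM (@cst_continuous _ _ (bes s i 0) x) (@continuous_beam (th + pi / 2) s x)).
have -> := Rintegral_partialM cK Hf (@continuous_beam th s) cdf
  (fun x => is_derive_beam th s x i).
congr (- _); rewrite -!RintegralZl//; try by apply: Lli; exact: c1_on_cs.
rewrite -RintegralD//; first by apply: eq_Rintegral => x _; rewrite /df; ring.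
- by apply: integrableRZ; apply: Lli; exact: c1_on_cs.
- by apply: integrableRZ; apply: Lli; exact: c1_on_cs.
Qed.

Let L_quarter2 th s f : cs f -> L (th + pi / 2 + pi / 2) s f = - L th s f.
Proof.
move=> Hf; rewrite /pairing -mulN1r -RintegralZl//; last exact: Lli.
by apply: eq_Rintegral => x _; rewrite beam_quarter2 mulNr mulN1r.
Qed.

Let c1phi : c1_on K phi. Proof. exact: test_on_c1. Qed.
Let c1pphi i : c1_on K (partial i phi). Proof. exact: test_on_c1_partial. Qed.
Let c1xphi j : c1_on K (fun x => x j 0 * phi x). Proof. exact: c1_onM_coord. Qed.

Let csphi : cs phi. Proof. exact: c1_on_cs. Qed.

Let L_dotv th s (w : E) : L th s (fun x => dotv w x * phi x) =
  \sum_j w j 0 * L th s (fun x => x j 0 * phi x).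
Proof.
transitivity (\sum_j L th s (fun x => w j 0 * (x j 0 * phi x))); last first.
  by apply: eq_bigr => j _; apply: (pairingZ (@Lli th s)); exact: c1_on_cs.
rewrite -(pairing_sum (@Lli th s)); last by move=> j; apply: csZ; exact: c1_on_cs.
apply: eq_Rintegral => x _; congr (_ * _).
by rewrite /dotv mulr_suml; apply: eq_bigr => j _; rewrite mulrA.
Qed.

(** Integrating by parts, P g = (<Q zeta, zeta> / 2 + <B^T zeta, x>) g. This is the logarithmic time
    derivative of g minus sr + i si, which is how the Lyapunov equation entered [dlnamp] and
    [darg]. *)
Lemma beam_weak_identity th s : \int[leb]_x (beam th s x * OUadj Q B phi x) =
  \int[leb]_x ((dlnamp s x * beam th s x + darg s x * beam (th + pi / 2) s x
    - sr * beam th s x - si * beam (th + pi / 2) s x) * phi x).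
Proof.
set th' := th + pi / 2.
have csw w : cs (fun x => dotv w x * phi x).
  split; last by move=> x nKx; rewrite (proj2 csphi)// mulr0.
  by move=> x; exact: (continuousM (@dotv_continuous _ _ w x) (proj1 csphi x)).
pose ca := 2^-1 * (dotv (Q *m als s) (als s) - dotv (Q *m bes s) (bes s)).
pose cb := dotv (Q *m als s) (bes s).
have -> : \int[leb]_x ((dlnamp s x * beam th s x + darg s x * beam th' s x
    - sr * beam th s x - si * beam th' s x) * phi x) =
    L th s (fun x => ca * phi x + dotv (A *m als s) x * phi x) +
    L th' s (fun x => cb * phi x + dotv (A *m bes s) x * phi x).
  rewrite -RintegralD//; first last.
  - by apply: Lli; apply: csD => //; exact: csZ.
  - by apply: Lli; apply: csD => //; exact: csZ.
  apply: eq_Rintegral => x _; rewrite /dlnamp /darg -/ca -/cb !mulmx_flow; ring.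
have H0 := csZ ca csphi; have H1 := csZ cb csphi.
rewrite (pairingD (@Lli th s) H0 (csw _)) (pairingD (@Lli th' s) H1 (csw _)).
rewrite (pairingZ (@Lli th s) ca csphi) (pairingZ (@Lli th' s) cb csphi) !L_dotv.
have -> : \int[leb]_x (beam th s x * OUadj Q B phi x) = L th s (OUadj Q B phi) by [].
rewrite (pairing_OUadj Q B cK tphi (@Lli th s)).
(* Two integrations by parts give zeta_i zeta_j; its real part keeps the phase and its imaginary
   part turns it by a quarter. *)
have E1 i j : Q i j * L th s (partial j (partial i phi)) =
    (als s j 0 * als s i 0 - bes s j 0 * bes s i 0) * Q i j * L th s phi +
    (als s j 0 * bes s i 0 + bes s j 0 * als s i 0) * Q i j * L th' s phi.
  by rewrite !L_partial// L_quarter2// -/th'; ring.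
have E2 i j : B i j * L th s (partial i (fun y => y j 0 * phi y)) =
    - (B i j * als s i 0 * L th s (fun x => x j 0 * phi x) +
       B i j * bes s i 0 * L th' s (fun x => x j 0 * phi x)).
  by rewrite !L_partial// -/th'; ring.
have F1 (u v : E) : \sum_i \sum_j u j 0 * v i 0 * Q i j = dotv (Q *m u) v.
  rewrite /dotv; apply: eq_bigr => i _; rewrite mxE mulr_suml.
  by apply: eq_bigr => j _; ring.
have F2 (u : E) (f : 'I_n -> R) : \sum_i \sum_j B i j * u i 0 * f j = \sum_j (A *m u) j 0 * f j.
  rewrite exchange_big /=; apply: eq_bigr => j _; rewrite mxE mulr_suml.
  by apply: eq_bigr => i _; rewrite mxE.
have S1 : \sum_i \sum_j Q i j * L th s (partial j (partial i phi)) =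
    2 * ca * L th s phi + 2 * cb * L th' s phi.
  transitivity (\sum_i \sum_j ((als s j 0 * als s i 0 * Q i j - bes s j 0 * bes s i 0 * Q i j) * L th s phi +
    (als s j 0 * bes s i 0 * Q i j + bes s j 0 * als s i 0 * Q i j) * L th' s phi)).
    apply: eq_bigr => i _; apply: eq_bigr => j _; rewrite E1; ring.
  under eq_bigr => i _ do rewrite big_split /= -!mulr_suml sumrB big_split /=.
  rewrite big_split /= -!mulr_suml sumrB big_split /= !F1.
  rewrite (dotv_sym Qsym (bes s) (als s)) /ca /cb; congr (_ * _ + _ * _); by field.
have S2 : \sum_i \sum_j B i j * L th s (partial i (fun y => y j 0 * phi y)) =
    - (\sum_j (A *m als s) j 0 * L th s (fun x => x j 0 * phi x) +
       \sum_j (A *m bes s) j 0 * L th' s (fun x => x j 0 * phi x)).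
  rewrite -!F2 -big_split -sumrN /=; apply: eq_bigr => i _.
  rewrite -big_split -sumrN /=; apply: eq_bigr => j _; exact: E2.
transitivity (2^-1 * (2 * ca * L th s phi + 2 * cb * L th' s phi) +
   - - (\sum_j (A *m als s) j 0 * L th s (fun x => x j 0 * phi x) +
       \sum_j (A *m bes s) j 0 * L th' s (fun x => x j 0 * phi x))).
  by congr (2^-1 * _ - _).
by field.
Qed.

End weak_identity.
End beam.

(** * Time integrals of g as weak solutions *)

Section beam_superposition.
Context {R : realType} {n : nat}.
Variables (Q B C : 'M[R]_n).
Hypothesis Qsym : Q^T = Q.
Hypothesis Csym : C^T = C.
Hypothesis lyapunov : forall x, dotv (C *m x) (B^T *m x) = - (2^-1 * dotv (Q *m x) x).
Local Notation A := B^T.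
Local Notation flow := (flow B).
Local Notation ip := (ip C).
Local Notation E := 'cV[R]_n.
Local Notation leb := (lebesgue_cV R n).

Variables (al be : E) (sr si k0 d : R).
Local Notation als := (flow al).
Local Notation bes := (flow be).
Local Notation beam := (beam B C al be sr si k0).
Local Notation lnamp0 := (lnamp0 B C al be sr k0).
Local Notation lnamp := (lnamp B C al be sr k0).
Local Notation arg := (arg B C al be si).
Local Notation dlnamp := (dlnamp Q B al be sr).
Local Notation darg := (darg Q B al be si).

Lemma continuous_itv_bounded (f : R -> R) (a b : R) : continuous f ->
  exists2 M, 0 <= M & forall s, a <= s <= b -> `|f s| <= M.
Proof.
move=> cf.
have cK : compact (f @` [set` `[a, b]%R]).
  by apply: continuous_compact; [exact: continuous_subspaceT|exact: segment_compact].
have [M [_ HM]] := compact_bounded cK.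
exists (`|M| + 1); first by rewrite addr_ge0.
move=> s sab; apply: (HM (`|M| + 1)); last by exists s.
by rewrite (le_lt_trans (ler_norm M))// ltrDl.
Qed.

Let flow_bounded w : exists2 M, 0 <= M & forall s i, - d <= s <= d -> `|flow w s i 0| <= M.
Proof.
have H i : exists M, 0 <= M /\ forall s, - d <= s <= d -> `|flow w s i 0| <= M.
  have [|M M0 HM] := @continuous_itv_bounded (fun s => flow w s i 0) (- d) d.
    by move=> s; exact: has_deriv_continuous (has_deriv_flow_coord B w i s).
  by exists M.
have [M HM] := choice H.
exists (\sum_i M i); first by apply: sumr_ge0 => i _; case: (HM i).
move=> s i sd; rewrite (le_trans ((HM i).2 s sd))// (bigD1 i)//= lerDl.
by apply: sumr_ge0 => j _; case: (HM j).
Qed.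

Let form_continuous (M : 'M[R]_n) (x y : E) : continuous (fun s => dotv (M *m flow x s) (flow y s)).
Proof. by move=> s; exact: has_deriv_continuous (has_deriv_form_flow B M x y s). Qed.

Let lnamp0_continuous : continuous lnamp0.
Proof.
move=> s; have H := has_deriv_continuous (has_deriv_lnamp Qsym Csym lyapunov al be sr k0 s 0).
rewrite (_ : lnamp0 = fun s => lnamp s 0)//.
by apply/funext => t; rewrite /lnamp dotv0r addr0.
Qed.

(** On a bounded time interval the frequencies stay bounded, so one function of x dominates all the
    beams; it justifies every exchange of integrals below. *)
Lemma beam_le : exists M c, 0 <= M /\ forall th s x, - d <= s <= d ->
  `|beam th s x| <= M * exp_dom c x.
Proof.
have [M M0 HM] := continuous_itv_bounded (- d) d lnamp0_continuous.
have [c c0 Hc] := flow_bounded al.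
exists (expR M), c; split; first exact: expR_ge0.
move=> th s x sd; rewrite /beam normrM (ger0_norm (expR_ge0 _)).
apply: (@le_trans _ _ (expR (lnamp s x))).
  by rewrite ler_piMr ?expR_ge0 ?normr_cos_le1.
rewrite /lnamp expRD; apply: ler_pM; rewrite ?expR_ge0//.
  by rewrite ler_expR (le_trans (ler_norm _))// HM.
by apply: exp_dotv_le_dom => i; exact: Hc.
Qed.

(** The factors [dlnamp] and [darg] brought by time differentiation grow linearly in x. *)
Let affine (M : R) (x : E) := M * (1 + \sum_i `|x i 0|).

Let dotv_flow_le w : exists2 M, 0 <= M & forall s x, - d <= s <= d ->
  `|dotv (flow w s) x| <= affine M x.
Proof.
have [c c0 Hc] := flow_bounded w; exists c => // s x sd.
rewrite /affine mulrDr mulr1 mulr_sumr (le_trans (ler_norm_sum _ _ _))//.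
by rewrite ler_wpDl//; apply: ler_sum => i _; rewrite normrM ler_wpM2r// Hc.
Qed.

Let affine_ge0 M x : 0 <= M -> 0 <= affine M x.
Proof. by move=> M0; rewrite mulr_ge0// addr_ge0// sumr_ge0. Qed.

Let affineD M N x : affine M x + affine N x = affine (M + N) x.
Proof. by rewrite /affine mulrDl. Qed.

Let affine_add_le (f : R -> R) w : continuous f -> exists2 M, 0 <= M &
  forall s x, - d <= s <= d -> `|f s + dotv (flow w s) x| <= affine M x.
Proof.
move=> cf; have [M M0 HM] := continuous_itv_bounded (- d) d cf.
have [N N0 HN] := dotv_flow_le w.
exists (M + N); first exact: addr_ge0.
move=> s x sd; rewrite -affineD (le_trans (ler_normD _ _))// lerD ?HN//.
by rewrite (le_trans (HM s sd))// /affine ler_peMr// lerDl sumr_ge0.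
Qed.

Let dlnamp_le : exists2 M, 0 <= M & forall s x, - d <= s <= d -> `|dlnamp s x| <= affine M x.
Proof.
apply: affine_add_le.
have c1 : continuous (fun s => dotv (Q *m als s) (als s) - dotv (Q *m bes s) (bes s)).
  by move=> s; exact: (continuousB (@form_continuous Q al al s) (@form_continuous Q be be s)).
have c2 : continuous (fun s => 2^-1 * (dotv (Q *m als s) (als s) - dotv (Q *m bes s) (bes s))).
  by move=> s; exact: (continuousM (@cst_continuous R R (2^-1) s) (c1 s)).
by move=> s; exact: (continuousD (@cst_continuous R R sr s) (c2 s)).
Qed.

Let darg_le : exists2 M, 0 <= M & forall s x, - d <= s <= d -> `|darg s x| <= affine M x.
Proof.
apply: affine_add_le => s.
exact: (continuousD (@cst_continuous R R si s) (@form_continuous Q al be s)).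
Qed.

Let measurable_fst_cont (f : R -> R) : continuous f ->
  measurable_fun [set: measurableTypeR R * E] (fun p => f p.1).
Proof.
move=> cf; apply: measurableT_comp; last exact: measurable_fst.
exact: continuous_measurable_fun.
Qed.

Let measurable_snd_cont (f : E -> R) : continuous f ->
  measurable_fun [set: measurableTypeR R * E] (fun p => f p.2).
Proof.
move=> cf; apply: measurableT_comp; last exact: measurable_snd.
exact: continuous_measurable_cV.
Qed.

Let measurable_dotv_flow w : measurable_fun [set: measurableTypeR R * E] (fun p => dotv (flow w p.1) p.2).
Proof.
apply: measurable_sum => i; apply: measurable_funM.
  apply: (@measurable_fst_cont (fun s => flow w s i 0)) => s.
  exact: has_deriv_continuous (has_deriv_flow_coord B w i s).
by apply: (@measurable_snd_cont (fun x => x i 0)); exact: cV_coord_continuous.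
Qed.

Let measurable_lnamp : measurable_fun [set: measurableTypeR R * E] (fun p => lnamp p.1 p.2).
Proof. by apply: measurable_funD; [exact: measurable_fst_cont|exact: measurable_dotv_flow]. Qed.

Let measurable_arg : measurable_fun [set: measurableTypeR R * E] (fun p => arg p.1 p.2).
Proof.
apply: measurable_funD; last exact: measurable_dotv_flow.
apply: (@measurable_fst_cont (fun s => si * s - ip (als s) (bes s))) => s.
have c1 : {for s, continuous (fun s : R => si * s)}.
  exact: has_deriv_continuous (has_deriv_mull s si).
exact: (continuousB c1 (@form_continuous C al be s)).
Qed.

Lemma measurable_beam th : measurable_fun [set: measurableTypeR R * E] (fun p => beam th p.1 p.2).
Proof.
apply: measurable_funM; first by apply: measurableT_comp measurable_lnamp.
apply: measurableT_comp; first exact: measurable_cos.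
exact: measurable_funD measurable_arg _.
Qed.

Let measurable_dlnamp : measurable_fun [set: measurableTypeR R * E] (fun p => dlnamp p.1 p.2).
Proof.
apply: measurable_funD; last exact: measurable_dotv_flow.
apply: measurable_funD => //.
apply: measurable_funM => //.
by apply: measurable_funB; apply: (@measurable_fst_cont (fun s => dotv (Q *m flow _ s) (flow _ s)));
  exact: form_continuous.
Qed.

Let measurable_darg : measurable_fun [set: measurableTypeR R * E] (fun p => darg p.1 p.2).
Proof.
apply: measurable_funD; last exact: measurable_dotv_flow.
apply: measurable_funD => //.
by apply: (@measurable_fst_cont (fun s => dotv (Q *m flow _ s) (flow _ s))); exact: form_continuous.
Qed.

Definition packet th (x : E) : R := \int[lebesgue_measure]_(s in `[- d, d]) beam th s x.

(** The real part, after a turn by th, of P u = g(d) - g(-d) - (sr + i si) u. *)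
Definition packet_image th (x : E) : R :=
  beam th d x - beam th (- d) x - sr * packet th x - si * packet (th + pi / 2) x.

Let continuous_beam_time th x : continuous (fun s => beam th s x).
Proof.
by move=> s; exact: has_deriv_continuous (has_deriv_beam Qsym Csym lyapunov al be sr si k0 th s x).
Qed.

Let dbeam th s x : R := dlnamp s x * beam th s x + darg s x * beam (th + pi / 2) s x.

Let continuous_dbeam th x : continuous (fun s => dbeam th s x).
Proof.
have cd w (f : R -> R) : continuous f -> continuous (fun s => f s + dotv (flow w s) x).
  move=> cf s; have H := has_deriv_continuous (has_deriv_dotv_flowl B w x s).
  exact: (continuousD (cf s) H).
have c1 : continuous (fun s => dotv (Q *m als s) (als s) - dotv (Q *m bes s) (bes s)).
  by move=> s; exact: (continuousB (@form_continuous Q al al s) (@form_continuous Q be be s)).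
have c2 : continuous (fun s => 2^-1 * (dotv (Q *m als s) (als s) - dotv (Q *m bes s) (bes s))).
  by move=> s; exact: (continuousM (@cst_continuous R R (2^-1) s) (c1 s)).
have c3 : continuous (fun s => dlnamp s x).
  by apply: cd => s; exact: (continuousD (@cst_continuous R R sr s) (c2 s)).
have c4 : continuous (fun s => darg s x).
  by apply: cd => s; exact: (continuousD (@cst_continuous R R si s) (@form_continuous Q al be s)).
have c5 : continuous (fun s => dlnamp s x * beam th s x).
  by move=> s; exact: (continuousM (c3 s) (@continuous_beam_time th x s)).
have c6 : continuous (fun s => darg s x * beam (th + pi / 2) s x).
  by move=> s; exact: (continuousM (c4 s) (@continuous_beam_time (th + pi / 2) x s)).
by move=> s; exact: (continuousD (c5 s) (c6 s)).
Qed.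

Let exp_dom_ge0 c (x : E) : 0 <= exp_dom c x.
Proof. exact: exp_dom_ge0. Qed.

Let continuous_sum_cV (F : 'I_n -> E -> R) : (forall i, continuous (F i)) ->
  continuous (fun x => \sum_i F i x).
Proof.
move=> HF x; rewrite /continuous_at.
by apply: (@cvg_sumR R 'I_n E (nbhs (x : E)) (nbhs_filter (x : E))) => i; exact: HF.
Qed.

Let continuous_exp_dom c : continuous (exp_dom c : E -> R).
Proof.
have ce a : continuous (fun x : E => expR (dotv a x)).
  by move=> x; apply: continuous_comp; [exact: dotv_continuous|exact: continuous_expR].
have cS : continuous (fun x : E => \sum_i (expR (dotv ((c * n%:R) *: delta_mx i 0) x) +
               expR (dotv (- ((c * n%:R) *: delta_mx i 0)) x))).
  apply: continuous_sum_cV => i x.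
  exact: (continuousD (ce ((c * n%:R) *: delta_mx i 0) x) (ce (- ((c * n%:R) *: delta_mx i 0)) x)).
by move=> x; exact: (continuousD (@cst_continuous E R 1 x) (cS x)).
Qed.

Let continuous_affine M : continuous (affine M).
Proof.
have cS : continuous (fun x : E => \sum_i `|x i 0|).
  apply: continuous_sum_cV => i x.
  apply: (@continuous_comp _ _ _ (fun x : E => x i 0) Num.norm).
    exact: cV_coord_continuous.
  exact: norm_continuous.
have c1 : continuous (fun x : E => 1 + \sum_i `|x i 0|).
  by move=> x; exact: (continuousD (@cst_continuous E R 1 x) (cS x)).
by move=> x; exact: (continuousM (@cst_continuous E R M x) (c1 x)).
Qed.

Let continuous_normr (f : E -> R) : continuous f -> continuous (fun x => `|f x|).
Proof.
move=> cf x; apply: (@continuous_comp _ _ _ f Num.norm); [exact: cf|exact: norm_continuous].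
Qed.

Let leb_int_dom (K : set E) (g h : E -> R) : compact K -> continuous g -> continuous h ->
  (forall x, ~ K x -> h x = 0) -> leb.-integrable [set: E] (EFin \o (fun x => g x * `|h x|)).
Proof.
move=> cK cg ch h0; apply: (compact_support_integrable cK).
  have cn := continuous_normr ch.
  by move=> x; exact: (continuousM (cg x) (cn x)).
by move=> x /h0 ->; rewrite normr0 mulr0.
Qed.

Section weak.
Variables (K : set E) (phi : E -> R).
Hypothesis cK : compact K.
Hypothesis tphi : test_on K phi.
Hypothesis d0 : 0 < d.

Let iitv (f : R -> R) : continuous f ->
  (@lebesgue_measure R).-integrable `[- d, d] (EFin \o f).
Proof. exact: continuous_integrable_itv. Qed.

(** Fubini brings the time integral outside, [beam_weak_identity] applies at each time, and Fubini
    brings it back; then the integral of dg/ds is evaluated by the fundamental theorem of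
    calculus. *)
Lemma packet_weak_identity th :
  \int[leb]_x (packet th x * OUadj Q B phi x) =
  \int[leb]_x (packet_image th x * phi x).
Proof.
have [cO O0] := OUadj_cs Q B cK tphi.
have [phi0 cphi _] := test_on_c1 tphi.
have [M [c [M0 Hb]]] := beam_le.
have [Ma Ma0 Ha] := dlnamp_le.
have [Mb Mb0 Hd] := darg_le.
have mO : measurable_fun [set: measurableTypeR R * E] (fun p => OUadj Q B phi p.2).
  exact: measurable_snd_cont.
have mphi : measurable_fun [set: measurableTypeR R * E] (fun p => phi p.2).
  exact: measurable_snd_cont.
have cMe : continuous (fun x : E => M * exp_dom c x).
  by move=> x; exact: (continuousM (@cst_continuous E R M x) (@continuous_exp_dom c x)).
pose th' := th + pi / 2.
pose F s x := beam th s x * OUadj Q B phi x.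
pose W s x := dbeam th s x - sr * beam th s x - si * beam th' s x.
transitivity (\int[leb]_x \int[lebesgue_measure]_(s in `[- d, d]) F s x).
  apply: eq_Rintegral => x _; rewrite /packet -RintegralZr//.
  exact: iitv.
rewrite (@Rintegral_itvC _ _ _ leb F _ _ (fun x => M * exp_dom c x * `|OUadj Q B phi x|)); first last.
- exact: (leb_int_dom cK cMe cO O0).
- by move=> x; rewrite mulr_ge0// mulr_ge0.
- by move=> s x sd; rewrite normrM ler_wpM2r// Hb.
- by apply: measurable_funM => //; exact: measurable_beam.
transitivity (\int[lebesgue_measure]_(s in `[- d, d]) \int[leb]_x (W s x * phi x)).
  apply: eq_Rintegral => s _.
  exact: (beam_weak_identity B C Qsym al be sr si k0 cK tphi th s).
(* Dominates dg/ds - (sr + i si) g uniformly in time, as the second exchange needs. *)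
pose D x := (affine Ma x + affine Mb x + `|sr| + `|si|) * (M * exp_dom c x).
have WD s x : - d <= s <= d -> `|W s x| <= D x.
  move=> sd; have b1 := Hb th s x sd; have b2 := Hb th' s x sd.
  have b0 : 0 <= M * exp_dom c x by rewrite mulr_ge0.
  rewrite /D !mulrDl /W /dbeam.
  rewrite (le_trans (ler_normB _ _))// lerD//; last by rewrite normrM ler_wpM2l.
  rewrite (le_trans (ler_normB _ _))// lerD//; last by rewrite normrM ler_wpM2l.
  rewrite (le_trans (ler_normD _ _))// lerD// normrM; apply: ler_pM => //; [exact: Ha|exact: Hd].
have cD : continuous D.
  have c1 : continuous (fun x => affine Ma x + affine Mb x).
    by move=> x; exact: (continuousD (@continuous_affine Ma x) (@continuous_affine Mb x)).
  have c2 : continuous (fun x => affine Ma x + affine Mb x + `|sr|).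
    by move=> x; exact: (continuousD (c1 x) (@cst_continuous E R `|sr| x)).
  have c3 : continuous (fun x => affine Ma x + affine Mb x + `|sr| + `|si|).
    by move=> x; exact: (continuousD (c2 x) (@cst_continuous E R `|si| x)).
  by move=> x; exact: (continuousM (c3 x) (cMe x)).
rewrite -(@Rintegral_itvC _ _ _ leb (fun s x => W s x * phi x) _ _ (fun x => D x * `|phi x|)); first last.
- exact: (leb_int_dom cK cD cphi phi0).
- by move=> x; rewrite mulr_ge0// mulr_ge0// ?mulr_ge0// !addr_ge0// affine_ge0.
- by move=> s x sd; rewrite normrM ler_wpM2r// WD.
- apply: measurable_funM => //; apply: measurable_funB.
    apply: measurable_funB; last by apply: measurable_funM => //; exact: measurable_beam.
    apply: measurable_funD; apply: measurable_funM => //; exact: measurable_beam.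
  by apply: measurable_funM => //; exact: measurable_beam.
apply: eq_Rintegral => x _.
have c1 : continuous (fun s => sr * beam th s x).
  by move=> s; exact: (continuousM (@cst_continuous R R sr s) (@continuous_beam_time th x s)).
have c2 : continuous (fun s => si * beam th' s x).
  by move=> s; exact: (continuousM (@cst_continuous R R si s) (@continuous_beam_time th' x s)).
have c3 : continuous (fun s => dbeam th s x - sr * beam th s x).
  by move=> s; exact: (continuousB (@continuous_dbeam th x s) (c1 s)).
have cW : continuous (fun s => W s x) by move=> s; exact: (continuousB (c3 s) (c2 s)).
rewrite RintegralZr//; last exact: iitv.
congr (_ * _); rewrite /packet_image -/th'.
rewrite /W RintegralB//; [|exact: iitv|exact: iitv].
rewrite RintegralB//; [|by apply: iitv; exact: continuous_dbeam|exact: iitv].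
rewrite RintegralZl//; last exact: iitv.
rewrite RintegralZl//; last exact: iitv.
congr (_ - _ - _).
apply: (Rintegral_FTC (F := fun s => beam th s x)); first by rewrite (lt_trans _ d0)// oppr_lt0.
  by move=> s; exact: has_deriv_beam.
exact: continuous_dbeam.
Qed.

End weak.

(** The product with g is itself a time integral with a dominated integrand, so Fubini gives its
    integrability. *)
Lemma packet_locally_integrable (K : set E) th : compact K -> locally_integrable K (packet th).
Proof.
move=> cK g [cg g0]; have [M [c [M0 Hb]]] := beam_le.
have cMe : continuous (fun x : E => M * exp_dom c x).
  by move=> x; exact: (continuousM (@cst_continuous E R M x) (@continuous_exp_dom c x)).
apply: (eq_integrableR (f := fun x => \int[lebesgue_measure]_(s in `[- d, d]) (beam th s x * g x))).
  move=> x; rewrite /packet -RintegralZr//; exact: continuous_integrable_itv.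
apply: (integrable_Rintegral_itv (F := fun s x => beam th s x * g x)
  (D := fun x => M * exp_dom c x * `|g x|)).
- apply: measurable_funM; [exact: measurable_beam|exact: measurable_snd_cont].
- by move=> s x sd; rewrite normrM ler_wpM2r// Hb.
- by move=> x; rewrite mulr_ge0// mulr_ge0.
- exact: (leb_int_dom cK cMe cg g0).
Qed.

End beam_superposition.

(** * Quasimodes in L^2 *)

Section OU_on_functions.
Context {R : realType} {n : nat}.
Variables Q B : 'M[R]_n.
Local Open Scope complex_scope.

Lemma sumC (I : Type) (r : seq I) (a b : I -> R) :
  \sum_(i <- r) (a i +i* b i) = (\sum_(i <- r) a i) +i* (\sum_(i <- r) b i).
Proof.
by elim: r => [|i r IH]; rewrite ?big_nil// !big_cons IH.
Qed.

Lemma mulrC_complex (c a b : R) : c%:C * (a +i* b) = (c * a) +i* (c * b).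
Proof. by apply/eqP; rewrite eq_complex /= !mul0r subr0 addr0 !eqxx. Qed.

(** Unfolds the distributional P into the adjoint on the test function; since test functions are
    real, the real and imaginary parts separate. *)
Lemma OU_distr_of (K : set 'cV[R]_n) (phi : 'cV[R]_n -> R) (f : 'cV[R]_n -> R[i]) :
  compact K -> test_on K phi ->
  locally_integrable K (fun x => complex.Re (f x)) ->
  locally_integrable K (fun x => complex.Im (f x)) ->
  OU Q B (distr_of f) phi =
  pairing (fun x => complex.Re (f x)) (OUadj Q B phi) +i*
  pairing (fun x => complex.Im (f x)) (OUadj Q B phi).
Proof.
move=> cK tphi fr fi; rewrite (pairing_OUadj Q B cK tphi fr) (pairing_OUadj Q B cK tphi fi).
rewrite /OU /distr_partial /distr_mul.
have E psi : distr_of f psi = pairing (fun x => complex.Re (f x)) psi +i*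
    pairing (fun x => complex.Im (f x)) psi by [].
have N (a b : R) : - (a +i* b) = (- a) +i* (- b) by [].
under eq_bigr => i _ do (under eq_bigr => j _ do rewrite opprK E mulrC_complex; rewrite sumC).
rewrite sumC mulrC_complex.
under [X in _ + X]eq_bigr => i _ do
  (under eq_bigr => j _ do rewrite E N mulrC_complex !mulrN -N; rewrite sumrN sumC N).
rewrite sumC !sumrN; apply/eqP; rewrite eq_complex /=; apply/andP; split; apply/eqP => //.
Qed.

End OU_on_functions.

Section square_integrable.
Context d (T : measurableType d) (R : realType).
Variable mu : {measure set T -> \bar R}.

Definition sqint (f : T -> R) : Prop :=
  measurable_fun [set: T] f /\ mu.-integrable [set: T] (EFin \o (fun x => f x ^+ 2)).

Lemma sqintM_integrable f g : sqint f -> sqint g ->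
  mu.-integrable [set: T] (EFin \o (fun x => f x * g x)).
Proof.
move=> [mf If] [mg Ig]; apply: le_integrableR (integrableRD If Ig).
  exact: measurable_funM.
move=> x; rewrite normrM -(real_normK (num_real (f x))) -(real_normK (num_real (g x))).
have : 0 <= (`|f x| - `|g x|) ^+ 2 by exact: sqr_ge0.
have : 0 <= `|f x| * `|g x| by rewrite mulr_ge0.
rewrite !expr2; lra.
Qed.

Lemma sqintD f g : sqint f -> sqint g -> sqint (fun x => f x + g x).
Proof.
move=> Hf Hg; have [mf If] := Hf; have [mg Ig] := Hg; split; first exact: measurable_funD.
have := integrableRD (integrableRD If (integrableRZ 2 (sqintM_integrable Hf Hg))) Ig.
by apply: eq_integrableR => x; ring.
Qed.

Lemma sqintZ (c : R) f : sqint f -> sqint (fun x => c * f x).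
Proof.
move=> [mf If]; split; first exact: measurable_funM.
by have := integrableRZ (c ^+ 2) If; apply: eq_integrableR => x; rewrite exprMn.
Qed.

Lemma sqintB f g : sqint f -> sqint g -> sqint (fun x => f x - g x).
Proof.
move=> Hf Hg; have := sqintD Hf (sqintZ (-1) Hg).
by rewrite (_ : (fun x => f x + -1 * g x) = fun x => f x - g x)//; apply/funext => x; rewrite mulN1r.
Qed.

Lemma le_sqint (f g : T -> R) : measurable_fun [set: T] f -> (forall x, `|f x| <= g x) -> sqint g -> sqint f.
Proof.
move=> mf fg [mg Ig]; split => //; apply: le_integrableR Ig; first exact: measurable_funX.
move=> x; rewrite normrX lerXn2r// nnegrE// (le_trans _ (fg x))//.
Qed.

Lemma sqint_in_L2 (f g : T -> R) : sqint f -> sqint g -> in_L2 mu (fun x => f x +i* g x)%C.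
Proof.
move=> [mf If] [mg Ig]; split => //; rewrite normL2E ?ltry//.
exact: integrableRD If Ig.
Qed.

End square_integrable.

(** As e >= 2, each exponential is at most 1/4. This is the budget that brings the norm of g(d) -
    g(-d) below 1. *)
Lemma expR_sum_le1 (R : realType) (a b : R) : a <= - 2 -> b <= - 2 ->
  2 * expR a + 2 * expR b <= 1.
Proof.
have e1 : expR (- 1) <= 2^-1 :> R.
  by rewrite expRN lef_pV2 ?posrE ?expR_gt0// (le_trans _ (expR_ge1Dx _))//; lra.
have e2 : expR (- 2) <= 4^-1 :> R.
  have -> : - 2 = - 1 + - 1 :> R by ring.
  have -> : 4^-1 = 2^-1 * 2^-1 :> R by field.
  by rewrite expRD; apply: ler_pM; rewrite ?expR_ge0.
rewrite -(ler_expR a) -(ler_expR b); lra.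
Qed.

(** * L^2 estimates of the packet and of its residual *)

Section packet_norm.
Context {R : realType} {n : nat}.
Variables (Q B C : 'M[R]_n) (mu : probability 'cV[R]_n R).
Hypothesis Qsym : Q^T = Q.
Hypothesis Csym : C^T = C.
Hypothesis lyapunov : forall x, dotv (C *m x) (B^T *m x) = - (2^-1 * dotv (Q *m x) x).
Hypothesis exp_integrable : forall a,
  mu.-integrable [set: 'cV[R]_n] (EFin \o (fun x => expR (dotv a x))).
Hypothesis mean_wave : forall a b th, \int[mu]_x wave a b th x =
  expR (2^-1 * (dotv (C *m a) a - dotv (C *m b) b)) * cos (dotv (C *m a) b + th).
Local Notation A := B^T.
Local Notation flow := (flow B).
Local Notation ip := (ip C).
Local Notation E := 'cV[R]_n.

Variables (al be : E) (sr si kap d : R).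
Hypothesis d0 : 0 < d.
Local Notation als := (flow al).
Local Notation bes := (flow be).
(* normalized so that |g(0)|^2 has mean expR (2 * kap) *)
Let k0 := kap - 2^-1 * (ip al al + ip be be).
Local Notation beam := (beam B C al be sr si k0).
Local Notation packet := (packet B C al be sr si k0 d).
Local Notation packet_image := (packet_image B C al be sr si k0 d).
Local Notation lnamp := (lnamp B C al be sr k0).
Local Notation arg := (arg B C al be si).

(** A product of exponentials is an exponential, and [mu] integrates them all. Expanding one factor
    of the square of [exp_dom] then gives its square integrability. *)
Let integrable_expM_dom a c :
  mu.-integrable [set: E] (EFin \o (fun x => expR (dotv a x) * exp_dom c x)).
Proof.
have := integrableRD (exp_integrable a) (integrableR_sum (index_enum 'I_n) measurableT
  (fun i => integrableRD (exp_integrable (a + (c * n%:R) *: delta_mx i 0))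
                         (exp_integrable (a - (c * n%:R) *: delta_mx i 0)))).
apply: eq_integrableR => x; rewrite /exp_dom mulrDr mulr1; congr (_ + _).
rewrite mulr_sumr; apply: eq_bigr => i _.
by rewrite mulrDr !dotvDl !expRD.
Qed.

Let sqint_exp_dom c : sqint mu (exp_dom c : E -> R).
Proof.
have mS : measurable_fun [set: E] (exp_dom c : E -> R).
  have := integrable_expM_dom 0 c => /integrableR_measurable.
  rewrite (_ : (fun x => _) = (exp_dom c : E -> R))//.
  by apply/funext => x; rewrite dotv0l expR0 mul1r.
split => //.
have := integrableRD (integrable_expM_dom 0 c) (integrableR_sum (index_enum 'I_n) measurableT
  (fun i => integrableRD (integrable_expM_dom ((c * n%:R) *: delta_mx i 0) c)
                         (integrable_expM_dom (- ((c * n%:R) *: delta_mx i 0)) c))).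
apply: eq_integrableR => x; rewrite expr2 [X in _ = X * _]/exp_dom mulrDl dotv0l expR0; congr (_ + _).
by rewrite mulr_suml; apply: eq_bigr => i _; rewrite mulrDl.
Qed.

Let dd : - d <= d.
Proof. by rewrite (@le_trans _ _ 0) ?oppr_le0// ltW. Qed.

Let measurable_beams th s : measurable_fun [set: E] (beam th s).
Proof. by apply: continuous_measurable_cV; exact: continuous_beam. Qed.

Let sqint_beam th s : - d <= s <= d -> sqint mu (beam th s).
Proof.
have [M [c [M0 Hb]]] := beam_le Qsym Csym lyapunov al be sr si k0 d.
move=> sd; apply: le_sqint (sqintZ M (sqint_exp_dom c)) => //.
by move=> x; exact: Hb.
Qed.

(** Measurability in x is a by-product of Fubini; the size is at most the length 2 d of the time
    interval times the common bound of the beams. *)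
Lemma packet_sqint th : sqint mu (packet th).
Proof.
have [M [c [M0 Hb]]] := beam_le Qsym Csym lyapunov al be sr si k0 d.
have [_ Ie] := sqintZ M (sqint_exp_dom c).
have ie : mu.-integrable [set: E] (EFin \o (fun x => M * exp_dom c x)).
  apply: integrableRZ; have := integrable_expM_dom 0 c; apply: eq_integrableR => x.
  by rewrite dotv0l expR0 mul1r.
have e0 (x : E) : 0 <= exp_dom c x := exp_dom_ge0 c x.
have cb x : continuous (fun s => beam th s x).
  by move=> s; exact: has_deriv_continuous (has_deriv_beam Qsym Csym lyapunov al be sr si k0 th s x).
have mp : measurable_fun [set: E] (packet th).
  apply: (@integrableR_measurable _ _ _ mu).
  apply: (integrable_Rintegral_itv (F := beam th) (D := fun x => M * exp_dom c x)) => //.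
  - exact: (measurable_beam Qsym Csym lyapunov).
  - by move=> s x; exact: Hb.
  - by move=> x; rewrite mulr_ge0.
apply: (@le_sqint _ _ _ _ _ (fun x => (2 * d * M) * exp_dom c x)) => //; last exact: sqintZ.
move=> x; rewrite /packet.
have ib := continuous_integrable_itv (- d) d (cb x).
apply: le_trans; first by apply: le_normr_Rintegral.
have ci : (@lebesgue_measure R).-integrable `[- d, d] (EFin \o (fun=> M * exp_dom c x)).
  by apply: continuous_integrable_itv => s; exact: cst_continuous.
apply: (@le_trans _ _ (\int[lebesgue_measure]_(s in `[- d, d]) (M * exp_dom c x))).
  apply: le_Rintegral => //; first exact: integrable_norm.
  by move=> s; rewrite /= in_itv /= => sd; exact: Hb.
rewrite Rintegral_cst//= lebesgue_measure_itv /= lte_fin ifT; last by rewrite (lt_trans _ d0)// oppr_lt0.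
by rewrite -EFinB /= opprK; lra.
Qed.

Lemma packet_image_sqint th : sqint mu (packet_image th).
Proof.
apply: sqintB; last by apply: sqintZ; exact: packet_sqint.
apply: sqintB; last by apply: sqintZ; exact: packet_sqint.
by apply: sqintB; apply: sqint_beam; rewrite lexx dd.
Qed.

Local Notation ph := (- (pi / 2)).

Let beam_prod s s' x : beam 0 s x * beam 0 s' x + beam ph s x * beam ph s' x =
  expR (lnamp s x + lnamp s' x) * cos (arg s x - arg s' x).
Proof.
have P (a : R) : cos (a - pi / 2) = sin a.
  by rewrite cosB cos_pihalf sin_pihalf mulr0 mulr1 add0r.
rewrite /beam; move: (arg s x) (arg s' x) (lnamp s x) (lnamp s' x) => a b l l'.
rewrite (P a) (P b) (addr0 a) (addr0 b) cosB expRD; ring.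
Qed.

Let ip_sub u v : ip (u + v) (u + v) = ip u u + 2 * ip u v + ip v v.
Proof. by rewrite !ipDl !ipDr (ipC Csym v u); ring. Qed.

(** The integrand is the real part of g(s) times the conjugate of g(0): up to a constant factor, a
    single wave of frequency als + al + i (bes - be), whose mean is known. *)
Lemma beam_product_mean s : \int[mu]_x (beam 0 s x * beam 0 0 x + beam ph s x * beam ph 0 x) =
  expR (2 * kap) * (expR (phase_re B C sr al be s) * cos (phase_im B C si al be s)).
Proof.
pose c1 := lnamp0 B C al be sr k0 s + lnamp0 B C al be sr k0 0.
pose c2 := si * s - ip (als s) (bes s) + ip al be.
transitivity (\int[mu]_x (expR c1 * wave (als s + al) (bes s - be) c2 x)).
  apply: eq_Rintegral => x _; rewrite beam_prod /wave mulrA -expRD; congr (expR _ * cos _).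
    by rewrite /lnamp flow0 dotvDl /c1 addrACA.
  by rewrite /arg !flow0 dotvBl mulr0 /c2; ring.
rewrite RintegralZl//; last first.
  apply: le_integrableR (exp_integrable (als s + al)); first exact: measurable_wave.
  by move=> x; exact: wave_le.
rewrite mean_wave mulrA -!expRD mulrA -expRD.
rewrite -[dotv (C *m (als s + al)) (als s + al)]/(ip _ _) -[dotv (C *m (bes s - be)) _]/(ip _ _).
rewrite -[dotv (C *m (als s + al)) _]/(ip _ _) !ip_sub ipDl !ipDr !ipNl !ipNr opprK.
congr (expR _ * cos _).
  by rewrite /c1 /lnamp0 /phase_re !flow0 /k0; field.
by rewrite /c2 /phase_im (ipC Csym al (bes s)); ring.
Qed.

(** Up to a constant factor, |g(s)|^2 is the real exponential of frequency 2 als. *)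
Lemma beam_square_mean s : \int[mu]_x (beam 0 s x ^+ 2 + beam ph s x ^+ 2) =
  expR (2 * kap + weight B C sr al be s).
Proof.
pose c1 := lnamp0 B C al be sr k0 s.
transitivity (\int[mu]_x (expR (2 * c1) * wave (2 *: als s) 0 0 x)).
  apply: eq_Rintegral => x _; rewrite !expr2 beam_prod subrr cos0 mulr1.
  rewrite /wave dotv0l addr0 cos0 mulr1 -expRD /lnamp dotvZl -/c1; congr expR; ring.
rewrite RintegralZl//; last first.
  apply: le_integrableR (exp_integrable (2 *: als s)); first exact: measurable_wave.
  by move=> x; exact: wave_le.
rewrite mean_wave mulmx0 dotv0l dotv0r addr0 cos0 mulr1 -expRD; congr expR.
rewrite -[dotv _ _]/(ip _ _) ipZl ipZr /c1 /lnamp0 /weight /k0; by field.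
Qed.

Definition cpacket (x : E) : R[i] := (packet 0 x +i* packet ph x)%C.
Definition cpacket_image (x : E) : R[i] := (packet_image 0 x +i* packet_image ph x)%C.

Lemma cpacket_OU_L2 : OU_L2 Q B mu cpacket cpacket_image.
Proof.
split.
- by apply: sqint_in_L2; exact: packet_sqint.
- by apply: sqint_in_L2; exact: packet_image_sqint.
move=> phi [K [cK _ tphi]].
have li th := packet_locally_integrable Qsym Csym lyapunov al be sr si k0 d th cK.
rewrite (OU_distr_of Q B (f := cpacket) cK tphi (li 0) (li ph)).
by congr (_ +i* _)%C; exact: packet_weak_identity cK tphi d0 _.
Qed.

Lemma packet_half x : packet (pi / 2) x = - packet ph x.
Proof.
transitivity (-1 * packet ph x); last by rewrite mulN1r.
rewrite /packet -RintegralZl//.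
  apply: eq_Rintegral => s _; rewrite mulN1r -beam_quarter2; congr beam.
  by rewrite addNr add0r.
apply: continuous_integrable_itv => s.
exact: has_deriv_continuous (has_deriv_beam Qsym Csym lyapunov al be sr si k0 ph s x).
Qed.

Lemma cpacket_resolvent x : cpacket_image x - (- (sr +i* si))%C * cpacket x =
  ((beam 0 d x - beam 0 (- d) x) +i* (beam ph d x - beam ph (- d) x))%C.
Proof.
apply/eqP; rewrite eq_complex /= /packet_image add0r packet_half addNr.
move: (beam 0 d x - _) (beam ph d x - _) (packet 0 x) (packet ph x) => a b u v.
by apply/andP; split; apply/eqP; ring.
Qed.

(** Cauchy-Schwarz against g(0), whose squared norm is exp(2 kap): by Fubini the real part of <u,
    g(0)> is exp(2 kap) times the integral that J minorizes. *)
Lemma normL2_cpacket (J : R) : 0 <= J ->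
  J <= \int[lebesgue_measure]_(s in `[- d, d])
    (expR (phase_re B C sr al be s) * cos (phase_im B C si al be s)) ->
  ((expR kap * J)%:E <= normL2 mu cpacket)%E.
Proof.
move=> J0 HJ.
have s0 : - d <= 0 <= d by rewrite oppr_le0 ltW.
have Hp th := packet_sqint th; have Hb th := sqint_beam th s0.
have ip2 : mu.-integrable [set: E] (EFin \o sqmod cpacket).
  exact: (integrableRD (Hp 0).2 (Hp ph).2).
rewrite (normL2E ip2) lee_fin -[leLHS]ger0_norm ?mulr_ge0 ?expR_ge0//.
rewrite -sqrtr_sqr ler_sqrt; last by apply: Rintegral_ge0 => x _; rewrite addr_ge0 ?sqr_ge0.
set J1 := \int[lebesgue_measure]_(s in _) _ in HJ.
have ipr : mu.-integrable [set: E] (EFin \o (fun x => packet 0 x * beam 0 0 x + packet ph x * beam ph 0 x)).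
  by apply: integrableRD; exact: sqintM_integrable.
have ib2 : mu.-integrable [set: E] (EFin \o (fun x => beam 0 0 x ^+ 2 + beam ph 0 x ^+ 2)).
  exact: (integrableRD (Hb 0).2 (Hb ph).2).
have EJ : \int[mu]_x (packet 0 x * beam 0 0 x + packet ph x * beam ph 0 x) = expR (2 * kap) * J1.
  have [M [c [M0 Hbd]]] := beam_le Qsym Csym lyapunov al be sr si k0 d.
  have e0 (x : E) : 0 <= M * exp_dom c x by rewrite mulr_ge0 ?exp_dom_ge0.
  have cb th x : continuous (fun s => beam th s x).
    by move=> s; exact: has_deriv_continuous (has_deriv_beam Qsym Csym lyapunov al be sr si k0 th s x).
  have icb th x := continuous_integrable_itv (- d) d (cb th x).
  transitivity (\int[mu]_x \int[lebesgue_measure]_(s in `[- d, d])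
     (beam 0 s x * beam 0 0 x + beam ph s x * beam ph 0 x)).
    apply: eq_Rintegral => x _; rewrite RintegralD//; first last.
    - apply: continuous_integrable_itv => s.
      exact: (continuousM (cb ph x s) (@cst_continuous R R (beam ph 0 x) s)).
    - apply: continuous_integrable_itv => s.
      exact: (continuousM (cb 0 x s) (@cst_continuous R R (beam 0 0 x) s)).
    by rewrite !RintegralZr.
  have [_ Ie] := sqintZ M (sqint_exp_dom c).
  rewrite (@Rintegral_itvC _ _ _ mu
    (fun s x => beam 0 s x * beam 0 0 x + beam ph s x * beam ph 0 x) _ _
    (fun x => 2 * (M * exp_dom c x) ^+ 2)); first last.
  - exact: integrableRZ.
  - by move=> x; rewrite mulr_ge0// sqr_ge0.
  - move=> s x sd; rewrite (le_trans (ler_normD _ _))// mulr_natl mulr2n expr2.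
    by apply: lerD; rewrite normrM; apply: ler_pM; rewrite ?normr_ge0// Hbd.
  - have mb th := measurable_beam Qsym Csym lyapunov al be sr si k0 th.
    have mb0 th : measurable_fun [set: measurableTypeR R * E] (fun p => beam th 0 p.2).
      by have := measurableT_comp (@measurable_beams th 0) (@measurable_snd _ _ (measurableTypeR R) E).
    exact: measurable_funD (measurable_funM (mb 0) (mb0 0)) (measurable_funM (mb ph) (mb0 ph)).
  rewrite /J1 -RintegralZl//; last first.
    have c1 : continuous (fun s => expR (phase_re B C sr al be s)).
      move=> s; apply: (@continuous_comp _ _ _ (phase_re B C sr al be) expR); last exact: continuous_expR.
      apply: has_deriv_continuous; apply: has_derivB; last exact: has_deriv_cst.
      apply: has_derivD; first exact: has_deriv_mull.
      by apply: has_derivD; exact: has_deriv_ip_flow.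
    have c2 : continuous (fun s => cos (phase_im B C si al be s)).
      move=> s; apply: (@continuous_comp _ _ _ (phase_im B C si al be) cos); last exact: continuous_cos.
      apply: has_deriv_continuous; apply: has_derivD; first exact: has_deriv_mull.
      by apply: has_derivB; exact: has_deriv_ip_flow.
    by apply: continuous_integrable_itv => s; exact: (continuousM (c1 s) (c2 s)).
  by apply: eq_Rintegral => s _; exact: beam_product_mean.
have EM : \int[mu]_x (beam 0 0 x ^+ 2 + beam ph 0 x ^+ 2) = expR (2 * kap).
  by rewrite beam_square_mean /weight !flow0 mulr0 add0r subrr addr0.
(* |u - J g(0)|^2 has a nonnegative mean *)
have : 0 <= \int[mu]_x (sqmod cpacket x - 2 * J * (packet 0 x * beam 0 0 x + packet ph x * beam ph 0 x)
    + J ^+ 2 * (beam 0 0 x ^+ 2 + beam ph 0 x ^+ 2)).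
  apply: Rintegral_ge0 => x _.
  rewrite /sqmod /=; move: (packet 0 x) (packet ph x) (beam 0 0 x) (beam ph 0 x) => a b c e.
  have := sqr_ge0 (a - J * c); have := sqr_ge0 (b - J * e); lra.
have i1 := integrableRZ (2 * J) ipr; have i2 := integrableRZ (J ^+ 2) ib2.
rewrite RintegralD//; last exact: integrableRB.
rewrite RintegralB// !RintegralZl// EJ EM exprMn.
have -> : expR kap ^+ 2 = expR (2 * kap) by rewrite expr2 -expRD; congr expR; ring.
have e0 := expR_gt0 (2 * kap); have := ler_wpM2l (ltW e0) HJ => H1.
have := ler_wpM2l J0 H1; rewrite !expr2; lra.
Qed.

(** The residual is g(d) - g(-d), and |v - w|^2 <= 2 |v|^2 + 2 |w|^2, with both means given by
    [beam_square_mean]. *)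
Lemma normL2_cpacket_resolvent : 2 * kap + weight B C sr al be d <= - 2 ->
  2 * kap + weight B C sr al be (- d) <= - 2 ->
  (normL2 mu (fun x => cpacket_image x - (- (sr +i* si))%C * cpacket x)%R <= 1)%E.
Proof.
move=> H1 H2.
have -> : (fun x => cpacket_image x - (- (sr +i* si))%C * cpacket x)%R =
    fun x => ((beam 0 d x - beam 0 (- d) x) +i* (beam ph d x - beam ph (- d) x))%C.
  by apply/funext => x; exact: cpacket_resolvent.
have s1 : - d <= d <= d by rewrite lexx dd.
have s2 : - d <= - d <= d by rewrite lexx dd.
have Hb1 th := sqint_beam th s1; have Hb2 th := sqint_beam th s2.
set f := (f in normL2 mu f).
have If : mu.-integrable [set: E] (EFin \o sqmod f).
  exact: (integrableRD (sqintB (Hb1 0) (Hb2 0)).2 (sqintB (Hb1 ph) (Hb2 ph)).2).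
pose N s x := beam 0 s x ^+ 2 + beam ph s x ^+ 2.
have i1 : mu.-integrable [set: E] (EFin \o N d) := integrableRD (Hb1 0).2 (Hb1 ph).2.
have i2 : mu.-integrable [set: E] (EFin \o N (- d)) := integrableRD (Hb2 0).2 (Hb2 ph).2.
have j1 := integrableRZ 2 i1; have j2 := integrableRZ 2 i2.
have fN x : sqmod f x <= 2 * N d x + 2 * N (- d) x.
  rewrite /sqmod /N /=.
  move: (beam 0 d x) (beam 0 (- d) x) (beam ph d x) (beam ph (- d) x) => a b c e.
  rewrite -subr_ge0 (_ : _ - _ = (a + b) ^+ 2 + (c + e) ^+ 2); last by ring.
  by rewrite addr_ge0 ?sqr_ge0.
have E1 : \int[mu]_x N d x = expR (2 * kap + weight B C sr al be d) := beam_square_mean d.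
have E2 : \int[mu]_x N (- d) x = expR (2 * kap + weight B C sr al be (- d)) := beam_square_mean (- d).
rewrite (normL2E If) lee_fin -[leRHS]sqrtr1 ler_sqrt//.
move: N i1 i2 j1 j2 fN E1 E2 => N i1 i2 j1 j2 fN E1 E2.
apply: (@le_trans _ _ (\int[mu]_x (2 * N d x + 2 * N (- d) x))).
  by apply: (le_Rintegral measurableT If (integrableRD j1 j2)) => x _; exact: fN.
rewrite (RintegralD measurableT j1 j2) (RintegralZl 2 measurableT i1) (RintegralZl 2 measurableT i2).
rewrite E1 E2; exact: (expR_sum_le1 H1 H2).
Qed.

End packet_norm.

(** The exponential dominates a power of t of degree m = N + 2: N factors cancel t^-N, one cancels
    the 1/t of the algebraic factor, and one is left to diverge. *)
Lemma exp_growth (R : realType) (g d k : R) (N : nat) : 0 < g -> 0 < d -> 0 < k ->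
  exists2 c, 0 < c & forall t, 1 <= t ->
    c * t <= expR (2^-1 * (g * t) - 5 / 4) * (d / (2 * (1 + k * t * d ^+ 2))) * t ^- N.
Proof.
move=> g0 d0 k0; set m := N.+2.
have m0 : 0 < m%:R :> R by rewrite ltr0n.
pose b := g / 2 / m%:R; have b0 : 0 < b by rewrite !divr_gt0.
pose h := 1 + k * d ^+ 2.
have h0 : 0 < h by rewrite addr_gt0// mulr_gt0// exprn_gt0.
have e0 := expR_gt0 (- (5 / 4) : R).
exists (expR (- (5 / 4)) * b ^+ m * (d / (2 * h))).
  apply: mulr_gt0; first by rewrite mulr_gt0 ?exprn_gt0.
  by rewrite divr_gt0// mulr_gt0.
move=> t t1; have t0 : 0 < t by lra.
have E1 : (b * t) ^+ m <= expR (2^-1 * (g * t)).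
  have -> : 2^-1 * (g * t) = m%:R * (b * t) by rewrite /b; field; rewrite gt_eqF.
  have bt0 : 0 <= b * t by rewrite mulr_ge0 ?ltW.
  rewrite expRM_natl lerXn2r ?nnegrE ?expR_ge0//.
  by rewrite (le_trans _ (expR_ge1Dx _))// lerDr.
have H2 : d / (2 * h) / t <= d / (2 * (1 + k * t * d ^+ 2)).
  rewrite -mulrA -invfM ler_wpM2l ?(ltW d0)// lef_pV2 ?posrE.
  - have -> : 2 * h * t = 2 * (t + k * t * d ^+ 2) by rewrite /h; ring.
    by rewrite ler_wpM2l// lerD2r.
  - by rewrite !mulr_gt0.
  - by rewrite mulr_gt0// addr_gt0// !mulr_gt0// exprn_gt0.
have tN : 0 <= t ^- N by rewrite invr_ge0 exprn_ge0// ltW.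
have -> : expR (- (5 / 4)) * b ^+ m * (d / (2 * h)) * t =
    expR (- (5 / 4)) * (b * t) ^+ m * (d / (2 * h) / t) * t ^- N.
  have -> : (b * t) ^+ m = b ^+ m * (t * t * t ^+ N).
    by rewrite exprMn; congr (_ * _); rewrite /m !exprS mulrA.
  have hn := lt0r_neq0 h0; have tn := lt0r_neq0 t0; have tNn := expf_neq0 N tn.
  move: (expR _) (b ^+ m) (t ^+ N) tNn => e bm tN' tNn; clearbody h; field.
  by rewrite hn tn tNn.
rewrite ler_wpM2r//; apply: ler_pM => //.
- by rewrite mulr_ge0 ?exprn_ge0 ?mulr_ge0 ?expR_ge0// ltW.
- by rewrite !divr_ge0 ?mulr_ge0 ?ltW.
by rewrite addrC expRD ler_wpM2l// ltW.
Qed.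

Theorem theorem2p5 (R : realType) (n : nat) (hn : (0 < n)%N)
  (Q B : 'M[R]_n)
  (Qsym : Q^T = Q) (Qpsd : forall x : 'cV[R]_n, 0 <= dotv (Q *m x) x)
  (hypo : OU_hypoelliptic Q B) (degenerate : \det Q = 0)
  (mu : probability 'cV[R]_n R) (inv : OU_invariant Q B mu)
  (z : R[i]) (hz : 0 < complex.Re z) (N : nat) :
  (resolvent_norm mu (OU_L2 Q B mu)
     (- ((2^-1 * \tr B)%:C + t%:C * z))%R * (t ^- N)%:E)%E
    @[t --> +oo%R] --> +oo%E.
Proof.
have [C [Csym Clim]] := Qinf_exists Qsym Qpsd inv.
have lyapunov := Qinf_lyapunov Qpsd Csym Clim.
have C_gt0 := @Qinf_gt0 _ _ _ _ _ Qsym Qpsd inv _ Clim.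
have expi := integrable_exp_dotv Qsym Qpsd inv Clim.
have mean := Rintegral_wave Qsym Qpsd inv Clim.
have [eta [Qeta QAeta]] := degenerate_bracket Qsym degenerate
  (fun x => @Qt_gt0 _ _ _ _ _ Qsym Qpsd inv 1 x ltr01).
set tau := 2^-1 * \tr B.
have [al [be [k [d [g [[k0 d0 g0 taud] Hre Him Hw1 Hw2]]]]]] :=
  phase_geometry Qsym Qpsd Csym C_gt0 lyapunov Qeta QAeta (complex.Im z) tau hz.
have bound t : 1 <= t ->
  ((expR (2^-1 * (g * t) - 5 / 4) * (d / (2 * (1 + k * t * d ^+ 2))))%:E <=
   resolvent_norm mu (OU_L2 Q B mu) (- (tau%:C + t%:C * z))%R)%E.
  move=> t1; have t0 : 0 < t by exact: lt_le_trans ltr01 t1.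
  (* On the spectrum the norm is infinite by convention; elsewhere the packet is a competitor in the
     supremum. *)
  rewrite /resolvent_norm; case: ifP => _; last exact: leey.
  (* frequencies of size sqrt t: every quadratic phase gets multiplied by t *)
  pose r := Num.sqrt t; have rr : r * r = t by rewrite -expr2 sqr_sqrtr// ltW.
  pose sr := tau + t * complex.Re z; pose si := t * complex.Im z.
  (* The largest normalization compatible with a residual of norm at most 1: 2 kap = g t - 5/2, the
     weight at either end contributes at most - g t, and 2 tau s at most 1/2, so the exponent is at
     most - 2. *)
  pose kap := 2^-1 * (g * t) - 5 / 4.
  have ipr u v : ip C (r *: u) (r *: v) = t * ip C u v.
    by rewrite ipZl ipZr mulrA rr.
  have Pre s : phase_re B C sr (r *: al) (r *: be) s = tau * s + t * phase_re B C (complex.Re z) al be s.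
    by rewrite /phase_re !flowZ !ipr /sr; ring.
  have Pim s : phase_im B C si (r *: al) (r *: be) s = t * phase_im B C (complex.Im z) al be s.
    by rewrite /phase_im !flowZ !ipr /si; ring.
  have W s : weight B C sr (r *: al) (r *: be) s = 2 * (tau * s) + t * weight B C (complex.Re z) al be s.
    by rewrite /weight !flowZ !ipr /sr; ring.
  have lamE : - (tau%:C + t%:C * z) = (- (sr +i* si))%C.
    by apply/eqP; rewrite eq_complex /sr /si; case: (z) => a b /=; rewrite !mul0r subr0 addr0 add0r !eqxx.
  have taud' : `|tau * d| <= 4^-1 by rewrite normrM (gtr0_norm d0).
  have /andP[td1 td2] : - 4^-1 <= tau * d <= 4^-1 by rewrite -ler_norml.
  (* The norm of the packet lies between the two sides: it is bounded below by the oscillatory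
     integral and above by the supremum. *)
  apply: (@le_trans _ _ (normL2 mu (cpacket B C (r *: al) (r *: be) sr si kap d))).
    have HJ : 0 <= d / (2 * (1 + k * t * d ^+ 2)).
      by rewrite divr_ge0 ?(ltW d0)// mulr_ge0// addr_ge0// !mulr_ge0 ?ltW// exprn_gt0.
    apply: (normL2_cpacket Qsym Csym lyapunov expi mean kap d0 HJ).
    under eq_Rintegral => s _ do rewrite Pre Pim.
    apply: oscillatory_lower_bound => //.
      move=> s; apply: has_deriv_continuous; apply: has_derivB; last exact: has_deriv_cst.
      apply: has_derivD; first exact: has_deriv_mull.
      by apply: has_derivD; exact: has_deriv_ip_flow.
    move=> s; apply: has_deriv_continuous; apply: has_derivD; first exact: has_deriv_mull.
    by apply: has_derivB; exact: has_deriv_ip_flow.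
  apply: ereal_sup_ubound; exists (cpacket B C (r *: al) (r *: be) sr si kap d),
    (cpacket_image B C (r *: al) (r *: be) sr si kap d); split => //.
    exact: (cpacket_OU_L2 Qsym Csym lyapunov expi).
  rewrite lamE; apply: (normL2_cpacket_resolvent Qsym Csym lyapunov expi mean si d0); rewrite W /kap.
    move: (weight B C (complex.Re z) al be d) (ler_wpM2l (ltW t0) Hw1) => w; clear -td1 td2; lra.
  move: (weight B C (complex.Re z) al be (- d)) (ler_wpM2l (ltW t0) Hw2) => w; clear -td1 td2; lra.
have [c c0 Hc] := exp_growth N g0 d0 k0.
apply/cvgeyPge => M; near=> t.
have t1 : 1 <= t by near: t; apply: nbhs_pinfty_ge; exact: num_real.
apply: (@le_trans _ _ (c * t)%:E).
  by rewrite lee_fin -ler_pdivrMl//; near: t; apply: nbhs_pinfty_ge; exact: num_real.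
apply: (@le_trans _ _ ((expR (2^-1 * (g * t) - 5 / 4) * (d / (2 * (1 + k * t * d ^+ 2)))) * t ^- N)%:E).
  by rewrite lee_fin Hc.
rewrite EFinM lee_wpmul2r ?bound// lee_fin invr_ge0 exprn_ge0//; lra.
Unshelve. all: by end_near. Qed.
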